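(* Let $X\colon\Sigma^n\to\mathbb{R}^{n+1}$ be an $n$-dimensional, complete, weakly convex self-shrinker of the Gaussian curvature flow, i.e. $K=-\langle X,N\rangle$. If $$\sup_{\Sigma^n}\|A\|^2<\infty\quad\text{and}\quad\sup_{\Sigma^n}HK<n,$$ then $\Sigma^n$ is a hyperplane in $\mathbb{R}^{n+1}$.
   Context: $X\colon\Sigma^n\to\mathbb{R}^{n+1}$ is a smooth isometric immersion of a connected $n$-dimensional Riemannian manifold without boundary, with a continuous globally defined unit normal field $N$. ''$\Sigma^n$ is a hyperplane'' means that its image $X(\Sigma^n)$ is a hyperplane. The shape operator is $A(Y)=-\overline{\nabla}_Y N$, with $\overline\nabla$ the Levi-Civita connection of $\mathbb{R}^{n+1}$; its eigenvalues $k_1,\dots,k_n$ are the principal curvatures, and $\|A\|^2=\operatorname{trace}(A^2)$. $H=k_1+\cdots+k_n$ is the mean curvature and $K=k_1\cdots k_n$ the Gauss-Kronecker curvature. The convention on $N$ is that on closed hypersurfaces (e.g. spheres) $N$ points inward. Weakly convex means that $A$ is positive semidefinite. A self-shrinker of the Gaussian curvature flow is a hypersurface satisfying $K=-\langle X,N\rangle$, where $X$ is the position vector. *)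

(* Defs.v *)
From HB Require Import structures.
From mathcomp Require Import all_boot all_order all_algebra.
From mathcomp Require Import all_classical all_reals all_analysis.

Set Implicit Arguments.
Unset Strict Implicit.
Unset Printing Implicit Defensive.

Import Order.TTheory GRing.Theory Num.Theory.
Import numFieldNormedType.Exports.

Local Open Scope classical_set_scope.
Local Open Scope ring_scope.

(* Vectors are row vectors and matrices act on the right: if f is
   differentiable at u then 'D_v f u = v *m 'J f u, so row i of 'J f u is the
   i-th partial derivative of f at u.  The sup norm carried by 'rV[R]_n is used
   only for its topology; lengths and angles come from [dot] and from the
   Riemannian metric. *)

Definition dot (R : realType) (m : nat) (u v : 'rV[R]_m) : R :=
  \sum_i u 0 i * v 0 i.

(* [U] is meant to be open: values of [f] outside [U] are then irrelevant. *)
Fixpoint Ck_on (R : realType) (V W : normedModType R) (k : nat) (U : set V)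
    (f : V -> W) : Prop :=
  (forall x, U x -> {for x, continuous f}) /\
  if k is k'.+1 then
    forall v, (forall x, U x -> derivable f x v) /\ Ck_on k' U ('D_v f)
  else True.

Definition smooth_on (R : realType) (V W : normedModType R) (U : set V)
    (f : V -> W) : Prop := forall k, Ck_on k U f.

Record chart (R : realType) (n : nat) (T : topologicalType) := Chart {
  source : set T;
  target : set 'rV[R]_n;
  chart_coord : T -> 'rV[R]_n;
  chart_param : 'rV[R]_n -> T;
  source_open : open source;
  target_open : open target;
  coord_target : forall p, source p -> target (chart_coord p);
  param_source : forall u, target u -> source (chart_param u);
  coordK : forall p, source p -> chart_param (chart_coord p) = p;
  paramK : forall u, target u -> chart_coord (chart_param u) = u;
  coord_continuous : forall p, source p -> {for p, continuous chart_coord};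
  param_continuous : forall u, target u -> {for u, continuous chart_param} }.

(* A smooth manifold without boundary.  The atlas need not be maximal.
   [chart_at p] is a preferred chart around p; it serves only to identify the
   tangent space at p with 'rV[R]_n, by means of its coordinate basis. *)
Record smoothManifold (R : realType) (n : nat) := SmoothManifold {
  manifold_sort :> topologicalType;
  atlas : set (chart R n manifold_sort);
  chart_at : manifold_sort -> chart R n manifold_sort;
  chart_at_atlas : forall p, atlas (chart_at p);
  chart_at_source : forall p, source (chart_at p) p;
  atlas_smooth : forall c d, atlas c -> atlas d ->
    smooth_on (target c `&` chart_param c @^-1` source d)
      (chart_coord d \o chart_param c);
  manifold_hausdorff : hausdorff_space manifold_sort;
  manifold_second_countable : @second_countable manifold_sort }.

Section Manifold.
Context {R : realType} {n : nat} (M : smoothManifold R n).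

(* A connected manifold is nonempty by convention, whereas [connected] holds of
   the empty set. *)
Definition connected_manifold : Prop :=
  [set: M] !=set0 /\ connected [set: M].

Definition smooth_map (m : nat) (f : M -> 'rV[R]_m) : Prop :=
  forall c, atlas c -> smooth_on (target c) (f \o chart_param c).

(* Row i is df_p applied to the i-th tangent vector of [chart_at p]. *)
Definition differential (m : nat) (f : M -> 'rV[R]_m) (p : M) : 'M[R]_(n, m) :=
  'J (f \o chart_param (chart_at p)) (chart_coord (chart_at p) p).

(* Row i is the i-th tangent vector of the chart [c] at [chart_param c u],
   written in the basis of the tangent space at that point. *)
Definition chart_frame (c : chart R n M) (u : 'rV[R]_n) : 'M[R]_n :=
  'J (chart_coord (chart_at (chart_param c u)) \o chart_param c) u.

(* [metric p] is the Gram matrix of the scalar product on the tangent space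
   at p; smoothness is smoothness of the Gram matrix in every chart. *)
Record riemannianMetric := RiemannianMetric {
  metric :> M -> 'M[R]_n;
  metric_sym : forall p, (metric p)^T = metric p;
  metric_pos : forall p (v : 'rV[R]_n), v != 0 ->
    0 < dot (v *m metric p) v;
  metric_smooth : forall c, atlas c ->
    smooth_on (target c) (fun u =>
      chart_frame c u *m metric (chart_param c u) *m (chart_frame c u)^T) }.

Definition C1_curve (gamma : R -> M) : Prop :=
  continuous gamma /\
  forall c, atlas c ->
    Ck_on (V := R^o) 1 (gamma @^-1` source c) (chart_coord c \o gamma).

Definition velocity (gamma : R -> M) (t : R) : 'rV[R]_n :=
  derive1 (chart_coord (chart_at (gamma t)) \o gamma) t.

Definition speed (g : riemannianMetric) (gamma : R -> M) (t : R) : R :=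
  Num.sqrt (dot (velocity gamma t *m g (gamma t)) (velocity gamma t)).

Definition curve_length (g : riemannianMetric) (gamma : R -> M) : \bar R :=
  (\int[lebesgue_measure]_(t in `[0%R, 1%R]) (speed g gamma t)%:E)%E.

Definition riemannian_dist (g : riemannianMetric) (p q : M) : \bar R :=
  ereal_inf [set curve_length g gamma | gamma in
    [set gamma | [/\ C1_curve gamma, gamma 0 = p & gamma 1 = q]]].

Definition complete_manifold (g : riemannianMetric) : Prop :=
  forall x : nat -> M,
    (forall e : R, 0 < e -> exists K : nat, forall i j : nat,
      (K <= i)%N -> (K <= j)%N -> (riemannian_dist g (x i) (x j) < e%:E)%E) ->
    exists p : M, forall e : R, 0 < e -> exists K : nat, forall i : nat,
      (K <= i)%N -> (riemannian_dist g (x i) p < e%:E)%E.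

Definition isometric_immersion (g : riemannianMetric)
    (X : M -> 'rV[R]_n.+1) : Prop :=
  [/\ smooth_map X,
      forall p, row_free (differential X p) &
      forall p (v w : 'rV[R]_n),
        dot (v *m differential X p) (w *m differential X p) =
        dot (v *m g p) w].

Definition unit_normal_field (X N : M -> 'rV[R]_n.+1) : Prop :=
  [/\ continuous N,
      forall p, dot (N p) (N p) = 1 &
      forall p (v : 'rV[R]_n), dot (N p) (v *m differential X p) = 0].

(* The map A with dX (A v) = - dN v for every tangent vector v.  The image of
   dN lies in that of dX and dX is injective, so this is the unique matrix S
   with S *m differential X p = - differential N p. *)
Definition shape_operator (X N : M -> 'rV[R]_n.+1) (p : M) : 'M[R]_n :=
  - differential N p *m pinvmx (differential X p).

Lemma shape_operatorE (X N : M -> 'rV[R]_n.+1) (p : M) :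
  (differential N p <= differential X p)%MS ->
  shape_operator X N p *m differential X p = - differential N p.
Proof. by move=> NX; rewrite mulmxKpV // eqmx_opp. Qed.

(* The eigenvalues of the shape operator with multiplicity, in some order; they
   exist because the shape operator is self-adjoint for the metric. *)
Definition principal_curvatures (X N : M -> 'rV[R]_n.+1) (p : M) : 'rV[R]_n :=
  xget 0 [set k : 'rV[R]_n |
    char_poly (shape_operator X N p) = \prod_i ('X - (k 0 i)%:P)].

Definition mean_curvature (X N : M -> 'rV[R]_n.+1) (p : M) : R :=
  \sum_i principal_curvatures X N p 0 i.

Definition gauss_kronecker (X N : M -> 'rV[R]_n.+1) (p : M) : R :=
  \prod_i principal_curvatures X N p 0 i.

Definition shape_norm2 (X N : M -> 'rV[R]_n.+1) (p : M) : R :=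
  \tr (shape_operator X N p *m shape_operator X N p).

Definition weakly_convex (g : riemannianMetric) (X N : M -> 'rV[R]_n.+1)
    : Prop :=
  forall p (v : 'rV[R]_n), 0 <= dot (v *m shape_operator X N p *m g p) v.

Definition gauss_self_shrinker (X N : M -> 'rV[R]_n.+1) : Prop :=
  forall p, gauss_kronecker X N p = - dot (X p) (N p).

End Manifold.

Definition hyperplane (R : realType) (m : nat) (P : set 'rV[R]_m) : Prop :=
  exists (a : 'rV[R]_m) (b : R), a != 0 /\ P = [set x | dot x a = b].

(* Main.v *)
Require Import Defs.
From mathcomp Require Import all_boot all_order all_algebra all_fingroup.
From mathcomp Require Import all_classical all_reals all_analysis.
From mathcomp Require Import measurable_realfun ring lra.

(** The curvature is K = - <X, N>.  The proof shows that K vanishes identically,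
and then that a complete hypersurface whose position vector is everywhere tangent
is a hyperplane.

Both steps see the hypersurface as a graph over the tangent hyperplane at a point
p.  Let F q be the orthogonal projection of X q - X p to that hyperplane.  It is a
local homeomorphism where <N q, N p> > 0, and since it shrinks tangent vectors at
most by the factor <N q, N p>, completeness makes it possible to lift a segment
issued from 0 as long as this factor stays away from 0 along the lift.  The lifts
form a continuous section of F over an open star-shaped set
([radial_section], [projection_section]).

Vanishing of K.  By weak convexity and the bound on the second fundamental form, K
is nonnegative and bounded; suppose that its supremum is positive.  The bound
|A| <= C makes the normal turn slowly, so that the section is defined on a disc of
radius 1 / (4 C) around every p ([short_ray_angle]).  If K p is close to the
supremum, K minus a small multiple mu of |F|^2 / 2 has an interior maximum on this
disc.  There, K = - <X, N> is differentiated twice along the principal directions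
and the second order conditions are summed with the weights
P_i = \prod_(j != i) k_j.  Since P_i k_i = K, this produces K (n - H K); the third
derivatives of X combine, by Jacobi's formula for the determinant of the shape
operator, into the derivative of K along the tangential part of X, which
at the maximum is \sum_j k_j <X, e_j>^2 >= 0.  Hence
K (n - H K) <= mu * constant ([shrinker_local_inequality], [penalized_maximum]),
which contradicts sup H K < n as mu tends to 0 ([shrinker_flat]).

The case K = 0.  Now <X, N> = 0, and differentiating this shows that the shape
operator kills X.  Along the lift of the segment from p towards the origin, X runs
straight to the origin and N is constant ([flat_ray]), so that the lift ends at a
point o with X o = 0.  All rays from o lift to straight lines as well; the section
at o is therefore defined on the whole tangent space, and its image is open and
closed in the connected hypersurface ([cone_hyperplane]). *)

Set Implicit Arguments.
Unset Strict Implicit.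
Unset Printing Implicit Defensive.

Import Order.TTheory GRing.Theory Num.Theory.
Import numFieldNormedType.Exports.

Local Open Scope classical_set_scope.
Local Open Scope ring_scope.

(** * Limits of matrices *)

Lemma near_open (T : topologicalType) (x : T) (P : T -> Prop) :
  (\forall y \near x, P y) ->
  exists2 B : set T, open B /\ B x & forall y, B y -> P y.
Proof. by rewrite /prop_near1 nbhsE => -[B [oB Bx] BP]; exists B. Qed.

Section MatrixLimits.
Context {R : realType}.

Lemma mx_entry_le m n (A : 'M[R]_(m, n)) i j : `|A i j| <= `|A|.
Proof.
rewrite [leRHS]/Num.Def.normr/= mx_normrE.
by apply: le_trans; last exact: (le_bigmax _ _ (i, j)).
Qed.

Lemma mx_norm_le m n (A : 'M[R]_(m, n)) (e : R) :
  0 <= e -> (forall i j, `|A i j| <= e) -> `|A| <= e.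
Proof.
move=> e0 Ae; rewrite [leLHS]/Num.Def.normr/= mx_normrE.
by apply: bigmax_le => // -[i j] _; exact: Ae.
Qed.

Lemma cvg_mxP (T : Type) (F : set_system T) {FF : Filter F} m n
    (f : T -> 'M[R]_(m, n)) (l : 'M[R]_(m, n)) :
  f x @[x --> F] --> l <-> forall i j, f x i j @[x --> F] --> l i j.
Proof.
split=> [fl i j|fl].
  exact: (cvg_comp _ _ fl (@coord_continuous R m n i j l)).
apply/cvgrPdist_le => /= e e0.
have H : \forall x \near F, forall ij : 'I_m * 'I_n,
    `|l ij.1 ij.2 - f x ij.1 ij.2| <= e.
  by apply: filter_forall => ij; exact: ((cvgrPdist_le _ _).1 (fl ij.1 ij.2)).
apply: filterS H => x H; apply: mx_norm_le (ltW e0) _ => i j; rewrite !mxE.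
exact: (H (i, j)).
Qed.

Lemma cvg_mx (T : Type) (F : set_system T) {FF : Filter F} m n
    (f : T -> 'M[R]_(m, n)) (l : 'M[R]_(m, n)) :
  (forall i j, f x i j @[x --> F] --> l i j) -> f x @[x --> F] --> l.
Proof. by move=> fl; apply/cvg_mxP. Qed.

Lemma mx_norm_mulmx m n p (A : 'M[R]_(m, n)) (B : 'M[R]_(n, p)) :
  `|A *m B| <= n%:R * `|A| * `|B|.
Proof.
apply: mx_norm_le => [|i j]; first by rewrite !mulr_ge0.
rewrite mxE (le_trans (ler_norm_sum _ _ _))//.
apply: (@le_trans _ _ (\sum_(k < n) `|A| * `|B|)).
  by apply: ler_sum => k _; rewrite normrM ler_pM// mx_entry_le.
by rewrite sumr_const card_ord -mulrA mulr_natl.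
Qed.

Lemma cvg_near_le (T : Type) (F : set_system T) {FF : Filter F}
    (W : normedModType R) (f : T -> W) (l : W) (e : R) :
  f x @[x --> F] --> l -> 0 < e -> \forall x \near F, `|l - f x| <= e.
Proof. by move=> /cvgrPdist_le fl e0; exact: fl. Qed.

Section Cvg.
Context (T : Type) (F : set_system T) {FF : Filter F}.

Lemma cvg_prodr (I : Type) (r : seq I) (P : pred I) (f : I -> T -> R) (l : I -> R) :
  (forall i, P i -> f i x @[x --> F] --> l i) ->
  \prod_(i <- r | P i) f i x @[x --> F] --> \prod_(i <- r | P i) l i.
Proof.
move=> fl; elim: r => [|i r IH].
  by under eq_cvg do rewrite big_nil; rewrite big_nil; exact: cvg_cst.
under eq_cvg do rewrite big_cons; rewrite big_cons.
case: ifPn => // Pi; apply: cvgM IH; exact: fl.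
Qed.

Lemma cvg_sumr (I : Type) (r : seq I) (P : pred I) (f : I -> T -> R) (l : I -> R) :
  (forall i, P i -> f i x @[x --> F] --> l i) ->
  \sum_(i <- r | P i) f i x @[x --> F] --> \sum_(i <- r | P i) l i.
Proof.
move=> fl; elim: r => [|i r IH].
  by under eq_cvg do rewrite big_nil; rewrite big_nil; exact: cvg_cst.
under eq_cvg do rewrite big_cons; rewrite big_cons.
case: ifPn => // Pi; apply: cvgD IH; exact: fl.
Qed.

Lemma cvg_mulmx m n p (A : T -> 'M[R]_(m, n)) (B : T -> 'M[R]_(n, p))
    (a : 'M[R]_(m, n)) (b : 'M[R]_(n, p)) :
  A x @[x --> F] --> a -> B x @[x --> F] --> b ->
  A x *m B x @[x --> F] --> a *m b.
Proof.
move=> /cvg_mxP Aa /cvg_mxP Bb; apply/cvg_mxP => i j.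
under eq_cvg do rewrite mxE.
rewrite mxE; apply: cvg_sumr => k _; exact: cvgM.
Qed.

Lemma cvg_trmx m n (A : T -> 'M[R]_(m, n)) (a : 'M[R]_(m, n)) :
  A x @[x --> F] --> a -> (A x)^T @[x --> F] --> a^T.
Proof.
move=> /cvg_mxP Aa; apply/cvg_mxP => i j.
by under eq_cvg do rewrite mxE; rewrite mxE; exact: Aa.
Qed.

Lemma cvg_det n (A : T -> 'M[R]_n) (a : 'M[R]_n) :
  A x @[x --> F] --> a -> \det (A x) @[x --> F] --> \det a.
Proof.
move=> /cvg_mxP Aa; rewrite /determinant.
apply: cvg_sumr => s _; apply: cvgM; first exact: cvg_cst.
by apply: cvg_prodr => i _; exact: Aa.
Qed.

Lemma cvg_adj n (A : T -> 'M[R]_n) (a : 'M[R]_n) :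
  A x @[x --> F] --> a -> \adj (A x) @[x --> F] --> \adj a.
Proof.
move=> /cvg_mxP Aa; apply/cvg_mxP => i j; rewrite !mxE.
under eq_cvg do rewrite mxE.
apply: cvgM; first exact: cvg_cst.
apply: cvg_det; apply/cvg_mxP => k l.
under eq_cvg do rewrite !mxE.
by rewrite !mxE; exact: Aa.
Qed.

Lemma cvg_invmx n (A : T -> 'M[R]_n) (a : 'M[R]_n) : a \in unitmx ->
  A x @[x --> F] --> a -> invmx (A x) @[x --> F] --> invmx a.
Proof.
move=> ua Aa; have da : \det a != 0 by rewrite -unitfE -unitmxE.
have dA := cvg_det Aa.
rewrite /invmx ua.
apply: (@cvg_trans _ (((\det (A x))^-1 *: \adj (A x)) @[x --> F])).
  apply: near_eq_cvg; near=> x.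
  suff -> : A x \in unitmx by [].
  rewrite unitmxE unitfE; near: x.
  by have /cvgr_neq0 := dA; apply.
by apply: cvgZ; [exact: cvgV|exact: cvg_adj].
Unshelve. all: by end_near. Qed.

(** The matrix of the system is invertible along the filter because its
determinant has a nonzero limit; the limit of the solution is then read off
Cramer's formula.  This is how derivatives of implicitly defined vectors are
obtained below: their difference quotients solve linear systems. *)
Lemma cvg_solve n p (M : T -> 'M[R]_n) (x c : T -> 'M[R]_(p, n))
    (M0 : 'M[R]_n) (c0 : 'M[R]_(p, n)) :
  M0 \in unitmx -> M t @[t --> F] --> M0 -> c t @[t --> F] --> c0 ->
  (\forall t \near F, x t *m M t = c t) ->
  x t @[t --> F] --> c0 *m invmx M0.
Proof.
move=> uM MM0 cc0 xM.
apply: (@cvg_trans _ ((c t *m invmx (M t)) @[t --> F])); last first.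
  by apply: cvg_mulmx => //; exact: cvg_invmx.
apply: near_eq_cvg; near=> t.
have <- : x t *m M t = c t by near: t.
rewrite mulmxK// unitmxE unitfE; near: t.
have /cvgr_neq0 := cvg_det MM0; apply.
by rewrite -unitfE -unitmxE.
Unshelve. all: by end_near. Qed.

End Cvg.
End MatrixLimits.

(** * Directional calculus and local inversion *)

Section DirectionalCalculus.
Context {R : realType} {V : normedModType R}.
Implicit Types (f : V -> R) (x v w : V) (U : set V).

Lemma continuous_of_dist (T : topologicalType) (W : normedModType R) (g : T -> W) (x : T) :
  (forall e : R, 0 < e -> \forall y \near x, `|g x - g y| <= e) ->
  {for x, continuous g}.
Proof. by move=> H; apply/cvgrPdist_le => e e0; exact: H. Qed.

Lemma near_dist_le x (e : R) : 0 < e -> \forall y \near x, `|x - y| <= e.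
Proof.
move=> e0; apply/nbhs_ballP; exists e => // y.
by rewrite -ball_normE /ball_/= => /ltW.
Qed.

Lemma is_derive_line (W : normedModType R) (g : V -> W) x v (t : R) (d : W) :
  is_derive (t *: v + x) v g d ->
  is_derive t 1 (fun h : R => g (h *: v + x)) d.
Proof.
move=> [dg <-].
have E : (fun h : R => h^-1 *: (((fun h : R => g (h *: v + x)) \o shift t) (h *: (1 : R))
    - g (t *: v + x))) = (fun h => h^-1 *: ((g \o shift (t *: v + x)) (h *: v) - g (t *: v + x))).
  apply/funext => h /=; rewrite [_%:A]mulr1 scalerDl addrA //.
by split; rewrite /derivable /derive E.
Qed.

Lemma is_derive_dirZ (W : normedModType R) (g : V -> W) x v (k : R) (d : W) :
  is_derive x v g d -> is_derive x (k *: v) g (k *: d).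
Proof.
have [->|k0] := eqVneq k 0; first by rewrite !scale0r => _; exact: is_derive0.
move=> [dg <-].
have C : k *: (h^-1 *: ((g \o shift x) (h *: v) - g x)) @[h --> (0:R)^'] --> k *: 'D_v g x.
  by apply: cvgZr; exact: dg.
have D : h * k @[h --> (0:R)^'] --> (0:R)^'.
  move=> A [e /= e0 eA]; exists (e / `|k|); first by rewrite /= divr_gt0// normr_gt0.
  move=> h /=; rewrite !sub0r !normrN ltr_pdivlMr ?normr_gt0// => hk h0.
  by apply: eA; rewrite /= ?sub0r ?normrN ?normrM// mulf_neq0.
have E := cvg_comp _ _ D C.
have E2 : h^-1 *: ((g \o shift x) (h *: (k *: v)) - g x) @[h --> (0:R)^'] --> k *: 'D_v g x.
  apply: cvg_trans E; apply: near_eq_cvg; near=> h => /=.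
  have h0 : h != 0 by near: h; exact: nbhs_dnbhs_neq.
  by rewrite !scalerA invfM mulrCA divff// mulr1.
by split; [apply/cvg_ex; eexists; exact: E2|exact/cvg_lim].
Unshelve. all: by end_near. Qed.

Lemma mvt_line_open f x v :
  (forall t : R, 0 <= t <= 1 -> derivable f (t *: v + x) v) ->
  exists2 c : R, 0 < c < 1 & f (v + x) - f x = 'D_v f (c *: v + x).
Proof.
move=> df; pose g (h : R) := f (h *: v + x).
have dg (t : R) : 0 <= t <= 1 -> is_derive t 1 g ('D_v f (t *: v + x)).
  by move=> /df/derivableP/is_derive_line.
have [c c01] : exists2 c, c \in `]0, 1[%R & g 1 - g 0 = 'D_v f (c *: v + x) * (1 - 0).
  apply: (@MVT R g (fun t => 'D_v f (t *: v + x))) => //.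
    move=> t; rewrite in_itv/= => /andP[t0 t1].
    by apply: dg; rewrite !ltW.
  apply: derivable_within_continuous => t; rewrite in_itv/= => t01.
  by have [] := dg _ t01.
rewrite subr0 mulr1 /g scale1r scale0r add0r => E.
by exists c => //; move: c01; rewrite in_itv.
Qed.

Lemma mvt_line f x v :
  (forall t : R, 0 <= t <= 1 -> derivable f (t *: v + x) v) ->
  exists2 c : R, 0 <= c <= 1 & f (v + x) - f x = 'D_v f (c *: v + x).
Proof.
move=> /mvt_line_open[c /andP[c0 c1] E].
by exists c => //; rewrite !ltW.
Qed.

(** Directional derivatives only, as in the successive stages of [Ck_on];
Frechet differentiability follows in finite dimension. *)
Definition C1_on (W : normedModType R) U (f : V -> W) :=
  (forall x v, U x -> derivable f x v) /\
  (forall v x, U x -> {for x, continuous ('D_v f)}).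

Lemma near_parallelogram U x v w : open U -> U x ->
  \forall h \near (0 : R), forall c d : R, 0 <= c <= 1 -> 0 <= d <= 1 ->
    U (c *: (h *: v) + (d *: (h *: w) + x)).
Proof.
move=> oU Ux; have /nbhs_ballP[r /= r0 rU] := open_nbhs_nbhs (conj oU Ux).
have vw : 0 < `|v| + `|w| + 1 by rewrite ltr_wpDl// addr_ge0.
exists (r / (`|v| + `|w| + 1)); first by rewrite /= divr_gt0.
move=> h /=; rewrite sub0r normrN ltr_pdivlMr// => hr c d /andP[c0 c1] /andP[d0 d1].
apply: rU; rewrite -ball_normE /ball_/= addrA opprD addrCA subrr addr0 normrN.
apply: le_lt_trans hr; rewrite (le_trans (ler_normD _ _))// !normrZ mulrDr mulrDr.
rewrite -[leLHS]addr0 lerD// ?mulr1//  lerD//.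
  by rewrite ger0_norm// ler_piMl// mulr_ge0.
by rewrite ger0_norm// ler_piMl// mulr_ge0.
Qed.

Lemma near_line U x (v w : V) : open U -> U x ->
  \forall h \near (0 : R), forall c : R, 0 <= c <= 1 ->
    U (c *: (h *: v) + (h *: w + x)).
Proof.
move=> oU Ux; apply: filterS (near_parallelogram v w oU Ux) => h H c c01.
by have := H c 1 c01; rewrite scale1r lexx ler01; apply.
Qed.

(** The increment along h (v + w) is split at h w; the mean value theorem turns
the part along h v into a value of the continuous function 'D_v f near x. *)
Lemma derive_dirD U f x v w : open U -> C1_on U f -> U x ->
  'D_(v + w) f x = 'D_v f x + 'D_w f x.
Proof.
move=> oU [df cf] Ux.
apply: cvg_lim => //.
have dw : h^-1 *: ((f \o shift x) (h *: w) - f x) @[h --> (0:R)^'] --> 'D_w f x by exact: df.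
apply/cvgrPdist_le => /= e e0; have e20 : 0 < e / 2 by rewrite divr_gt0.
have N3 : \forall h \near (0 : R)^',
    `|'D_w f x - h^-1 *: ((f \o shift x) (h *: w) - f x)| <= e / 2.
  exact: cvg_near_le dw e20.
have N1 : \forall h \near (0:R), forall c : R, 0 <= c <= 1 ->
    U (c *: (h *: v) + (h *: w + x)) by exact: near_line.
have [B [oB Bx] BE] : exists2 B, open B /\ B x & forall y, B y -> `|'D_v f x - 'D_v f y| <= e / 2.
  by apply: near_open; exact: cvg_near_le (cf v x Ux) e20.
have N2 : \forall h \near (0:R), forall c : R, 0 <= c <= 1 ->
    B (c *: (h *: v) + (h *: w + x)) by exact: near_line.
near=> h.
have h0 : h != 0 by near: h; exact: nbhs_dnbhs_neq.
have Uh : forall c : R, 0 <= c <= 1 -> U (c *: (h *: v) + (h *: w + x)).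
  by near: h; exact: nbhs_dnbhs.
have Bh : forall c : R, 0 <= c <= 1 -> B (c *: (h *: v) + (h *: w + x)).
  by near: h; exact: nbhs_dnbhs.
have H3 : `|'D_w f x - h^-1 *: ((f \o shift x) (h *: w) - f x)| <= e / 2 by near: h.
have [c c01 E] : exists2 c : R, 0 <= c <= 1 &
    f (h *: v + (h *: w + x)) - f (h *: w + x) = 'D_(h *: v) f (c *: (h *: v) + (h *: w + x)).
  apply: mvt_line => c c01.
  by have [] := is_derive_dirZ h (derivableP (df _ v (Uh c c01))).
have := derive_val (is_derive := is_derive_dirZ h (derivableP (df _ v (Uh c c01)))).
rewrite -E => {}E.
have -> : (f \o shift x) (h *: (v + w)) - f x =
   h *: 'D_v f (c *: (h *: v) + (h *: w + x)) + ((f \o shift x) (h *: w) - f x).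
  by rewrite -E /= scalerDr -[h *: v + h *: w + x]addrA; ring.
rewrite scalerDr (scalerK h0) opprD addrACA (le_trans (ler_normD _ _))//.
by rewrite (splitr e) lerD// BE//; exact: Bh.
Unshelve. all: by end_near. Qed.

Lemma derive_entry m n (g : V -> 'M[R]_(m, n)) x v i j :
  derivable g x v -> 'D_v (fun y => g y i j) x = 'D_v g x i j.
Proof. by move=> dg; rewrite derive_mx// mxE. Qed.

Lemma C1_entry m n U (g : V -> 'M[R]_(m, n)) i j : open U -> C1_on U g ->
  C1_on U (fun x => g x i j).
Proof.
move=> oU [dg cg]; split=> [x v Ux|v x Ux].
  exact: (derivable_mxP _ _ _).1 (dg x v Ux) i j.
change ('D_v (fun y => g y i j) y @[y --> x] --> 'D_v (fun y => g y i j) x).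
rewrite derive_entry; last exact: dg.
have /cvg_mxP/(_ i j) := cg v x Ux; apply: cvg_trans.
apply: near_eq_cvg; near=> y; rewrite derive_entry//; apply: dg.
by near: y; exact: open_nbhs_nbhs.
Unshelve. all: by end_near. Qed.

Lemma differentiable_of_remainder (W : normedModType R) (g : V -> W)
    (df : {linear V -> W}) x : continuous df ->
  (forall e : R, 0 < e -> \forall h \near (0 : V),
     `|g (h + x) - g x - df h| <= e * `|h|) ->
  differentiable g x /\ 'd g x = df :> (V -> W).
Proof.
move=> cdf gdf.
have E : g \o shift x = cst (g x) + df +o_ 0 id.
  apply/eqaddoP => e e0; apply: filterS (gdf e e0) => h.
  by rewrite !fctE /= opprD addrA.
have D := diff_unique cdf E.
by split=> //; apply/diff_locallyP; rewrite D.
Qed.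

End DirectionalCalculus.

Section RowCalculus.
Context {R : realType} {n : nat}.
Implicit Types (f : 'rV[R]_n -> R) (U : set 'rV[R]_n) (x u v : 'rV[R]_n).

Notation "''e_' i" := (delta_mx 0 i : 'rV[R]_n) (at level 8, format "''e_' i").

Lemma derive_dir_sum U f x v : open U -> C1_on U f -> U x ->
  'D_v f x = \sum_i v 0 i * 'D_('e_i) f x.
Proof.
move=> oU C Ux; rewrite {1}(row_sum_delta v).
elim/big_ind2 : _ => [|a b c d <- <-|i _]; first exact: derive0.
  exact: (@derive_dirD _ _ U).
by have [_ ->] := is_derive_dirZ (v 0 i) (derivableP (C.1 x 'e_i Ux)).
Qed.

(** The mean value theorem on the segment from v to u: the partial derivatives at
the intermediate point differ little from those at x0. *)
Lemma strict_diff_scalar U f x0 (e : R) : open U -> C1_on U f -> U x0 -> 0 < e ->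
  exists2 r : R, 0 < r & forall u v, ball x0 r u -> ball x0 r v ->
    `|f u - f v - \sum_i (u - v) 0 i * 'D_('e_i) f x0| <= e * `|u - v|.
Proof.
move=> oU C Ux0 e0; pose d := e / n.+1%:R.
have d0 : 0 < d by rewrite divr_gt0.
have H1 : \forall y \near x0, forall i : 'I_n,
    `|'D_('e_i) f x0 - 'D_('e_i) f y| <= d.
  have H0 : forall i : 'I_n, \forall y \near x0, `|'D_('e_i) f x0 - 'D_('e_i) f y| <= d.
    by move=> i; exact: cvg_near_le (C.2 'e_i x0 Ux0) d0.
  exact: filter_forall H0.
have H : nbhs x0 (fun y => U y /\ forall i : 'I_n, `|'D_('e_i) f x0 - 'D_('e_i) f y| <= d).
  by apply: filterI => //; exact: open_nbhs_nbhs.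
have /nbhs_ballP[r /= r0 rU] := H.
exists r => // u v; rewrite -ball_normE /ball_/= => ru rv.
have K (t : R) : 0 <= t <= 1 -> ball x0 r (t *: (u - v) + v).
  move=> /andP[t0 t1]; rewrite -ball_normE /ball_/=.
  have -> : x0 - (t *: (u - v) + v) = t *: (x0 - u) + (1 - t) *: (x0 - v).
    by apply/rowP => i; rewrite !mxE; ring.
  rewrite (le_lt_trans (ler_normD _ _))// !normrZ !ger0_norm ?subr_ge0//.
  have -> : r = t * r + (1 - t) * r by ring.
  have [->|t1'] := eqVneq t 1; first by rewrite subrr !mul0r !addr0 !mul1r.
  apply: ler_ltD; first by rewrite ler_wpM2l// ltW.
  by rewrite ltr_pM2l// subr_gt0 lt_neqAle t1'.
have [c c01] : exists2 c : R, 0 <= c <= 1 &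
    f ((u - v) + v) - f v = 'D_(u - v) f (c *: (u - v) + v).
  by apply: mvt_line => t t01; apply: C.1; have [] := rU _ (K t t01).
have [Uc Dc] := rU _ (K c c01).
rewrite subrK => ->; rewrite (derive_dir_sum _ oU C Uc) -sumrB.
rewrite (le_trans (ler_norm_sum _ _ _))//.
apply: (@le_trans _ _ (\sum_(i < n) d * `|u - v|)).
  apply: ler_sum => i _; rewrite -mulrBr normrM mulrC ler_pM//.
    by rewrite distrC.
  exact: mx_entry_le.
rewrite sumr_const card_ord -mulr_natl mulrA ler_wpM2r//.
by rewrite /d mulrCA ler_piMr ?(ltW e0)// ler_pdivrMr// mul1r ler_nat.
Qed.

Section VectorValued.
Context {m : nat}.
Implicit Types (g : 'rV[R]_n -> 'rV[R]_m).

Let jac g x : 'M[R]_(n, m) := \matrix_i ('D_('e_i) g x).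

Let strict_diff_jac U g x0 (e : R) : open U -> C1_on U g -> U x0 -> 0 < e ->
  exists2 r : R, 0 < r & forall u v, ball x0 r u -> ball x0 r v ->
    `|g u - g v - (u - v) *m jac g x0| <= e * `|u - v|.
Proof.
move=> oU C Ux0 e0.
have /choice[r Hr] (j : 'I_m) : exists r : R, 0 < r /\ forall u v, ball x0 r u -> ball x0 r v ->
    `|g u 0 j - g v 0 j - \sum_i (u - v) 0 i * 'D_('e_i) (fun x => g x 0 j) x0| <= e * `|u - v|.
  by have [r r0 H] := strict_diff_scalar oU (C1_entry 0 j oU C) Ux0 e0; exists r.
pose r0 : R := \big[Order.min/1]_j r j.
have r00 : 0 < r0 by apply/lt_bigmin; [exact: ltr01|move=> j _; have [] := Hr j].
exists r0 => // u v ru rv; apply: mx_norm_le => [|i j]; first by rewrite mulr_ge0// ltW.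
rewrite (ord1 i) {i}; have rj : r0 <= r j by exact: bigmin_le_cond.
have [_ /(_ u v (le_ball rj ru) (le_ball rj rv))] := Hr j.
rewrite !mxE; congr (`|_ - _ - _| <= _); apply: eq_bigr => i _.
by rewrite [X in _ = _ * X]mxE derive_entry//; exact: C.1.
Qed.

Lemma C1_differentiable U g x : open U -> C1_on U g -> U x ->
  differentiable g x.
Proof.
move=> oU C Ux; apply: (@differentiable_of_remainder _ _ _ _ (mulmxr (jac g x)) x _ _).1.
  move=> u; apply: (@cvg_mulmx _ _ (nbhs u) _ _ _ _ id (cst (jac g x))); [exact: cvg_id|exact: cvg_cst].
move=> e e0; have [r r0 H] := strict_diff_jac oU C Ux e0.
apply/nbhs_ballP; exists r => //= h; rewrite -ball_normE /ball_/= sub0r normrN => hr.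
have := H (h + x) x; rewrite addrK; apply; last exact: ballxx.
by rewrite -ball_normE /ball_/= opprD addrCA subrr addr0 normrN.
Qed.

Lemma jacobianE U g x i j : open U -> C1_on U g -> U x ->
  'J g x i j = 'D_('e_i) g x 0 j.
Proof.
move=> oU C Ux; rewrite deriveEjacobian; last exact: C1_differentiable C Ux.
by rewrite -rowE [RHS]mxE.
Qed.

Lemma C1_jacobian_continuous U g x : open U -> C1_on U g -> U x ->
  {for x, continuous (fun y => 'J g y)}.
Proof.
move=> oU C Ux; apply: (@cvg_mx _ _ (nbhs x) (nbhs_filter x)) => i j.
have H : 'D_('e_i) g y 0 j @[y --> nbhs x] --> 'D_('e_i) g x 0 j.
  exact: (cvg_mxP _ _).1 (C.2 'e_i x Ux) 0 j.
rewrite -[l in _ --> l](jacobianE i j oU C Ux) in H.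
apply: cvg_trans H; apply: near_eq_cvg.
apply: filterS (open_nbhs_nbhs (conj oU Ux)) => y Uy.
exact: esym (jacobianE i j oU C Uy).
Qed.

Lemma strict_diff U g x0 (e : R) : open U -> C1_on U g -> U x0 -> 0 < e ->
  exists2 r : R, 0 < r & forall u v, ball x0 r u -> ball x0 r v ->
    `|g u - g v - (u - v) *m 'J g x0| <= e * `|u - v|.
Proof.
move=> oU C Ux0 e0; have [r r0 H] := strict_diff_jac oU C Ux0 e0.
exists r => // u v ru rv; suff -> : 'J g x0 = jac g x0 by exact: H.
by apply/matrixP => i j; rewrite (jacobianE i j oU C Ux0) !mxE.
Qed.

(** Strict differentiability, with a tolerance that absorbs the norm of the left
inverse of the Jacobian. *)
Lemma immersion_near_id U g x0 : open U -> C1_on U g -> U x0 ->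
  row_free ('J g x0) ->
  exists r : R, [/\ 0 < r, ball x0 r `<=` U & forall u v, ball x0 r u -> ball x0 r v ->
    `|(g u - g v) *m pinvmx ('J g x0) - (u - v)| <= 2^-1 * `|u - v|].
Proof.
move=> oU C Ux0 fJ; set P := pinvmx _.
have e0 : 0 < (2 * (m%:R * `|P| + 1))^-1.
  by rewrite invr_gt0 mulr_gt0// ltr_wpDl// mulr_ge0.
have [r r0 H] := strict_diff oU C Ux0 e0.
have /nbhs_ballP[r' /= r'0 rU] := open_nbhs_nbhs (conj oU Ux0).
exists (Order.min r r'); split; first by rewrite lt_min r0.
  by apply: subset_trans rU; apply: le_ball; rewrite ge_min lexx orbT.
have rr : Order.min r r' <= r by rewrite ge_min lexx.
move=> u v /(le_ball rr) ru /(le_ball rr) rv.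
have -> : (g u - g v) *m P - (u - v) = (g u - g v - (u - v) *m 'J g x0) *m P.
  by rewrite [RHS]mulmxBl mulmxKp.
rewrite (le_trans (mx_norm_mulmx _ _))//.
apply: (@le_trans _ _ (m%:R * `|P| * ((2 * (m%:R * `|P| + 1))^-1 * `|u - v|))).
  by rewrite mulrAC ler_wpM2l ?mulr_ge0//; exact: H.
rewrite mulrA ler_wpM2r// invfM mulrCA ler_piMr// ler_pdivrMr ?mul1r.
  by rewrite lerDl.
by rewrite ltr_wpDl// mulr_ge0.
Qed.

(** Applying the left inverse of the Jacobian costs at most its norm. *)
Lemma immersion_chord U g x0 : open U -> C1_on U g -> U x0 ->
  row_free ('J g x0) ->
  exists r c : R, [/\ 0 < r, 0 < c, ball x0 r `<=` U & forall u v, ball x0 r u -> ball x0 r v ->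
    c * `|u - v| <= `|g u - g v|].
Proof.
move=> oU C Ux0 fJ; have [r [r0 rU H]] := immersion_near_id oU C Ux0 fJ.
set P := pinvmx _ in H; pose q := 2 * (m%:R * `|P| + 1).
have q0 : 0 < q by rewrite mulr_gt0// ltr_wpDl// mulr_ge0.
exists r, q^-1; split => //; first by rewrite invr_gt0.
move=> u v ru rv; rewrite ler_pdivrMl//.
have := H u v ru rv; set d := u - v; set w := g u - g v => Hd.
have Pw : `|w *m P| <= m%:R * `|P| * `|w|.
  by rewrite (le_trans (mx_norm_mulmx _ _))// mulrAC.
have : `|d| <= `|w *m P| + 2^-1 * `|d|.
  rewrite -{1}(subKr (w *m P) d) (le_trans (ler_normB _ _))//.
  by rewrite lerD2l.
have -> : q * `|w| = 2 * (m%:R * `|P| * `|w|) + 2 * `|w| by rewrite /q; ring.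
have := normr_ge0 w; lra.
Qed.

End VectorValued.

(** The preimage of w is a minimum point c of |(g u - w) P| on a closed ball,
P being the inverse of the Jacobian: if the residual d at c were not zero, the
Newton step c + d would at least halve it. *)
Lemma local_inverse U (g : 'rV[R]_n -> 'rV[R]_n) x0 : open U -> C1_on U g -> U x0 ->
  'J g x0 \in unitmx ->
  exists (r e : R) (s : 'rV[R]_n -> 'rV[R]_n),
  [/\ 0 < r, 0 < e, ball x0 r `<=` U,
      forall u v, ball x0 r u -> ball x0 r v -> g u = g v -> u = v &
      forall w : 'rV[R]_n, ball (g x0) e w -> [/\ ball x0 r (s w), g (s w) = w &
        {for w, continuous s}]].
Proof.
move=> oU C Ux0 uJ; have fJ : row_free ('J g x0) by rewrite row_free_unit.
have [r [r0 rU H]] := immersion_near_id oU C Ux0 fJ.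
set P := pinvmx _ in H; pose k : R := n%:R * `|P| + 1.
have k0 : 0 < k by rewrite ltr_wpDl// mulr_ge0.
have Hk (w : 'rV[R]_n) : `|w *m P| <= k * `|w|.
  rewrite (le_trans (mx_norm_mulmx _ _))// mulrAC ler_wpM2r//.
  by rewrite lerDl.
have Hd u v : ball x0 r u -> ball x0 r v -> `|u - v| <= 2 * `|(g u - g v) *m P|.
  move=> ru rv; have := H u v ru rv; set d := u - v; set w := _ *m P => Hd.
  have : `|d| <= `|w| + 2^-1 * `|d|.
    rewrite -{1}(subKr w d) (le_trans (ler_normB _ _))//.
    by rewrite lerD2l.
  lra.
(* 16 leaves room for the minimum point and the Newton step in the ball r / 2 *)
pose e := r / (16 * k); have e0 : 0 < e by rewrite divr_gt0// mulr_gt0.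
have ex_s (w : 'rV[R]_n) : ball (g x0) e w -> exists u, ball x0 r u /\ g u = w.
  rewrite -ball_normE /ball_/= => we.
  pose A := closed_ball x0 (r / 2); pose f u := `|(g u - w) *m P|.
  have r20 : 0 < r / 2 by rewrite divr_gt0.
  have AE u : A u <-> `|x0 - u| <= r / 2.
    by rewrite /A closed_ballE.
  have Ar u : A u -> ball x0 r u.
    move=> /AE; rewrite -ball_normE /ball_/= => /le_lt_trans; apply.
    by rewrite ltr_pdivrMr// ltr_pMr// ltr1n.
  have A0 : A !=set0 by exists x0; apply/AE; rewrite subrr normr0 ltW.
  have cA : compact A.
    apply: bounded_closed_compact; last exact: closed_ball_closed.
    exists (`|x0| + r / 2); split; first exact: num_real.
    move=> M xM u /AE ur; apply: le_trans (ltW xM).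
    by rewrite -[u in leLHS](subKr x0) (le_trans (ler_normB _ _))// lerD2l.
  have [|c Ac cmin] := @EVT_min_rV R n f A A0 cA.
    apply: continuous_in_subspaceT => u /[!inE] /Ar/rU Uu.
    have cg : {for u, continuous g}.
      exact: differentiable_continuous (C1_differentiable oU C Uu).
    apply: continuous_comp; last exact: norm_continuous.
    apply: (@cvg_mulmx _ _ (nbhs u) _ _ _ _ (fun u => g u - w) (cst P)).
      by apply: (@cvgB _ _ _ (nbhs u) _ g (cst w)) => //; exact: cvg_cst.
    exact: cvg_cst.
  move: Ac cmin => /set_mem Ac /(_ _ (mem_set _)) cmin.
  have cr := Ar _ Ac; have x0r := ballxx x0 r0.
  pose d := (w - g c) *m P.
  have fx0 : f x0 <= r / 16.
    rewrite /f (le_trans (Hk _))// -ler_pdivlMl//.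
    rewrite ltW// (lt_le_trans we)// /e invfM; lra.
  have dN : `|d| = f c by rewrite /d /f -normrN -mulNmx opprB.
  have dr : `|d| <= r / 16.
    by rewrite dN (le_trans (cmin _ _) fx0)//; apply/AE; rewrite subrr normr0 ltW.
  have cx0 : `|x0 - c| <= r / 4.
    rewrite (le_trans (Hd x0 c x0r cr))//.
    have -> : (g x0 - g c) *m P = (g x0 - w) *m P + d by rewrite /d -mulmxDl subrKA.
    have := ler_normD ((g x0 - w) *m P) d; rewrite -/(f x0); lra.
  pose u := c + d.
  have Au : A u.
    apply/AE; rewrite /u opprD addrA (le_trans (ler_normB _ _))//; lra.
  have fu : f u <= 2^-1 * `|d|.
    have := H u c (Ar _ Au) cr.
    have -> : u - c = d by rewrite /u addrAC subrr add0r.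
    by rewrite /d -mulmxBl opprB addrA subrK.
  have d0 : d = 0.
    apply/normr0_eq0; have := cmin u Au; rewrite -dN => du.
    by apply/eqP; rewrite eq_le normr_ge0 andbT; lra.
  exists c; split; first by move: cr; rewrite -ball_normE.
  apply/eqP; rewrite eq_sym -subr_eq0; apply/eqP.
  have := congr1 (fun z => z *m 'J g x0) d0.
  by rewrite /d /P pinvmxE// mulmxKV// mul0mx.
pose s (w : 'rV[R]_n) := if pselect (ball (g x0) e w) is left p then projT1 (cid (ex_s w p)) else x0.
have sP (w : 'rV[R]_n) : ball (g x0) e w -> ball x0 r (s w) /\ g (s w) = w.
  by rewrite /s; case: pselect => // p _; case: (cid _).
exists r, e, s; split => //.
  move=> u v ru rv uv; apply/eqP; rewrite -subr_eq0 -normr_le0.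
  by rewrite (le_trans (Hd _ _ ru rv))// uv subrr mul0mx normr0 mulr0.
move=> w we; have [rw gw] := sP w we; split => //.
apply: continuous_of_dist => eps eps0.
have : \forall y \near w, ball (g x0) e y /\ `|w - y| <= eps / (2 * k).
  apply: filterI; first by apply: open_nbhs_nbhs; split => //; exact: ball_open.
  by apply: (@near_dist_le _ 'rV[R]_n); rewrite divr_gt0// mulr_gt0.
apply: filterS => y [ye wy]; have [ry gy] := sP y ye.
rewrite (le_trans (Hd _ _ rw ry))// gw gy.
have := Hk (w - y); rewrite ler_pdivlMr in wy; last by rewrite mulr_gt0.
nra.
Qed.

End RowCalculus.

(** * Second derivatives and product rules *)

Section SecondOrder.
Context {R : realType} {V : normedModType R}.
Implicit Types (f : V -> R) (x v w : V) (U : set V).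

Lemma is_derive_translate (W : normedModType R) (g : V -> W) x v a (d : W) :
  is_derive (x + a) v g d -> is_derive x v (fun y => g (y + a)) d.
Proof.
move=> [dg <-].
have E : (fun h : R => h^-1 *: (((fun y => g (y + a)) \o shift x) (h *: v) - g (x + a)))
    = (fun h => h^-1 *: ((g \o shift (x + a)) (h *: v) - g (x + a))).
  by apply/funext => h /=; rewrite addrA.
by split; rewrite /derivable /derive E.
Qed.

Let second_difference U f x v w (h : R) : C1_on U f -> C1_on U ('D_v f) ->
  (forall c d : R, 0 <= c <= 1 -> 0 <= d <= 1 -> U (c *: (h *: v) + (d *: (h *: w) + x))) ->
  exists c d : R, [/\ 0 <= c <= 1, 0 <= d <= 1 &
    f (h *: v + (h *: w + x)) - f (h *: v + x) - (f (h *: w + x) - f x) =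
    h * (h * 'D_w ('D_v f) (c *: (h *: v) + (d *: (h *: w) + x)))].
Proof.
move=> C Cv HU; pose g y := f (y + h *: w) - f y.
have I0 : 0 <= (0 : R) <= 1 by rewrite lexx ler01.
have I1 : 0 <= (1 : R) <= 1 by rewrite lexx ler01.
have dg (t : R) : 0 <= t <= 1 -> is_derive (t *: (h *: v) + x) (h *: v) g
    (h *: ('D_v f (t *: (h *: v) + (h *: w + x)) - 'D_v f (t *: (h *: v) + x))).
  move=> t01; apply: is_derive_dirZ; apply: is_deriveB.
    apply: is_derive_translate.
    rewrite -addrA [x + _]addrC; apply: derivableP; apply: C.1.
    by have := HU _ _ t01 I1; rewrite scale1r.
  by apply: derivableP; apply: C.1; have := HU _ _ t01 I0; rewrite scale0r add0r.
have [|c c01 Ec] := @mvt_line _ _ g x (h *: v).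
  by move=> t /dg[].
have Dvw (d : R) : 0 <= d <= 1 ->
    is_derive (d *: (h *: w) + (c *: (h *: v) + x)) (h *: w) ('D_v f)
      (h *: 'D_w ('D_v f) (c *: (h *: v) + (d *: (h *: w) + x))).
  by move=> d01; rewrite addrCA; apply: is_derive_dirZ; apply: derivableP; apply: Cv.1; exact: HU.
have [|d d01 Ed] := @mvt_line _ _ ('D_v f) (c *: (h *: v) + x) (h *: w).
  by move=> d /Dvw[].
exists c, d; split => //.
move: Ec; rewrite /g (derive_val (is_derive := dg c c01)) -[h *: v + x + h *: w]addrA.
rewrite [x + h *: w]addrC => Ec.
have Dd := derive_val (is_derive := Dvw d d01).
rewrite Ec -[h *: (_ - _)]/(h * _); congr (h * _).
by rewrite [h * _](esym Dd) -Ed [h *: w + (_ + _)]addrCA.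
Qed.

(** Both mixed derivatives are limits of the same second difference quotient. *)
Lemma derive_symm U f x v w : open U -> U x -> C1_on U f ->
  C1_on U ('D_v f) -> C1_on U ('D_w f) ->
  'D_w ('D_v f) x = 'D_v ('D_w f) x.
Proof.
move=> oU Ux C Cv Cw; apply/eqP; rewrite -subr_eq0 -normr_le0; apply/ler_addgt0Pl => e e0.
have e20 : 0 < e / 2 by rewrite divr_gt0.
have [A [oA Ax] HA] : exists2 B, open B /\ B x & forall y, B y ->
    `|'D_w ('D_v f) x - 'D_w ('D_v f) y| <= e / 2.
  by apply: near_open; exact: cvg_near_le (Cv.2 w x Ux) e20.
have [B [oB Bx] HB] : exists2 B, open B /\ B x & forall y, B y ->
    `|'D_v ('D_w f) x - 'D_v ('D_w f) y| <= e / 2.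
  by apply: near_open; exact: cvg_near_le (Cw.2 v x Ux) e20.
pose O := U `&` (A `&` B).
have oO : open O by do 2 apply: openI => //.
have Ox : O x by [].
have N1 : \forall h \near (0 : R), forall c d : R, 0 <= c <= 1 -> 0 <= d <= 1 ->
    O (c *: (h *: v) + (d *: (h *: w) + x)) by exact: near_parallelogram.
have N2 : \forall h \near (0 : R), forall c d : R, 0 <= c <= 1 -> 0 <= d <= 1 ->
    O (c *: (h *: w) + (d *: (h *: v) + x)) by exact: near_parallelogram.
have [h [[H1 H2] h0]] : exists h : R, ((forall c d : R, 0 <= c <= 1 -> 0 <= d <= 1 ->
    O (c *: (h *: v) + (d *: (h *: w) + x))) /\
   (forall c d : R, 0 <= c <= 1 -> 0 <= d <= 1 ->
    O (c *: (h *: w) + (d *: (h *: v) + x)))) /\ h != 0.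
  apply: (@filter_ex _ ((0 : R)^')); near=> h; split; last by near: h; exact: nbhs_dnbhs_neq.
  split; near: h; exact: nbhs_dnbhs.
have [c [d [c01 d01 E1]]] : exists c d : R, [/\ 0 <= c <= 1, 0 <= d <= 1 &
    f (h *: v + (h *: w + x)) - f (h *: v + x) - (f (h *: w + x) - f x) =
    h * (h * 'D_w ('D_v f) (c *: (h *: v) + (d *: (h *: w) + x)))].
  by apply: (@second_difference U) => // c d c01 d01; have [] := H1 c d c01 d01.
have [c' [d' [c'01 d'01 E2]]] : exists c d : R, [/\ 0 <= c <= 1, 0 <= d <= 1 &
    f (h *: w + (h *: v + x)) - f (h *: w + x) - (f (h *: v + x) - f x) =
    h * (h * 'D_v ('D_w f) (c *: (h *: w) + (d *: (h *: v) + x)))].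
  by apply: (@second_difference U) => // c' d' c01' d01'; have [] := H2 c' d' c01' d01'.
have E : 'D_w ('D_v f) (c *: (h *: v) + (d *: (h *: w) + x)) =
         'D_v ('D_w f) (c' *: (h *: w) + (d' *: (h *: v) + x)).
  apply: (mulfI h0); apply: (mulfI h0); rewrite -E1 -E2 addrCA; ring.
have [_ [A1 _]] := H1 c d c01 d01.
have [_ [_ B1]] := H2 c' d' c'01 d'01.
have := HA _ A1; have := HB _ B1; rewrite E addr0.
move: ('D_v ('D_w f) _) ('D_w ('D_v f) x) ('D_v ('D_w f) x) => a b b'.
move=> h1 h2; have -> : b - b' = (b - a) - (b' - a) by ring.
by rewrite (le_trans (ler_normB _ _))// (splitr e) lerD.
Unshelve. all: by end_near. Qed.

Lemma derive_local_max U f x v : open U -> U x ->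
  (forall y, U y -> f y <= f x) -> (forall y, U y -> derivable f y v) ->
  'D_v f x = 0.
Proof.
move=> oU Ux fmax df.
have /near_open[B [oB B0] HB] : \forall h \near (0 : R), forall c d : R, 0 <= c <= 1 -> 0 <= d <= 1 ->
    U (c *: (h *: v) + (d *: (h *: 0) + x)) by exact: near_parallelogram.
have /nbhs_ballP[r /= r0 rB] := open_nbhs_nbhs (conj oB B0).
have HU (h : R) : h \in `]-r, r[ -> U (h *: v + x).
  rewrite in_itv/= => hr.
  have /rB/HB/(_ 1 0) : ball (0 : R) r h by rewrite -ball_normE /ball_/= sub0r normrN ltr_norml.
  by rewrite scale1r scale0r add0r; apply; rewrite !lexx !ler01.
have dl (h : R) : h \in `]-r, r[ -> is_derive h 1 (fun h : R => f (h *: v + x)) ('D_v f (h *: v + x)).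
  by move=> /HU Uh; apply: is_derive_line; apply: derivableP; exact: df.
have I0 : (0 : R) \in `]-r, r[ by rewrite in_itv/= oppr_lt0 r0.
have D0 : is_derive (0 : R) 1 (fun h : R => f (h *: v + x)) 0.
  apply: (@derive1_at_max R _ (- r) r) => //; first by rewrite ge0_cp// ltW.
    by move=> t /dl[].
  by move=> t /HU/fmax; rewrite scale0r add0r.
have := derive_val (is_derive := dl 0 I0).
by rewrite (derive_val (is_derive := D0)) scale0r add0r.
Qed.

(** If the second derivative were positive, the first one would be positive just
after x, and f would increase there. *)
Lemma second_derivative_test U f x v : open U -> U x ->
  (forall y, U y -> f y <= f x) -> (forall y, U y -> derivable f y v) ->
  derivable ('D_v f) x v -> 'D_v ('D_v f) x <= 0.
Proof.
move=> oU Ux fmax df ddf; rewrite leNgt; apply/negP => D2.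
have D1 := derive_local_max oU Ux fmax df.
have H1 : \forall h \near (0 : R)^', 0 < h^-1 *: (('D_v f \o shift x) (h *: v) - 'D_v f x).
  by apply: (cvgr_gt _ ddf); exact: D2.
have H2 : \forall h \near (0 : R), forall c d : R, 0 <= c <= 1 -> 0 <= d <= 1 ->
    U (c *: (h *: v) + (d *: (h *: 0) + x)) by exact: near_parallelogram.
have [r /= r0 Hr] := H1.
have [s /= s0 Hs] := H2.
pose h := Order.min r s / 2.
have m0 : 0 < Order.min r s by rewrite lt_min r0.
have h0 : 0 < h by rewrite divr_gt0.
have hm : h < Order.min r s by rewrite ltr_pdivrMr// ltr_pMr// ltr1n.
have [hr hs] : h < r /\ h < s by move: hm; rewrite lt_min => /andP.
have HU (t : R) : 0 <= t <= 1 -> U (t *: (h *: v) + x).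
  move=> t01; have := Hs h _ t 0 t01; rewrite scale0r add0r; apply.
    by rewrite /= sub0r normrN gtr0_norm.
  by rewrite lexx ler01.
have dhv (t : R) : 0 <= t <= 1 -> is_derive (t *: (h *: v) + x) (h *: v) f (h *: 'D_v f (t *: (h *: v) + x)).
  by move=> t01; apply: is_derive_dirZ; apply: derivableP; apply: df; exact: HU.
have [|c /andP[c0 c1] E] := @mvt_line_open _ _ f x (h *: v); first by move=> t /dhv[].
have ch0 : 0 < c * h by rewrite mulr_gt0.
have := Hr (c * h); rewrite /= sub0r normrN gtr0_norm// D1 subr0 => Hch.
have {}Hch := Hch (lt_trans (y := h) _ hr) (lt0r_neq0 ch0).
have : 0 < (c * h)^-1 *: 'D_v f ((c * h) *: v + x) by apply: Hch; rewrite gtr_pMl.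
rewrite -[_ *: _]/(_ * _) pmulr_rgt0 ?invr_gt0// => Dpos.
have c01 : 0 <= c <= 1 by rewrite !ltW.
have := fmax (h *: v + x); rewrite -subr_le0 E (derive_val (is_derive := dhv c c01)) scalerA.
have U1 : U (h *: v + x) by have := HU 1; rewrite scale1r; apply; rewrite lexx ler01.
move=> /(_ U1); rewrite -[_ *: 'D_v f _]/(_ * _) leNgt mulr_gt0//.
Qed.

End SecondOrder.

Section ProductRules.
Context {R : realType} {V : normedModType R}.
Implicit Types (x v : V).

Lemma is_derive_mx m n (A : V -> 'M[R]_(m, n)) x v (d : 'M[R]_(m, n)) :
  (forall i j, is_derive x v (fun y => A y i j) (d i j)) -> is_derive x v A d.
Proof.
move=> H; have dA : derivable A x v by apply/derivable_mxP => i j; have [] := H i j.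
split => //; rewrite derive_mx//; apply/matrixP => i j; rewrite mxE.
by have [] := H i j.
Qed.

Lemma is_derive_entry m n (A : V -> 'M[R]_(m, n)) x v (d : 'M[R]_(m, n)) i j :
  is_derive x v A d -> is_derive x v (fun y => A y i j) (d i j).
Proof.
move=> [dA <-]; rewrite -derive_entry//; apply: derivableP.
exact: (derivable_mxP _ _ _).1 dA i j.
Qed.

Lemma is_derive_mulmx m n p (A : V -> 'M[R]_(m, n)) (B : V -> 'M[R]_(n, p)) x v dA dB :
  is_derive x v A dA -> is_derive x v B dB ->
  is_derive x v (fun y => A y *m B y) (dA *m B x + A x *m dB).
Proof.
move=> HA HB; apply: is_derive_mx => i j.
have E : (fun y => (A y *m B y) i j) = \sum_k ((fun y => A y i k) * (fun y => B y k j)).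
  by apply/funext => y; rewrite mxE fct_sumE.
rewrite E; apply: is_derive_eq.
  apply: is_derive_sum => k; apply: is_deriveM; exact: is_derive_entry.
rewrite !mxE -big_split; apply: eq_bigr => k _ /=.
by rewrite -[A x i k *: _]/(A x i k * _) -[B x k j *: _]/(B x k j * _) addrC [dA i k * _]mulrC.
Qed.

Lemma is_derive_trmx m n (A : V -> 'M[R]_(m, n)) x v dA :
  is_derive x v A dA -> is_derive x v (fun y => (A y)^T) dA^T.
Proof.
move=> HA; apply: is_derive_mx => i j; rewrite mxE.
have -> : (fun y => (A y)^T i j) = (fun y => A y j i) by apply/funext => y; rewrite mxE.
exact: is_derive_entry.
Qed.

Lemma dotE m (u w : 'rV[R]_m) : dot u w = (u *m w^T) 0 0.
Proof. by rewrite mxE; apply: eq_bigr => i _; rewrite mxE. Qed.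

Lemma is_derive_dot m (f g : V -> 'rV[R]_m) x v df dg :
  is_derive x v f df -> is_derive x v g dg ->
  is_derive x v (fun y => dot (f y) (g y)) (dot df (g x) + dot (f x) dg).
Proof.
move=> Hf Hg; have H := is_derive_mulmx Hf (is_derive_trmx Hg).
have -> : (fun y => dot (f y) (g y)) = (fun y => (f y *m (g y)^T) 0 0).
  by apply/funext => y; rewrite dotE.
by apply: is_derive_eq (is_derive_entry 0 0 H) _; rewrite mxE !dotE.
Qed.

Lemma is_derive_prod (I : eqType) (r : seq I) (f : I -> V -> R) (df : I -> R) x v :
  uniq r -> (forall i, is_derive x v (f i) (df i)) ->
  is_derive x v (fun y => \prod_(i <- r) f i y)
    (\sum_(i <- r) (\prod_(j <- r | j != i) f j x) * df i).
Proof.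
move=> + Hf; elim: r => [|i r IH] /=.
  move=> _; rewrite big_nil.
  have -> : (fun y : V => \prod_(i <- [::]) f i y) = cst 1 by apply/funext => y; rewrite big_nil.
  exact: is_derive_cst.
move=> /andP[ir ur].
have -> : (fun y => \prod_(k <- i :: r) f k y) = f i * (fun y => \prod_(k <- r) f k y).
  by apply/funext => y; rewrite big_cons.
apply: is_derive_eq; first exact: is_deriveM (Hf i) (IH ur).
rewrite big_cons big_cons eqxx /= addrC; congr (_ + _).
  rewrite -[LHS]/(_ * _); congr (_ * _).
  rewrite big_seq [RHS]big_seq_cond; apply: eq_big => [k|k] //.
  by case kr: (k \in r) => //=; apply/esym; apply: contraNneq ir => <-.
rewrite -[LHS]/(_ * _) big_distrr /=; apply: eq_big_seq => k kr.
rewrite big_cons; have -> : i != k by apply: contra ir => /eqP ->.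
by rewrite mulrA.
Qed.

(** At a diagonal matrix only the diagonal permutation contributes to the
derivative of the determinant: any other one picks at least two off-diagonal
entries. *)
Lemma is_derive_det n (A : V -> 'M[R]_n) x v dA (d : 'I_n -> R) :
  is_derive x v A dA -> (forall i j, A x i j = d i *+ (i == j)) ->
  is_derive x v (fun y => \det (A y)) (\sum_i (\prod_(j | j != i) d j) * dA i i).
Proof.
move=> HA Ad.
pose F (s : 'S_n) (y : V) : R := (-1) ^+ s * \prod_i A y i (s i).
have HF (s : 'S_n) : is_derive x v (F s)
    ((-1) ^+ s * \sum_i (\prod_(j | j != i) A x j (s j)) * dA i (s i)).
  apply: is_derive_eq.
    apply: (@is_deriveM _ _ (cst ((-1) ^+ s)) (fun y => \prod_i A y i (s i))).
    apply: (@is_derive_prod 'I_n (index_enum 'I_n) (fun i y => A y i (s i)) (fun i => dA i (s i))).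
      exact: index_enum_uniq.
    by move=> i; exact: is_derive_entry.
  by rewrite scaler0 addr0.
have E : (fun y => \det (A y)) = \sum_s F s by apply/funext => y; rewrite fct_sumE.
rewrite E; pose r := \sum_(s : 'S_n) ((-1) ^+ s * \sum_i (\prod_(j | j != i) A x j (s j)) * dA i (s i)).
have Hr : is_derive x v (\sum_s F s) r.
  by rewrite /r; elim/big_ind2 : _ => // [|*]; [exact: is_derive_cst|exact: is_deriveD].
apply: is_derive_eq Hr _.
rewrite /r (bigD1 (1%g : 'S_n)) //= odd_perm1 expr0 mul1r [X in _ + X]big1 ?addr0.
  apply: eq_bigr => i _; rewrite perm1; congr (_ * _); apply: eq_bigr => j _.
  by rewrite perm1 Ad eqxx.
move=> s s1; rewrite big1 ?mulr0// => i _.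
have [j ji sj] : exists2 j, j != i & s j != j.
  apply: contrapT => H; case/eqP: s1; apply/permP => k; rewrite perm1.
  have H2 j : j != i -> s j = j.
    by move=> ji; apply/eqP/negPn/negP => sj; apply: H; exists j.
  have [->|/H2//] := eqVneq k i.
  have [//|/H2 /perm_inj//] := eqVneq (s i) i.
by rewrite (bigD1 j)//= Ad eq_sym (negbTE sj) mul0r mul0r.
Qed.

End ProductRules.

(** * Derivatives of implicitly defined maps *)

Section DotTheory.
Context {R : realType} {m : nat}.
Implicit Types u v w : 'rV[R]_m.

Lemma dotC u v : dot u v = dot v u.
Proof. by apply: eq_bigr => i _; rewrite mulrC. Qed.

Lemma dotDl u v w : dot (u + v) w = dot u w + dot v w.
Proof. by rewrite !dotE mulmxDl mxE. Qed.

Lemma dotDr u v w : dot w (u + v) = dot w u + dot w v.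
Proof. by rewrite dotC dotDl !(dotC w). Qed.

Lemma dotZl k u v : dot (k *: u) v = k * dot u v.
Proof. by rewrite !dotE -scalemxAl mxE. Qed.

Lemma dotZr k u v : dot u (k *: v) = k * dot u v.
Proof. by rewrite dotC dotZl dotC. Qed.

Lemma dotNl u v : dot (- u) v = - dot u v.
Proof. by rewrite -scaleN1r dotZl mulN1r. Qed.

Lemma dotNr u v : dot u (- v) = - dot u v.
Proof. by rewrite dotC dotNl dotC. Qed.

Lemma dotBl u v w : dot (u - v) w = dot u w - dot v w.
Proof. by rewrite dotDl dotNl. Qed.

Lemma dotBr u v w : dot w (u - v) = dot w u - dot w v.
Proof. by rewrite dotDr dotNr. Qed.

Lemma dot0l u : dot 0 u = 0.
Proof. by rewrite -(scale0r 0) dotZl mul0r. Qed.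

Lemma dot0r u : dot u 0 = 0.
Proof. by rewrite dotC dot0l. Qed.

Lemma dot_ge0 u : 0 <= dot u u.
Proof. by apply: sumr_ge0 => i _; rewrite -expr2 sqr_ge0. Qed.

Lemma dot_eq0 u : (dot u u == 0) = (u == 0).
Proof.
apply/idP/eqP => [|->]; last by rewrite dot0l.
rewrite psumr_eq0 => [/allP H|i _]; last by rewrite -expr2 sqr_ge0.
apply/rowP => i; rewrite mxE.
by have := H i (mem_index_enum _); rewrite mulf_eq0 orbb => /eqP.
Qed.

Lemma dot_gt0 u : u != 0 -> 0 < dot u u.
Proof. by move=> u0; rewrite lt_neqAle dot_ge0 eq_sym dot_eq0 u0. Qed.

Lemma mulmx_trE u v : u *m v^T = (dot u v)%:M.
Proof. by apply/matrixP => i j; rewrite (ord1 i) (ord1 j) dotE !mxE eqxx mulr1n. Qed.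

(** Cauchy-Schwarz, from the norm of the component of u orthogonal to v. *)
Lemma dot_CS u v : dot u v ^+ 2 <= dot u u * dot v v.
Proof.
have [->|v0] := eqVneq v 0; first by rewrite !dot0r expr0n mulr0.
have vv := dot_gt0 v0.
have := dot_ge0 (dot v v *: u - dot u v *: v).
rewrite !(dotBl, dotBr, dotZl, dotZr) (dotC v u) => H.
rewrite -subr_ge0 -(pmulr_rge0 _ vv).
by apply: le_trans H _; rewrite le_eqVlt; apply/orP; left; apply/eqP; ring.
Qed.

Lemma dot_delta u (i : 'I_m) : dot u (delta_mx 0 i) = u 0 i.
Proof.
rewrite /dot (bigD1 i)//= mxE !eqxx mulr1 big1 ?addr0// => j ji.
by rewrite mxE (negbTE ji) andbF mulr0.
Qed.

Lemma mulmx_tr_entry n l (A : 'M[R]_(n, m)) (B : 'M[R]_(l, m)) i j :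
  (A *m B^T) i j = dot (row i A) (row j B).
Proof. by rewrite mxE; apply: eq_bigr => k _; rewrite !mxE. Qed.

Lemma dot_trmx p u (w : 'rV[R]_p) (A : 'M[R]_(p, m)) : dot u (w *m A) = dot (u *m A^T) w.
Proof. by rewrite !dotE trmx_mul mulmxA. Qed.

End DotTheory.

Section ImplicitDerivatives.
Context {R : realType} {V : normedModType R}.
Implicit Types (a v : V).

Lemma cvg_col_mx (T : Type) (F : set_system T) {FF : Filter F} m1 m2 n
    (A : T -> 'M[R]_(m1, n)) (B : T -> 'M[R]_(m2, n)) (a : 'M[R]_(m1, n)) (b : 'M[R]_(m2, n)) :
  A x @[x --> F] --> a -> B x @[x --> F] --> b ->
  col_mx (A x) (B x) @[x --> F] --> col_mx a b.
Proof.
move=> /cvg_mxP Aa /cvg_mxP Bb; apply: cvg_mx => i j.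
by under eq_cvg do rewrite mxE; rewrite mxE; case: (fintype.split i) => k; [exact: Aa|exact: Bb].
Qed.

Lemma cvg_row_mx (T : Type) (F : set_system T) {FF : Filter F} m n1 n2
    (A : T -> 'M[R]_(m, n1)) (B : T -> 'M[R]_(m, n2)) (a : 'M[R]_(m, n1)) (b : 'M[R]_(m, n2)) :
  A x @[x --> F] --> a -> B x @[x --> F] --> b ->
  row_mx (A x) (B x) @[x --> F] --> row_mx a b.
Proof.
move=> /cvg_mxP Aa /cvg_mxP Bb; apply: cvg_mx => i j.
by under eq_cvg do rewrite mxE; rewrite mxE; case: (fintype.split j) => k; [exact: Aa|exact: Bb].
Qed.

Lemma cvg_along a v : h *: v + a @[h --> (0 : R)^'] --> a.
Proof.
have -> : nbhs a = nbhs (0 *: v + a) by rewrite scale0r add0r.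
apply: cvg_within_filter.
apply: cvgD; last exact: cvg_cst.
by apply: cvgZl; exact: cvg_id.
Qed.

Lemma near_along a v (P : V -> Prop) : (\forall y \near a, P y) ->
  \forall h \near (0 : R)^', P (h *: v + a).
Proof. by move=> aP; exact: (@cvg_along a v P aP). Qed.

Lemma derivable_cvg_along (W : normedModType R) (g : V -> W) a v :
  derivable g a v -> g (h *: v + a) @[h --> (0 : R)^'] --> g a.
Proof.
move=> dg.
have C : h *: (h^-1 *: ((g \o shift a) (h *: v) - g a)) + g a @[h --> (0 : R)^'] -->
    (0 : R) *: 'D_v g a + g a.
  apply: cvgD; last exact: cvg_cst.
  apply: cvgZ; last exact: dg.
  by apply: cvg_within_filter; exact: cvg_id.
rewrite scale0r add0r in C; apply: cvg_trans C; apply: near_eq_cvg; near=> h.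
have h0 : h != 0 by near: h; exact: nbhs_dnbhs_neq.
by rewrite scalerA divff// scale1r subrK.
Unshelve. all: by end_near. Qed.

Lemma is_derive_cvg (W : normedModType R) (g : V -> W) a v d :
  h^-1 *: (g (h *: v + a) - g a) @[h --> (0 : R)^'] --> d ->
  is_derive a v g d.
Proof. by move=> gd; split; [apply/cvg_ex; exists d|exact/cvg_lim]. Qed.

Lemma derive_cvg (W : normedModType R) (g : V -> W) a v d :
  is_derive a v g d -> h^-1 *: (g (h *: v + a) - g a) @[h --> (0 : R)^'] --> d.
Proof. by move=> [dg <-]. Qed.

(** The difference quotient of the solution solves a system with the same matrix,
whose right hand side converges. *)
Lemma is_derive_solve n p (M : V -> 'M[R]_n) (x c : V -> 'M[R]_(p, n)) a v dM dc :
  M a \in unitmx -> (\forall y \near a, x y *m M y = c y) ->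
  is_derive a v M dM -> is_derive a v c dc ->
  is_derive a v x ((dc - x a *m dM) *m invmx (M a)).
Proof.
move=> uM xM HM Hc; apply: is_derive_cvg.
have Mc := derivable_cvg_along (@ex_derive _ _ _ _ _ _ _ HM).
have cc := derivable_cvg_along (@ex_derive _ _ _ _ _ _ _ Hc).
have xMl := near_along v xM.
have xa : x (h *: v + a) @[h --> (0 : R)^'] --> x a.
  have -> : x a = c a *m invmx (M a) by rewrite -(nbhs_singleton xM) mulmxK.
  exact: cvg_solve uM Mc cc xMl.
apply: (cvg_solve uM (M := fun=> M a)
  (c := fun h => h^-1 *: (c (h *: v + a) - c a) -
     x (h *: v + a) *m (h^-1 *: (M (h *: v + a) - M a)))); first exact: cvg_cst.
  apply: cvgB; first exact: derive_cvg.
  by apply: cvg_mulmx => //; exact: derive_cvg.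
near=> h; have <- : x (h *: v + a) *m M (h *: v + a) = c (h *: v + a) by near: h.
rewrite -(nbhs_singleton xM) -scalemxAl -scalemxAr -scalerBr; congr (_ *: _).
by rewrite mulmxBl mulmxBr opprB [RHS]addrC addrA subrK.
Unshelve. all: by end_near. Qed.

(** The difference quotient of the normal solves a linear system: its product with
the tangent vectors is prescribed, and it is orthogonal to the mean of the two
normals because they have the same length. *)
Lemma is_derive_normal n (J : V -> 'M[R]_(n, n.+1)) (N : V -> 'rV[R]_n.+1) a v dJ :
  N (h *: v + a) @[h --> (0 : R)^'] --> N a ->
  (\forall y \near a, dot (N y) (N y) = 1 /\ N y *m (J y)^T = 0) ->
  (col_mx (N a) (J a) : 'M[R]_n.+1) \in unitmx ->
  is_derive a v J dJ ->
  is_derive a v N ((row_mx (0 : 'rV[R]_1) (- (N a *m dJ^T)) : 'rV[R]_n.+1) *m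
     invmx (col_mx (N a) (J a) : 'M[R]_n.+1)^T).
Proof.
move=> cN NJ uM HJ; apply: is_derive_cvg.
have uMT : (col_mx (N a) (J a) : 'M[R]_n.+1)^T \in unitmx by rewrite unitmx_tr.
have [Na1 NaJ] := nbhs_singleton NJ.
have NJl := near_along v NJ.
apply: (cvg_solve uMT
  (M := fun h => (col_mx (2^-1 *: (N (h *: v + a) + N a)) (J a) : 'M[R]_n.+1)^T)
  (c := fun h => (row_mx (0 : 'rV[R]_1) (- (N (h *: v + a) *m (h^-1 *: (J (h *: v + a) - J a))^T)) : 'rV[R]_n.+1))).
- apply: (@cvg_trmx _ _ _ _ n.+1 n.+1).
  apply: (@cvg_col_mx _ _ _ 1 n n.+1); last exact: cvg_cst.
  have E : N a = 2^-1 *: (N a + N a).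
    by apply/rowP => i; rewrite !mxE; lra.
  by rewrite [X in _ --> X]E; apply: cvgZr; apply: cvgD => //; exact: cvg_cst.
- apply: (@cvg_row_mx _ _ _ 1 1 n); first exact: cvg_cst.
  apply: cvgN; apply: cvg_mulmx => //; apply: cvg_trmx; exact: derive_cvg.
near=> h; have [N1 NJh] : dot (N (h *: v + a)) (N (h *: v + a)) = 1 /\ N (h *: v + a) *m (J (h *: v + a))^T = 0 by near: h.
set b := N (h *: v + a) in N1 NJh *.
have E1 : h^-1 *: (b - N a) *m (2^-1 *: (b + N a))^T = 0.
  rewrite mulmx_trE dotZl dotZr dotBl !dotDr N1 Na1 (dotC (N a)).
  by rewrite [_ + 1]addrC subrr !mulr0 raddf0.
have E2 : h^-1 *: (b - N a) *m (J a)^T = - (b *m (h^-1 *: (J (h *: v + a) - J a))^T).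
  rewrite [(h^-1 *: _)^T]linearZ /= -scalemxAl -scalemxAr -scalerN; congr (_ *: _).
  by rewrite linearB /= mulmxBl mulmxBr NJh NaJ sub0r subr0 opprK.
by rewrite (@tr_col_mx _ 1 n n.+1) (@mul_mx_row _ 1 n.+1 1 n) E1 E2.
Unshelve. all: by end_near. Qed.

End ImplicitDerivatives.

Section Curves.
Context {R : realType}.

(** The immersion separates points at a linear rate, so the difference quotient
of y is bounded; strict differentiability of g then determines its limit. *)
Lemma is_derive_lift n m U (g : 'rV[R]_n -> 'rV[R]_m) (y : R -> 'rV[R]_n) t z :
  open U -> C1_on U g -> U (y t) -> row_free ('J g (y t)) ->
  {for t, continuous y} -> is_derive t 1 (g \o y) z ->
  is_derive t 1 y (z *m pinvmx ('J g (y t))) /\ z *m pinvmx ('J g (y t)) *m 'J g (y t) = z.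
Proof.
move=> oU C Uy fJ cy Hz; set P := pinvmx _; set J := 'J g (y t).
have [r [c [r0 c0 rU Hc]]] := immersion_chord oU C Uy fJ.
have yl : y (h *: 1 + t) @[h --> (0 : R)^'] --> y t.
  have l1 : h *: (1 : R) + t @[h --> (0 : R)^'] --> t := @cvg_along R R t 1.
  exact: (cvg_comp _ _ l1 cy).
pose q (h : R) := h^-1 *: (y (h *: 1 + t) - y t).
pose w (h : R) := h^-1 *: (g (y (h *: 1 + t)) - g (y t)).
have wz : w h @[h --> (0 : R)^'] --> z by exact: derive_cvg Hz.
have near_ball (s : R) : 0 < s -> \forall h \near (0 : R)^', ball (y t) s (y (h *: 1 + t)).
  by move=> s0; exact: (yl _ (nbhsx_ballx (y t) s s0)).
have qb : \forall h \near (0 : R)^', `|q h| <= (`|z| + 1) / c.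
  have w1 : \forall h \near (0 : R)^', `|z - w h| <= 1 by exact: cvg_near_le wz ltr01.
  near=> h.
  have zw : `|z - w h| <= 1 by near: h.
  have yr : ball (y t) r (y (h *: 1 + t)) by near: h; exact: near_ball.
  rewrite ler_pdivlMr// mulrC.
  apply: (@le_trans _ _ `|w h|); last first.
    by rewrite -(subKr z (w h)) (le_trans (ler_normB _ _))// lerD2l.
  rewrite /q /w !normrZ mulrCA ler_wpM2l// Hc//; exact: ballxx.
have qJ : q h *m J @[h --> (0 : R)^'] --> z.
  apply/cvgrPdist_le => /= e e0.
  pose K : R := (`|z| + 1) / c + 1.
  have K0 : 0 < K by rewrite ltr_wpDl// divr_ge0// ?(ltW c0)// addr_ge0.
  have e20 : 0 < e / 2 by rewrite divr_gt0.
  have eK0 : 0 < e / 2 / K by rewrite divr_gt0.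
  have [s s0 Hs] := strict_diff oU C Uy eK0.
  have w2 : \forall h \near (0 : R)^', `|z - w h| <= e / 2 by exact: cvg_near_le wz e20.
  near=> h.
  have zw : `|z - w h| <= e / 2 by near: h.
  have ys : ball (y t) s (y (h *: 1 + t)) by near: h; exact: near_ball.
  have qh : `|q h| <= (`|z| + 1) / c by near: h.
  rewrite -(subrKA (w h)) (le_trans (ler_normD _ _))// (splitr e) lerD//.
  have -> : w h - q h *m J = h^-1 *: (g (y (h *: 1 + t)) - g (y t) - (y (h *: 1 + t) - y t) *m J).
    by rewrite /w /q -scalemxAl -scalerBr.
  have := Hs _ _ ys (ballxx _ s0); rewrite -/J => H.
  rewrite normrZ (@le_trans _ _ (`|h^-1| * (e / 2 / K * `|y (h *: 1 + t) - y t|)))//.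
    by rewrite ler_wpM2l.
  rewrite mulrCA -normrZ -/(q h) -[_ / K * _]mulrA -[leRHS]mulr1 ler_wpM2l ?(ltW e20)//.
  by rewrite mulrC ler_pdivrMr// mul1r (le_trans qh)// /K lerDl.
have qz : q h @[h --> (0 : R)^'] --> z *m P.
  have E : q h *m J *m P @[h --> (0 : R)^'] --> z *m P.
    by apply: cvg_mulmx => //; exact: cvg_cst.
  apply: cvg_trans E; apply: near_eq_cvg; apply: nearW => h.
  by rewrite mulmxKp.
split; first exact: is_derive_cvg.
have E : q h *m J @[h --> (0 : R)^'] --> z *m P *m J by apply: cvg_mulmx => //; exact: cvg_cst.
exact: (cvg_unique _ E qJ).
Unshelve. all: by end_near. Qed.

Lemma is_derive_C1_comp n m U (g : 'rV[R]_n -> 'rV[R]_m) (y : R -> 'rV[R]_n) t dy :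
  open U -> C1_on U g -> U (y t) -> is_derive t 1 y dy ->
  is_derive t 1 (g \o y) (dy *m 'J g (y t)).
Proof.
move=> oU C Uy [ddy <-].
have dg := C1_differentiable oU C Uy.
have /derivable1_diffP dyt := ddy.
have dgy : differentiable (g \o y) t by exact: differentiable_comp.
split; first exact: diff_derivable.
rewrite -deriveEjacobian// ['D_1 (g \o y) t]deriveE// diff_comp//=.
by rewrite ['D_1 y t]deriveE// ['D__ g (y t)]deriveE.
Qed.

End Curves.

(** * Star-shaped sections of a local homeomorphism *)

Section RadialSection.
Context {R : realType} {n : nat} {T : topologicalType}.
Variables (F : T -> 'rV[R]_n) (M0 : set T) (p : T).
Implicit Types (O : set 'rV[R]_n) (s : 'rV[R]_n -> T) (u w : 'rV[R]_n).

(** F is a homeomorphism from a neighbourhood of q onto a neighbourhood of F q. *)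
Definition locally_invertible_at (q : T) : Prop :=
  exists (V : set T) (e : R) (s : 'rV[R]_n -> T),
  [/\ open V, V q /\ V `<=` M0, 0 < e,
      forall x y, V x -> V y -> F x = F y -> x = y &
      forall w, ball (F q) e w -> [/\ V (s w), F (s w) = w & {for w, continuous s}]].

Hypothesis (T2 : hausdorff_space T).
Hypothesis (Fcont : forall q, M0 q -> {for q, continuous F}).
Hypothesis (Floc : forall q, M0 q -> locally_invertible_at q).

Lemma continuous_near_eq (A B : topologicalType) (f g : A -> B) (x : A) :
  (\forall y \near x, f y = g y) -> {for x, continuous f} -> {for x, continuous g}.
Proof.
move=> fg cf; rewrite /prop_for /continuous_at -(nbhs_singleton fg).
by apply: cvg_trans cf; apply: near_eq_cvg; apply: filterS fg.
Qed.

(** The set of parameters where the two lifts agree is open because F is locally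
injective, and closed because the space is Hausdorff. *)
Lemma lift_unique (c d : R -> T) :
  (forall t, 0 <= t <= 1 -> {for t, continuous c} /\ {for t, continuous d}) ->
  (forall t, 0 <= t <= 1 -> M0 (c t) /\ F (c t) = F (d t)) ->
  c 0 = d 0 -> c 1 = d 1.
Proof.
move=> cont lift cd0.
pose A := `[(0 : R), 1]%classic; pose E := [set t : R | c t = d t].
have Ein t : A t -> E t -> nbhs t [set r | A r -> E r].
  rewrite /A /= in_itv /= => t01 Et.
  have [Mc _] := lift t t01; have [V [e [s [oV [Vq _] _ Vinj _]]]] := Floc Mc.
  have [ct dt] := cont t t01.
  have N1 : \forall r \near t, V (c r) by apply: ct; exact: open_nbhs_nbhs.
  have N2 : \forall r \near t, V (d r).
    by apply: dt; rewrite -[d t](Et : c t = d t); exact: open_nbhs_nbhs.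
  apply: filterS2 N1 N2 => r V1 V2; rewrite /A /= in_itv/= => r01.
  by have [_ H] := lift r r01; exact: Vinj H.
have conn := @segment_connected R 0 1.
have I0 : A 0 by rewrite /A /= in_itv/= lexx ler01.
have I1 : A 1 by rewrite /A /= in_itv/= lexx ler01.
suff AE : A `&` E = A by have [] : (A `&` E) 1 by rewrite AE.
apply: conn; first by exists 0.
- exists [set r | A r -> E r]^°; first exact: open_interior.
  apply/seteqP; split=> t [At]; first by move=> Et; split => //; exact: Ein.
  by move=> /nbhs_singleton H; split => //; exact: H.
- exists (closure (A `&` E)); first exact: closed_closure.
  apply/seteqP; split=> t [At]; first by move=> Et; split => //; exact: subset_closure.
  move=> clt; split => //; apply: T2 => P Q cP dQ.
  move: (At); rewrite /A /= in_itv/= => t01; have [ct dt] := cont t t01.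
  have N1 : nbhs t (c @^-1` P) by exact: ct.
  have N2 : nbhs t (d @^-1` Q) by exact: dt.
  have [r [[_ Er] [Pr Qr]]] := clt _ (filterI N1 N2).
  by exists (c r); split => //=; rewrite [c r]Er.
Qed.

(** Star-shapedness about 0 makes two sections through p agree wherever both are
defined, so that all of them glue into a largest one. *)
Definition star_section O s : Prop :=
  [/\ open O, forall u t, O u -> 0 <= t <= 1 -> O (t *: u), s 0 = p &
      forall u, O u -> [/\ M0 (s u), F (s u) = u & {for u, continuous s}]].

Lemma continuous_ray (a b : R) u t : {for t, continuous (fun r : R => (a + b * r) *: u)}.
Proof.
apply: cvgZl; apply: cvgD; first exact: cvg_cst.
by apply: cvgM; [exact: cvg_cst|exact: cvg_id].
Qed.

Lemma continuous_along_ray s (a b : R) u t : {for (a + b * t) *: u, continuous s} ->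
  {for t, continuous (fun r : R => s ((a + b * r) *: u))}.
Proof.
by move=> cs; exact: (cvg_comp _ _ (@continuous_ray a b u t) cs).
Qed.

Lemma star_section_unique O1 s1 O2 s2 u : star_section O1 s1 -> star_section O2 s2 ->
  O1 u -> O2 u -> s1 u = s2 u.
Proof.
move=> [_ st1 p1 H1] [_ st2 p2 H2] u1 u2.
have := @lift_unique (fun t => s1 ((0 + 1 * t) *: u)) (fun t => s2 ((0 + 1 * t) *: u)).
rewrite !(add0r, mulr0, mul1r, scale0r, scale1r); apply; last by rewrite p1.
- move=> t t01; have [_ _ c1] := H1 _ (st1 _ _ u1 t01); have [_ _ c2] := H2 _ (st2 _ _ u2 t01).
  have E : (0 + 1 * t) *: u = t *: u by rewrite add0r mul1r.
  by split; apply: continuous_along_ray; rewrite E.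
- move=> t t01; rewrite add0r mul1r.
  have [m1 f1 _] := H1 _ (st1 _ _ u1 t01); have [_ f2 _] := H2 _ (st2 _ _ u2 t01).
  by rewrite f1 f2.
Qed.

Let Omax : set 'rV[R]_n := [set u | exists O s, star_section O s /\ O u].
Let smax u : T :=
  if pselect (Omax u) is left h then projT1 (cid (projT2 (cid h))) u else p.

Let smaxE O s u : star_section O s -> O u -> smax u = s u.
Proof.
move=> H Ou; rewrite /smax; case: pselect => [h|[]]; last by exists O, s.
have [H' Ou'] := svalP (cid (projT2 (cid h))).
exact: star_section_unique H' H Ou' Ou.
Qed.

Hypothesis (Mp : M0 p).
Hypothesis (Fp : F p = 0).

Let section_at0 : exists O s, star_section O s /\ O 0.
Proof.
have [V [e [s [oV [Vp VM] e0 Vinj Hs]]]] := Floc Mp; rewrite Fp in Hs.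
exists (ball 0 e), s; split; last exact: ballxx.
split; first exact: ball_open.
- move=> u t; rewrite -ball_normE /ball_/= !sub0r !normrN => ue /andP[t0 t1].
  by rewrite normrZ ger0_norm// (le_lt_trans _ ue)// ler_piMl.
- have [V0 F0 _] := Hs 0 (ballxx _ e0); apply: Vinj => //; by rewrite F0 Fp.
- by move=> u ue; have [Vs Fs cs] := Hs u ue; split => //; exact: VM.
Qed.

Let smaxP : star_section Omax smax.
Proof.
split.
- rewrite openE; move=> u; case=> O; case=> s; case=> H Ou.
  have [oO _ _ _] := H.
  by apply: filterS (open_nbhs_nbhs (conj oO Ou)) => w Ow; exists O, s.
- by move=> u t [ O [s [H Ou]]] t01; exists O, s; split => //; case: H => _ st _ _; exact: st.
- have [ O [s [H O0]]] := section_at0.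
  by rewrite (smaxE H O0); case: H.
- move=> u [ O [s [H Ou]]]; rewrite (smaxE H Ou).
  have [oO _ _ /(_ u Ou)[Ms Fs cs]] := H; split => //.
  apply: continuous_near_eq cs.
  by apply: filterS (open_nbhs_nbhs (conj oO Ou)) => w Ow; rewrite (smaxE H Ow).
Qed.

(* If the lift along the segment towards u accumulates at q, the largest section
   extends past u: it is glued with the local inverse of F at q over the points
   of a ball whose segment to 0 meets a small ball around t u. *)
Let extend_section u q : M0 q -> F q = u ->
  (forall (W : set T) (e : R), open W -> W q -> 0 < e -> exists t : R,
     [/\ 0 < t, t < 1, Omax (t *: u), W (smax (t *: u)) & `|u - t *: u| < e]) ->
  Omax u.
Proof.
move=> Mq Fq Hq.
have [oM stM _ HM] := smaxP.
have [V [e [s [oV [Vq VM] e0 Vinj Hs]]]] := Floc Mq; rewrite Fq in Hs.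
have [t [t0 t1 Ot Vt tu]] := Hq V e oV Vq e0.
have ballc (w w' : 'rV[R]_n) (l : R) : 0 <= l <= 1 -> ball u e w -> ball u e w' ->
    ball u e ((1 - l) *: w + l *: w').
  move=> /andP[l0 l1]; rewrite -ball_normE /ball_/= => we we'.
  have -> : u - ((1 - l) *: w + l *: w') = (1 - l) *: (u - w) + l *: (u - w').
    by apply/rowP => i; rewrite !mxE; ring.
  rewrite (le_lt_trans (ler_normD _ _))// !normrZ !ger0_norm ?subr_ge0//.
  have [->|l1'] := eqVneq l 1; first by rewrite subrr mul0r add0r mul1r.
  have -> : e = (1 - l) * e + l * e by ring.
  apply: ltr_leD; last by rewrite ler_wpM2l// ltW.
  by rewrite ltr_pM2l// subr_gt0 lt_neqAle l1'.
have Bt : ball u e (t *: u) by rewrite -ball_normE.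
have [Mt Ft ct] := HM _ Ot.
have [Vst Fst cst] := Hs _ Bt.
(* near t u both sections land in V, where F is injective *)
have N1 : nbhs (t *: u) [set w | [/\ Omax w, ball u e w & smax w = s w]].
  have N2 : nbhs (t *: u) [set w | V (smax w)] by apply: ct; exact: open_nbhs_nbhs.
  have N3 := open_nbhs_nbhs (conj oM Ot).
  have N4 : nbhs (t *: u) (ball u e) by apply: open_nbhs_nbhs; split => //; exact: ball_open.
  apply: filterS3 N2 N3 N4 => w Vw Ow Bw; split => //.
  have [Vsw Fsw _] := Hs _ Bw; have [_ Fmw _] := HM _ Ow.
  by apply: Vinj => //; rewrite Fsw Fmw.
have /nbhs_ballP[r /= r0 rN] := N1.
pose Q := [set w | ball u e w /\ exists l : R, 0 < l <= 1 /\ ball (t *: u) r (l *: w)].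
have QE w : Q w -> Omax w -> smax w = s w.
  move=> [Bw [l [/andP[l0 l1] lw]]] Ow.
  have [Olw Blw Elw] := rN _ lw.
  have := @lift_unique (fun x => smax ((l + (1 - l) * x) *: w)) (fun x => s ((l + (1 - l) * x) *: w)).
  have HQ x : 0 <= x <= 1 -> Omax ((l + (1 - l) * x) *: w) /\ ball u e ((l + (1 - l) * x) *: w).
    move=> /andP[x0 x1]; split.
      apply: stM => //; apply/andP; split; last by nra.
      by rewrite addr_ge0 ?(ltW l0)// mulr_ge0// subr_ge0.
    have -> : (l + (1 - l) * x) *: w = (1 - x) *: (l *: w) + x *: w.
      by rewrite scalerA -scalerDl; congr (_ *: _); ring.
    by apply: ballc => //; rewrite x0.
  rewrite !(mulr0, mulr1, addr0) [l + (1 - l)]addrC subrK scale1r; apply => //.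
  - move=> x x01; have [Oh Bh] := HQ x x01.
    have [_ _ c1] := HM _ Oh; have [_ _ c2] := Hs _ Bh.
    by split; exact: continuous_along_ray.
  - move=> x x01; have [Oh Bh] := HQ x x01.
    have [m1 f1 _] := HM _ Oh; have [_ f2 _] := Hs _ Bh.
    by rewrite f1 f2.
pose s' w := if pselect (Omax w) is left _ then smax w else s w.
have s'O w : Omax w -> s' w = smax w by rewrite /s'; case: pselect.
have s'Q w : Q w -> s' w = s w.
  by move=> Qw; rewrite /s'; case: pselect => // Ow; exact: QE.
have oQ w : Q w -> nbhs w Q.
  move=> [Bw [l [l01 lw]]].
  have N2 : nbhs w (ball u e) by apply: open_nbhs_nbhs; split => //; exact: ball_open.
  have N3 : nbhs w [set w' | ball (t *: u) r (l *: w')].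
    have cl : {for w, continuous (fun w' : 'rV[R]_n => l *: w')} by exact: scaler_continuous.
    have N4 : nbhs (l *: w) (ball (t *: u) r) by apply: open_nbhs_nbhs; split => //; exact: ball_open.
    exact: (cl _ N4).
  by apply: filterS2 N2 N3 => w' Bw' lw'; split => //; exists l.
have Qu : Q u.
  split; first exact: ballxx.
  by exists t; split; [rewrite t0 ltW|exact: ballxx].
exists (Omax `|` Q), s'; split; last by right.
split.
- rewrite openE => w [Ow|/oQ Qw].
    by apply: filterS (open_nbhs_nbhs (conj oM Ow)) => w' Ow'; left.
  by apply: filterS Qw => w' Qw'; right.
- move=> w h [Ow|[Bw [l [/andP[l0 l1] lw]]]] /andP[h0 h1].
    by left; apply: stM; rewrite ?h0.
  have [Olw Blw _] := rN _ lw.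
  have [hl|lh] := ltP h l.
    left; have -> : h *: w = (h / l) *: (l *: w) by rewrite scalerA divfK// gt_eqF.
    by apply: stM => //; rewrite divr_ge0 ?(ltW l0)//= ler_pdivrMr// mul1r ltW.
  have hp : 0 < h by exact: lt_le_trans lh.
  right; split.
    have [l1'|l1'] := eqVneq l 1.
      have -> : h = 1 by apply/eqP; rewrite eq_le h1 -l1'.
      by rewrite scale1r.
    have d0 : 0 < 1 - l by rewrite subr_gt0 lt_neqAle l1' l1.
    have := @ballc (l *: w) w ((h - l) / (1 - l)) _ Blw Bw.
    have -> : (1 - (h - l) / (1 - l)) *: (l *: w) + ((h - l) / (1 - l)) *: w = h *: w.
      by rewrite scalerA -scalerDl; congr (_ *: _); field; rewrite gt_eqF.
    by apply; rewrite divr_ge0 ?subr_ge0 ?(ltW d0)//= ler_pdivrMr// mul1r lerD2r.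
  exists (l / h); rewrite divr_gt0//= ler_pdivrMr// mul1r lh; split => //.
  by rewrite scalerA divfK// gt_eqF.
- have [_ _ s0p _] := smaxP; rewrite s'O//.
- move=> w [Ow|Qw].
    rewrite s'O//; have [M1 F1 c1] := HM _ Ow; split => //.
    apply: continuous_near_eq c1.
    by apply: filterS (open_nbhs_nbhs (conj oM Ow)) => w' Ow'; rewrite s'O.
  rewrite s'Q//; have [V1 F1 c1] := Hs _ Qw.1; split => //; first exact: VM.
  apply: continuous_near_eq c1.
  by apply: filterS (oQ _ Qw) => w' Qw'; rewrite s'Q.
Qed.

(** Take the union of all star-shaped sections.  Its domain is open, so the
segment towards u could only be interrupted at a point where the lift has a
cluster point, and there the local inverse of F extends it. *)
Theorem radial_section : exists O s, star_section O s /\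
  forall u, (forall T1 : R, 0 < T1 <= 1 -> (forall t, 0 <= t < T1 -> O (t *: u)) ->
    exists q, M0 q /\ forall (W : set T) (t0 : R), open W -> W q -> t0 < T1 ->
      exists t, [/\ 0 <= t, t0 <= t, t < T1 & W (s (t *: u))]) -> O u.
Proof.
exists Omax, smax; split=> [|u Hu]; first exact: smaxP.
have [oM stM _ HM] := smaxP.
have O0 : Omax 0 by exact: section_at0.
pose A := [set t : R | 0 <= t <= 1 /\ Omax (t *: u)].
have A0 : A 0 by split; rewrite ?lexx ?ler01// scale0r.
have Aub : ubound A 1 by move=> t [/andP[]].
have supA : has_sup A by split; [exists 0|exists 1].
pose T1 := sup A.
have T1le : T1 <= 1 by apply: ge_sup => //; exists 0.
have T1ge t : A t -> t <= T1 by move=> At; apply: ub_le_sup => //; exists 1.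
have HO t : 0 <= t < T1 -> Omax (t *: u).
  move=> /andP[t0 tT].
  have [t' [/andP[t'0 t'1] Ot'] tt'] := @sup_gt _ A t (ex_intro _ 0 A0) tT.
  have t'p : 0 < t' by exact: le_lt_trans tt'.
  have -> : t *: u = (t / t') *: (t' *: u) by rewrite scalerA divfK// gt_eqF.
  by apply: stM => //; rewrite divr_ge0//= ler_pdivrMr// mul1r ltW.
have T10 : 0 <= T1 by exact: T1ge.
have OT : Omax (T1 *: u).
  apply: contrapT => nO.
  have T1p : 0 < T1.
    by rewrite lt_neqAle T10 andbT; apply/eqP => E; apply: nO; rewrite -E scale0r.
  have [|q [Mq Hq]] := Hu T1 _ HO; first by rewrite T1p.
  have near_end (W : set T) (e : R) : open W -> W q -> 0 < e ->
      exists t, [/\ 0 < t, t < T1, W (smax (t *: u)) & `|T1 *: u - t *: u| < e].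
    move=> oW Wq e0; have u0 : 0 < `|u| + 1 by rewrite ltr_wpDl.
    have [|t [t0 tm tT Wt]] := Hq W (Order.max (T1 / 2) (T1 - e / (2 * (`|u| + 1)))) oW Wq.
      rewrite gt_max ltr_pdivrMr// ltr_pMr// ltr1n/= ltrBlDr ltrDl.
      by rewrite divr_gt0// mulr_gt0.
    move: tm; rewrite ge_max => /andP[tm1 tm2].
    exists t; split => //; first by apply: lt_le_trans tm1; rewrite divr_gt0.
    rewrite -scalerBl normrZ gtr0_norm ?subr_gt0//.
    have : (T1 - t) * (2 * (`|u| + 1)) <= e.
      by rewrite -ler_pdivlMr ?mulr_gt0// lerBlDr addrC -lerBlDr.
    have : 0 <= (T1 - t) * `|u| by rewrite mulr_ge0// subr_ge0 ltW.
    have : 0 < T1 - t by rewrite subr_gt0.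
    nra.
  apply: nO; apply: (@extend_section _ q) => //.
    apply/eqP; rewrite -subr_eq0 -normr_le0; apply/ler_addgt0Pl => e e0; rewrite addr0.
    have e20 : 0 < e / 2 by rewrite divr_gt0.
    have /near_open[W [oW Wq] HW] : \forall x \near q, ball (F q) (e / 2) (F x).
      exact: (Fcont Mq (nbhsx_ballx _ _ e20)).
    have [t [t0 tT Wt tu]] := near_end W (e / 2) oW Wq e20.
    have Ot : Omax (t *: u) by apply: HO; rewrite ltW.
    have [_ Ft _] := HM _ Ot.
    have := HW _ Wt; rewrite Ft -ball_normE /ball_/= => Fq.
    rewrite -(subrKA (t *: u)) (le_trans (ler_normD _ _))// (splitr e) lerD// ltW//.
    by rewrite distrC.
  move=> W e oW Wq e0; have [t [t0 tT Wt tu]] := near_end W e oW Wq e0.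
  exists (t / T1); rewrite scalerA divfK ?gt_eqF//; split => //.
  - by rewrite divr_gt0.
  - by rewrite ltr_pdivrMr// mul1r.
  - by apply: HO; rewrite ltW.
have [T1E|T1n] := eqVneq T1 1; first by move: OT; rewrite T1E scale1r.
have T1lt : T1 < 1 by rewrite lt_neqAle T1n.
have cl : t *: u @[t --> T1] --> T1 *: u by apply: cvgZl; exact: cvg_id.
have /nbhs_ballP[e /= e0 He] : nbhs T1 [set t | Omax (t *: u)].
  by apply: cl; exact: open_nbhs_nbhs.
pose d := Order.min (e / 2) (1 - T1).
have d0 : 0 < d by rewrite lt_min divr_gt0//= subr_gt0.
have : A (T1 + d).
  split; last first.
    apply: He; rewrite -ball_normE /ball_/= opprD addrA subrr sub0r normrN gtr0_norm//.
    by apply: (@le_lt_trans _ _ (e / 2)); rewrite ?ge_min ?lexx// ltr_pdivrMr// ltr_pMr// ltr1n.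
  by rewrite addr_ge0 ?(ltW d0)//= -lerBrDl ge_min lexx orbT.
by move=> /T1ge; rewrite leNgt ltrDl d0.
Qed.

End RadialSection.

(** * Simultaneous diagonalization *)

Section Diagonalization.
Context {R : realType}.

(* The rational parametrization of the circle turns the hypothesis into a
   polynomial inequality in t, whose linear term must vanish. *)
Lemma rotation_stationary (D E : R) :
  (forall c s : R, c ^+ 2 + s ^+ 2 = 1 -> 2 * c * s * E <= s ^+ 2 * D) -> E = 0.
Proof.
move=> H.
have K t : 4 * t * (1 - t ^+ 2) * E <= 4 * t ^+ 2 * D.
  have t1 : 0 < 1 + t ^+ 2 by rewrite ltr_pwDl// sqr_ge0.
  have := H ((1 - t ^+ 2) / (1 + t ^+ 2)) (2 * t / (1 + t ^+ 2)).
  have -> : ((1 - t ^+ 2) / (1 + t ^+ 2)) ^+ 2 + (2 * t / (1 + t ^+ 2)) ^+ 2 = 1.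
    by field; rewrite gt_eqF.
  move=> /(_ erefl).
  have -> : 2 * ((1 - t ^+ 2) / (1 + t ^+ 2)) * (2 * t / (1 + t ^+ 2)) * E =
      (4 * t * (1 - t ^+ 2) * E) / (1 + t ^+ 2) ^+ 2 by field; rewrite gt_eqF.
  have -> : (2 * t / (1 + t ^+ 2)) ^+ 2 * D = (4 * t ^+ 2 * D) / (1 + t ^+ 2) ^+ 2.
    by field; rewrite gt_eqF.
  by rewrite ler_pM2r// invr_gt0 exprn_gt0.
have pos E' : (forall t, 4 * t * (1 - t ^+ 2) * E' <= 4 * t ^+ 2 * D) -> E' <= 0.
  move=> {}K; rewrite leNgt; apply/negP => E0.
  pose t := Order.min 2^-1 (E' / (2 * (`|D| + 1))).
  have D1 : 0 < 2 * (`|D| + 1) by rewrite mulr_gt0// ltr_wpDl.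
  have t0 : 0 < t by rewrite lt_min invr_gt0 ltr0n/= divr_gt0.
  have t2 : t <= 2^-1 by rewrite ge_min lexx.
  have tE : t * (2 * (`|D| + 1)) <= E' by rewrite -ler_pdivlMr// ge_min lexx orbT.
  have DD := ler_norm D.
  have := K t.
  have -> : 4 * t * (1 - t ^+ 2) * E' = (4 * t) * ((1 - t ^+ 2) * E') by ring.
  have -> : 4 * t ^+ 2 * D = (4 * t) * (t * D) by ring.
  rewrite ler_pM2l ?mulr_gt0// => H1.
  have tt : t ^+ 2 <= 4^-1.
    have -> : (4 : R)^-1 = 2^-1 ^+ 2 by field.
    by rewrite ler_pXn2r// ?nnegrE ?(ltW t0)// invr_ge0.
  have tD : t * D <= t * `|D| by rewrite ler_wpM2l// ltW.
  nra.
apply/eqP; rewrite eq_le pos//=.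
rewrite -oppr_le0; apply: pos => t.
have := K (- t); rewrite sqrrN; lra.
Qed.

Definition orthogonal_mx n (Q : 'M[R]_n) := Q *m Q^T = 1%:M.

Lemma orthogonalP n (Q : 'M[R]_n) :
  orthogonal_mx Q <-> forall i j, dot (row i Q) (row j Q) = (i == j)%:R.
Proof.
have E i j : (Q *m Q^T) i j = dot (row i Q) (row j Q) by exact: mulmx_tr_entry.
split=> [H i j|H]; first by rewrite -E H mxE.
by apply/matrixP => i j; rewrite E H mxE.
Qed.

(** A real symmetric matrix is diagonalized by the orthogonal matrix that
maximizes a trace weighted by distinct weights: a rotation in the plane of rows
i and j changes it to first order by a multiple of the entry (i, j). *)
Lemma symmetric_diagonalizable n (A : 'M[R]_n) : A^T = A ->
  exists Q : 'M[R]_n, orthogonal_mx Q /\ is_diag_mx (Q *m A *m Q^T).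
Proof.
move=> symA.
pose B (u v : 'rV[R]_n) := dot (u *m A) v.
have BC u v : B u v = B v u by rewrite /B dotC dot_trmx symA.
have BDl u v w : B (u + v) w = B u w + B v w by rewrite /B mulmxDl dotDl.
have BZl k u v : B (k *: u) v = k * B u v by rewrite /B -scalemxAl dotZl.
have BDr u v w : B w (u + v) = B w u + B w v by rewrite BC BDl !(BC w).
have BZr k u v : B u (k *: v) = k * B u v by rewrite BC BZl BC.
pose f (v : 'rV[R]_(n * n)) := \sum_(i < n) (i%:R : R) * B (row i (vec_mx v)) (row i (vec_mx v)).
pose K := [set v : 'rV[R]_(n * n) | orthogonal_mx (vec_mx v)].
have ve (v : 'rV[R]_(n * n)) i j : {for v, continuous (fun v : 'rV[R]_(n * n) => vec_mx v i j)}.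
  have -> : (fun v : 'rV[R]_(n * n) => vec_mx v i j) = (fun v => v 0 (mxvec_index i j)).
    by apply/funext => w; rewrite mxE.
  exact: coord_continuous.
have cvec (v : 'rV[R]_(n * n)) : {for v, continuous (fun v : 'rV[R]_(n * n) => vec_mx v)}.
  by apply: (@cvg_mx _ _ (nbhs v) (nbhs_filter v)) => i j; exact: ve.
have cf (v : 'rV[R]_(n * n)) : {for v, continuous f}.
  apply: (@cvg_sumr _ _ (nbhs v) (nbhs_filter v)) => i _.
  apply: (@cvgM _ _ (nbhs v) (nbhs_filter v)); first exact: cvg_cst.
  have E : forall w : 'rV[R]_(n * n), B (row i (vec_mx w)) (row i (vec_mx w)) = (vec_mx w *m A *m (vec_mx w)^T) i i.
    by move=> w; rewrite /B /dot mxE; apply: eq_bigr => k _; rewrite -row_mul !mxE.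
  have -> : (fun w : 'rV[R]_(n * n) => B (row i (vec_mx w)) (row i (vec_mx w))) = (fun w : 'rV[R]_(n * n) => (vec_mx w *m A *m (vec_mx w)^T) i i).
    by apply/funext.
  rewrite E.
  have C : vec_mx w *m A *m (vec_mx w)^T @[w --> nbhs v] --> vec_mx v *m A *m (vec_mx v)^T.
    apply: (@cvg_mulmx _ _ (nbhs v) (nbhs_filter v)).
      by apply: (@cvg_mulmx _ _ (nbhs v) (nbhs_filter v)); [exact: cvec|exact: cvg_cst].
    by apply: (@cvg_trmx _ _ (nbhs v) (nbhs_filter v)); exact: cvec.
  by move/cvg_mxP : C => /(_ i i).
have K0 : K !=set0 by exists (mxvec 1%:M); rewrite /K /= mxvecK /orthogonal_mx trmx1 mulmx1.
have cK : compact K.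
  apply: bounded_closed_compact.
    exists 1; split; first exact: num_real.
    move=> x x1 v /orthogonalP Kv; apply: le_trans (ltW x1).
    apply: mx_norm_le => // i j; rewrite (ord1 i) {i}.
    have [k l] := mxvec_indexP j.
    have := Kv k k; rewrite eqxx /dot (bigD1 l)//= !mxE => H.
    have : vec_mx v k l ^+ 2 <= 1.
      have {}H : _ = 1 :> R := H.
      rewrite mxE -H expr2 lerDl.
      by apply: sumr_ge0 => m _; rewrite -expr2 sqr_ge0.
    by rewrite mxE -real_normK ?num_real// -{1}(expr1n _ 2) ler_pXn2r// ?nnegrE.
  pose h (v : 'rV[R]_(n * n)) : R := `|vec_mx v *m (vec_mx v)^T - 1%:M|.
  have -> : K = h @^-1` [set x | x <= 0].
    apply/seteqP; split=> v; rewrite /K /h /= normr_le0 subr_eq0; first by move=> ->.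
    by move=> /eqP.
  apply: closed_comp; last exact: closed_le.
  move=> v _; apply: (@cvg_norm _ _ _ (nbhs v) (nbhs_filter v)).
  apply: (@cvgB _ _ _ (nbhs v) (nbhs_filter v)); last exact: cvg_cst.
  apply: (@cvg_mulmx _ _ (nbhs v) (nbhs_filter v)); first exact: cvec.
  by apply: (@cvg_trmx _ _ (nbhs v) (nbhs_filter v)); exact: cvec.
have [v /set_mem vK vmax] := @EVT_max_rV R _ f K K0 cK (continuous_in_subspaceT (fun v _ => cf v)).
pose Q := vec_mx v; pose r i := row i Q.
exists Q; split => //.
have dd k l : dot (r k) (r l) = (k == l)%:R by exact: (orthogonalP Q).1.
have entry k l : (Q *m A *m Q^T) k l = B (r k) (r l).
  by rewrite /B /dot mxE; apply: eq_bigr => m _; rewrite -row_mul !mxE.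
apply/is_diag_mxP => i j ij.
have {}ij : i != j by apply: contra ij => /eqP ->.
have wij : (i%:R - j%:R : R) != 0 by rewrite subr_eq0 eqr_nat.
rewrite entry; apply: (mulfI wij); rewrite mulr0.
apply: (@rotation_stationary ((i%:R - j%:R) * (B (r i) (r i) - B (r j) (r j)))) => c s cs.
pose r' k := if k == i then c *: r i + s *: r j else if k == j then c *: r j - s *: r i else r k.
have r'i : r' i = c *: r i + s *: r j by rewrite /r' eqxx.
have r'j : r' j = c *: r j - s *: r i by rewrite /r' eq_sym (negbTE ij) eqxx.
have r'k k : k != i -> k != j -> r' k = r k by move=> ki kj; rewrite /r' (negbTE ki) (negbTE kj).
have ji : (j == i) = false by rewrite eq_sym (negbTE ij).
pose Q1 : 'M[R]_n := \matrix_k r' k.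
have oQ1 : orthogonal_mx Q1.
  apply/orthogonalP => k l; rewrite !rowK.
  have E k' l' : dot (r' k') (r' l') = dot (r' l') (r' k') by rewrite dotC.
  have ii : dot (r' i) (r' i) = 1.
    by rewrite r'i !(dotDl, dotDr, dotZl, dotZr) !dd !eqxx (negbTE ij) ji -[RHS]cs /=; ring.
  have jj : dot (r' j) (r' j) = 1.
    by rewrite r'j !(dotBl, dotBr, dotZl, dotZr) !dd !eqxx (negbTE ij) ji -[RHS]cs /=; ring.
  have ij0 : dot (r' i) (r' j) = 0.
    by rewrite r'i r'j !(dotDl, dotBr, dotZl, dotZr) !dd !eqxx (negbTE ij) ji /=; ring.
  have ki m : m != i -> m != j -> dot (r' i) (r' m) = 0.
    move=> mi mj; rewrite r'i (r'k m)// !(dotDl, dotZl) !dd.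
    by rewrite ![_ == m]eq_sym (negbTE mi) (negbTE mj) !mulr0 addr0.
  have kj m : m != i -> m != j -> dot (r' j) (r' m) = 0.
    move=> mi mj; rewrite r'j (r'k m)// !(dotBl, dotZl) !dd.
    by rewrite ![_ == m]eq_sym (negbTE mi) (negbTE mj) !mulr0 subr0.
  have [->|ki'] := eqVneq k i.
    have [->|li] := eqVneq l i; first by rewrite ii.
    by have [->|lj] := eqVneq l j; [rewrite ij0|rewrite ki].
  have [->|kj'] := eqVneq k j.
    have [->|li] := eqVneq l i; first by rewrite E ij0 ji.
    by have [->|lj] := eqVneq l j; [rewrite jj|rewrite kj].
  have [->|li] := eqVneq l i; first by rewrite E ki// (negbTE ki').
  have [->|lj] := eqVneq l j; first by rewrite E kj// (negbTE kj').
  by rewrite !r'k// dd.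
have Q1K : mxvec Q1 \in K by apply/mem_set; rewrite /K /= mxvecK.
have := vmax _ Q1K.
have split2 (g : 'I_n -> R) : \sum_k g k = g i + g j + \sum_(k | (k != i) && (k != j)) g k.
  by rewrite (bigD1 i)//= (bigD1 j) ?ji//= addrA.
rewrite /f mxvecK -/Q !split2 !rowK r'i r'j.
have -> : \sum_(k | (k != i) && (k != j)) (k%:R : R) * B (row k Q1) (row k Q1) =
    \sum_(k | (k != i) && (k != j)) (k%:R : R) * B (row k Q) (row k Q).
  by apply: eq_bigr => k /andP[ki kj]; rewrite rowK r'k.
have BNr u w : B w (- u) = - B w u by rewrite -scaleN1r BZr mulN1r.
have BNl u w : B (- u) w = - B u w by rewrite -scaleN1r BZl mulN1r.
rewrite lerD2r !(BDl, BDr, BNl, BNr, BZl, BZr) (BC (r j) (r i)) -/(r i) -/(r j).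
set bii := B (r i) (r i); set bjj := B (r j) (r j); set bij := B (r i) (r j).
move=> H; rewrite -subr_ge0.
have cs0 : c ^+ 2 + s ^+ 2 - 1 = 0 by rewrite cs subrr.
move: H; rewrite -subr_ge0 => H; apply: le_trans H _; rewrite -[leLHS]addr0.
rewrite -[X in _ + X](mul0r (i%:R * bii + j%:R * bjj)) -cs0.
by rewrite le_eqVlt; apply/orP; left; apply/eqP; ring.
Qed.

(** An orthogonal eigenbasis of g, rescaled, makes g the identity; a further
orthogonal change of basis diagonalizes h and preserves that. *)
Lemma simultaneous_diagonalization n (g h : 'M[R]_n) : g^T = g -> h^T = h ->
  (forall v : 'rV[R]_n, v != 0 -> 0 < dot (v *m g) v) ->
  exists (B : 'M[R]_n) (k : 'rV[R]_n),
    B *m g *m B^T = 1%:M /\ B *m h *m B^T = diag_mx k.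
Proof.
move=> gs hs gpos.
have diagE (A : 'M[R]_n) : is_diag_mx A -> A = diag_mx (\row_i A i i).
  move=> /is_diag_mxP dA; apply/matrixP => i j; rewrite !mxE.
  by have [->|ij] := eqVneq i j; rewrite ?mulr1n// mulr0n dA.
have [Q [oQ dQ]] := symmetric_diagonalizable gs.
pose d i := (Q *m g *m Q^T) i i.
have d0 i : 0 < d i.
  have -> : d i = dot (row i Q *m g) (row i Q).
    by rewrite /d /dot mxE; apply: eq_bigr => m _; rewrite -row_mul !mxE.
  apply: gpos; apply/eqP => Q0.
  by have := (orthogonalP Q).1 oQ i i; rewrite Q0 dot0l eqxx => /eqP; rewrite eq_sym oner_eq0.
pose S : 'M[R]_n := diag_mx (\row_i (Num.sqrt (d i))^-1).
have ST : S^T = S by rewrite /S tr_diag_mx.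
pose B0 := S *m Q.
have B0g : B0 *m g *m B0^T = 1%:M.
  have -> : B0 *m g *m B0^T = S *m (Q *m g *m Q^T) *m S by rewrite /B0 trmx_mul ST !mulmxA.
  rewrite (diagE _ dQ) /S !mulmx_diag -diag_const_mx; congr diag_mx.
  apply/rowP => i; rewrite !mxE.
  have sd : Num.sqrt (d i) != 0 by rewrite sqrtr_eq0 -ltNge.
  have -> : \sum_j (Q *m g) i j * Q^T j i = Num.sqrt (d i) ^+ 2.
    by rewrite sqr_sqrtr ?(ltW (d0 i))// /d [RHS]mxE.
  field.
  by rewrite sd.
have hs' : (B0 *m h *m B0^T)^T = B0 *m h *m B0^T by rewrite (trmx_mul (B0 *m h)) (trmx_mul B0) trmxK hs mulmxA.
have [Q' [oQ' dQ']] := symmetric_diagonalizable hs'.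
exists (Q' *m B0), (\row_i (Q' *m (B0 *m h *m B0^T) *m Q'^T) i i); split.
  have -> : Q' *m B0 *m g *m (Q' *m B0)^T = Q' *m (B0 *m g *m B0^T) *m Q'^T.
    by rewrite (trmx_mul Q') !mulmxA.
  by rewrite B0g mulmx1.
by rewrite -(diagE _ dQ') (trmx_mul Q') !mulmxA.
Qed.

Lemma char_poly_det_tr n (A B : 'M[R]_n) : char_poly A = char_poly B ->
  \det A = \det B /\ \tr A = \tr B.
Proof.
move=> AB; split.
  have := congr1 (fun p : {poly R} => p`_0) AB; rewrite !char_poly_det => /mulfI; apply.
  by rewrite signr_eq0.
case: n A B AB => [|n] A B AB; first by rewrite (flatmx0 A) (flatmx0 B).
have := congr1 (fun p : {poly R} => p`_n) AB.
by have := char_poly_trace A isT; have := char_poly_trace B isT => /= -> -> /oppr_inj.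
Qed.

Lemma char_poly_diag n (k : 'rV[R]_n) : char_poly (diag_mx k) = \prod_i ('X - (k 0 i)%:P).
Proof.
rewrite char_poly_trig ?diag_mx_is_trig//.
by apply: eq_bigr => i _; rewrite mxE eqxx mulr1n.
Qed.

Lemma det_tr_of_char_poly n (A : 'M[R]_n) (k : 'rV[R]_n) :
  char_poly A = \prod_i ('X - (k 0 i)%:P) ->
  \prod_i k 0 i = \det A /\ \sum_i k 0 i = \tr A.
Proof.
rewrite -char_poly_diag => /char_poly_det_tr[-> ->].
by rewrite det_diag mxtrace_diag.
Qed.

Lemma char_poly_similar n (A B P : 'M[R]_n) : P \in unitmx -> P *m A = B *m P ->
  char_poly A = char_poly B.
Proof.
move=> uP PA; rewrite /char_poly.
pose Pp := map_mx (@polyC R) P.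
have E : Pp *m char_poly_mx A = char_poly_mx B *m Pp.
  rewrite /char_poly_mx mulmxBr mulmxBl -!map_mxM PA; congr (_ - _).
  by rewrite mul_mx_scalar mul_scalar_mx.
have dP : \det Pp != 0.
  by rewrite det_map_mx polyC_eq0 -unitfE -unitmxE.
apply: (mulfI dP); rewrite -det_mulmx E det_mulmx mulrC //.
Qed.

End Diagonalization.

(** * The second order condition for self-shrinkers *)

Section FrameLemmas.
Context {R : realType}.

Lemma dot_suml m (I : finType) (f : I -> 'rV[R]_m) u :
  dot (\sum_i f i) u = \sum_i dot (f i) u.
Proof. by elim/big_rec2 : _ => [|i x y _ <-]; rewrite ?dot0l ?dotDl. Qed.

(** The frame and the normal are the rows of an orthogonal matrix, which is
invertible. *)
Lemma orthonormal_frame_zero n (e : 'I_n -> 'rV[R]_n.+1) (N x : 'rV[R]_n.+1) :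
  (forall i j, dot (e i) (e j) = (i == j)%:R) -> dot N N = 1 ->
  (forall i, dot N (e i) = 0) ->
  dot x N = 0 -> (forall i, dot x (e i) = 0) -> x = 0.
Proof.
move=> ee NN Ne xN xe.
pose M : 'M[R]_n.+1 := col_mx N (\matrix_i e i).
pose J : 'M[R]_(n, n.+1) := \matrix_i e i.
have E1 : N *m N^T = 1%:M by rewrite mulmx_trE NN.
have E2 : N *m J^T = 0 by apply/matrixP => i j; rewrite mulmx_tr_entry row_id rowK Ne mxE.
have E3 : J *m N^T = 0 by apply/matrixP => i j; rewrite mulmx_tr_entry row_id rowK dotC Ne mxE.
have E4 : J *m J^T = 1%:M by apply/matrixP => i j; rewrite mulmx_tr_entry !rowK ee mxE.
have E5 : x *m N^T = 0 by rewrite mulmx_trE xN raddf0.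
have E6 : x *m J^T = 0 by apply/matrixP => i j; rewrite mulmx_tr_entry row_id rowK xe mxE.
have MM : M *m M^T = 1%:M.
  rewrite /M (@tr_col_mx _ 1 n n.+1) (@mul_col_row _ 1 n n.+1 1 n) E1 E2 E3 E4.
  by rewrite -(@scalar_mx_block _ 1 n).
have xM : x *m M^T = 0.
  by rewrite /M (@tr_col_mx _ 1 n n.+1) (@mul_mx_row _ 1 n.+1 1 n) E5 E6 row_mx0.
have uM : M^T \in unitmx by have [] := mulmx1_unit MM.
by rewrite -[x](mulmxK uM) xM mul0mx.
Qed.

Lemma derive_zero_on (V W : normedModType R) (U : set V) (f : V -> W) x v d :
  open U -> U x -> (forall y, U y -> f y = 0) -> is_derive x v f d -> d = 0.
Proof.
move=> oU Ux f0 [df <-].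
rewrite (@near_eq_derive _ _ _ f (cst 0)) ?derive_cst//.
by apply: filterS (open_nbhs_nbhs (conj oU Ux)) => y Uy; rewrite f0.
Qed.

Lemma derive_symm_mx (V : normedModType R) m n (U : set V) (f : V -> 'M[R]_(m, n)) x v w :
  open U -> U x -> C1_on U f -> C1_on U ('D_v f) -> C1_on U ('D_w f) ->
  'D_w ('D_v f) x = 'D_v ('D_w f) x.
Proof.
move=> oU Ux C Cv Cw; apply/matrixP => i j.
have entryD a : C1_on U ('D_a f) -> C1_on U ('D_a (fun y => f y i j)).
  move=> Ca; have [dfa cfa] := C1_entry i j oU Ca.
  have E y : U y -> 'D_a f y i j = 'D_a (fun y => f y i j) y.
    by move=> Uy; rewrite derive_entry//; exact: C.1.
  have EN y : U y -> \forall z \near y, 'D_a f z i j = 'D_a (fun y => f y i j) z.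
    by move=> Uy; apply: filterS (open_nbhs_nbhs (conj oU Uy)) => z; exact: E.
  split=> [y b Uy|b y Uy]; first exact: near_eq_derivable (EN y Uy) (dfa y b Uy).
  apply: continuous_near_eq (cfa b y Uy).
  apply: filterS (open_nbhs_nbhs (conj oU Uy)) => z Uz.
  exact: near_eq_derive (EN z Uz).
have E a b : C1_on U ('D_a f) -> 'D_b ('D_a f) x i j = 'D_b ('D_a (fun y => f y i j)) x.
  move=> Ca; rewrite -derive_entry; last exact: Ca.1.
  apply: near_eq_derive; apply: filterS (open_nbhs_nbhs (conj oU Ux)) => z Uz.
  by rewrite derive_entry//; exact: C.1.
have S := derive_symm oU Ux (C1_entry i j oU C) (entryD v Cv) (entryD w Cw).
exact: etrans (E v w Cv) (etrans S (esym (E w v Cw))).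
Qed.

End FrameLemmas.

(** The identities at the maximum point, with all derivatives abstracted: Yi and
Ni stand for first derivatives along an orthonormal principal frame, Yii and Nii
for second ones, Yx and Nx for derivatives along the tangential part xi of the
position vector, Yxi for mixed ones, and T for the terms with third derivatives.
The vector z is half the gradient of the squared projected distance. *)
Section ShrinkerAlgebra.
Context {R : realType} {n : nat}.
Variables (Y N z Yx Nx : 'rV[R]_n.+1) (K mu : R) (k s P T : 'I_n -> R).
Variables (Yi Ni Yii Nii Yxi : 'I_n -> 'rV[R]_n.+1).
Hypothesis (frame : forall i j, dot (Yi i) (Yi j) = (i == j)%:R).
Hypothesis (NN : dot N N = 1).
Hypothesis (NYi : forall i, dot N (Yi i) = 0).
Hypothesis (KE : K = - dot Y N).
Hypothesis (YxE : Yx = \sum_j dot Y (Yi j) *: Yi j).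
Hypothesis (NiN : forall i, dot (Ni i) N = 0).
Hypothesis (NxN : dot Nx N = 0).
Hypothesis (NiYj : forall i j, dot (Ni i) (Yi j) = - k i *+ (i == j)).
Hypothesis (NYii : forall i, dot N (Yii i) = k i).
Hypothesis (NxYj : forall j, dot Nx (Yi j) = dot (Ni j) Yx).
Hypothesis (NiiYx : forall i, dot (Nii i) Yx + 2 * dot (Ni i) (Yxi i) + T i = 0).
Hypothesis (NiiN : forall i, dot (Nii i) N + dot (Ni i) (Ni i) = 0).
Hypothesis (critical : forall j, - dot Y (Ni j) = mu * dot z (Yi j)).
Hypothesis (max2 : forall i,
  - (dot (Yi i) (Ni i) + dot Y (Nii i)) - mu * (s i + dot z (Yii i)) <= 0).
Hypothesis (PK : forall i, P i * k i = K).
Hypothesis (jacobi : - dot Y Nx + K * \sum_i 2 * dot (Yi i) (Yxi i) =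
  \sum_i P i * (dot Nx (Yii i) + T i)).
Hypothesis (k0 : forall i, 0 <= k i).
Hypothesis (P0 : forall i, 0 <= P i).

Let weingarten i : Ni i = - k i *: Yi i.
Proof.
apply/subr0_eq; rewrite scaleNr opprK.
apply: (orthonormal_frame_zero frame NN NYi) => [|j].
  by rewrite dotDl dotZl NiN (dotC (Yi i)) NYi mulr0 addr0.
by rewrite dotDl dotZl NiYj frame -mulr_natr; ring.
Qed.

Let YxN : dot Yx N = 0.
Proof. by rewrite YxE dot_suml big1// => j _; rewrite dotZl (dotC (Yi j)) NYi mulr0. Qed.

Let YxYi i : dot Yx (Yi i) = dot Y (Yi i).
Proof.
rewrite YxE dot_suml (bigD1 i)//= dotZl frame eqxx mulr1 big1 ?addr0//.
by move=> j ji; rewrite dotZl frame (negbTE ji) mulr0.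
Qed.

Let Y_split : Y = Yx - K *: N.
Proof.
apply/subr0_eq; apply: (orthonormal_frame_zero frame NN NYi) => [|i].
  by rewrite opprB addrCA dotDl dotBl dotZl NN YxN KE; ring.
by rewrite opprB addrCA dotDl dotBl dotZl NYi YxYi; ring.
Qed.

Let NxYi j : dot Nx (Yi j) = - mu * dot z (Yi j).
Proof.
have -> : - mu * dot z (Yi j) = - (mu * dot z (Yi j)) by ring.
rewrite NxYj -critical opprK {1}Y_split dotBl dotZl.
by rewrite (dotC N) NiN mulr0 subr0 dotC.
Qed.

Let Nx_split : Nx + mu *: z = (mu * dot z N) *: N.
Proof.
apply/subr0_eq; apply: (orthonormal_frame_zero frame NN NYi) => [|j].
  by rewrite dotBl dotDl !dotZl NxN NN; ring.
by rewrite dotBl dotDl !dotZl NYi NxYi; ring.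
Qed.

Let NxYii i : dot Nx (Yii i) = mu * dot z N * k i - mu * dot z (Yii i).
Proof.
have -> : mu * dot z N * k i = dot (Nx + mu *: z) (Yii i) by rewrite Nx_split dotZl NYii.
by rewrite dotDl dotZl; ring.
Qed.

(* This is the derivative of K along xi. *)
Let YNx_ge0 : 0 <= - dot Y Nx.
Proof.
have -> : - dot Y Nx = \sum_j k j * dot Y (Yi j) ^+ 2.
  rewrite {1}Y_split dotBl dotZl (dotC N) NxN mulr0 subr0 YxE dot_suml -sumrN.
  apply: eq_bigr => j _; rewrite dotZl (dotC (Yi j)) NxYi.
  have -> : - mu * dot z (Yi j) = - (mu * dot z (Yi j)) by ring.
  by rewrite -critical weingarten dotZr; ring.
by apply: sumr_ge0 => j _; rewrite mulr_ge0// sqr_ge0.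
Qed.

(* The left hand side is the second derivative of K along a principal direction,
   computed from K = - <Y, N>. *)
Let hess i : - (dot (Yi i) (Ni i) + dot Y (Nii i)) =
  k i - (k i * (2 * dot (Yi i) (Yxi i)) - T i + K * k i ^+ 2).
Proof.
have -> : dot Y (Nii i) = dot (Nii i) Yx - K * dot (Nii i) N.
  by rewrite {1}Y_split dotBl dotZl (dotC Yx) (dotC N).
have := NiiN i; have := NiiYx i; rewrite weingarten !dotZl !dotZr frame eqxx !mulr1.
set a := dot (Nii i) N; set b := dot (Nii i) Yx; set c := dot (Yi i) (Yxi i) => H1 H2.
have -> : a = - (k i ^+ 2) by rewrite expr2; lra.
have -> : b = 2 * (k i * c) - T i by lra.
by ring.
Qed.

(** The second order conditions are summed with the weights P i, which are the
coefficients of the linearized determinant.  As P i * k i = K, the zeroth order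
terms add up to K (n - K H).  The third derivatives are eliminated by Jacobi's
formula: they only enter through the derivative of K along xi, which is
\sum_j k j <Y, Yi j>^2 at a critical point, hence nonnegative by convexity. *)
Lemma shrinker_algebra :
  K * (n%:R - K * \sum_i k i) <= mu * \sum_i P i * (s i + k i * dot z N).
Proof.
pose S := \sum_i P i * (- (dot (Yi i) (Ni i) + dot Y (Nii i)) - mu * (s i + dot z (Yii i))).
have S0 : S <= 0 by apply: sumr_le0 => i _; rewrite mulr_ge0_le0.
have TE : S = n%:R * K - K * \sum_i 2 * dot (Yi i) (Yxi i) + \sum_i P i * (dot Nx (Yii i) + T i)
   - K ^+ 2 * \sum_i k i - mu * \sum_i P i * (s i + k i * dot z N).
  have -> : n%:R * K = \sum_(i < n) K by rewrite sumr_const card_ord mulr_natl.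
  rewrite /S !mulr_sumr -!sumrN -!big_split /=; apply: eq_bigr => i _.
  rewrite hess NxYii -(PK i); ring.
move: S0 YNx_ge0; rewrite TE -jacobi.
set SG := \sum_i 2 * _; set SK := \sum_i k i; set SR := \sum_i _ * _.
nra.
Qed.

End ShrinkerAlgebra.

Section LocalComputation.
Context {R : realType} {n : nat}.
Variables (U : set 'rV[R]_n) (u0 : 'rV[R]_n).
Variables (Y N : 'rV[R]_n -> 'rV[R]_n.+1) (K : 'rV[R]_n -> R).
Variables (e : 'I_n -> 'rV[R]_n) (k : 'I_n -> R).
Variables (E : 'M[R]_(n.+1, n)) (y0 : 'rV[R]_n.+1) (mu : R).

Hypothesis (oU : open U) (Uu0 : U u0).
Hypothesis (Y1 : C1_on U Y).
Hypothesis (Y2 : forall v, C1_on U ('D_v Y)).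
Hypothesis (Y3 : forall v w, C1_on U ('D_w ('D_v Y))).
Hypothesis (N1 : forall u v, U u -> derivable N u v).
Hypothesis (N2 : forall v w, derivable ('D_v N) u0 w).
Hypothesis (NN : forall u, U u -> dot (N u) (N u) = 1).
Hypothesis (NY : forall u v, U u -> dot (N u) ('D_v Y u) = 0).
Hypothesis (shrinker : forall u, U u -> K u = - dot (Y u) (N u)).
Hypothesis (Kdet : forall u, U u ->
  K u * \det (\matrix_(i, j) dot ('D_(e i) Y u) ('D_(e j) Y u)) =
  \det (\matrix_(i, j) dot (N u) ('D_(e i) ('D_(e j) Y) u))).
Hypothesis (frame : forall i j, dot ('D_(e i) Y u0) ('D_(e j) Y u0) = (i == j)%:R).
Hypothesis (principal : forall i j, dot (N u0) ('D_(e i) ('D_(e j) Y) u0) = k i *+ (i == j)).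
Hypothesis (k0 : forall i, 0 <= k i).

Let F u : 'rV[R]_n := (Y u - y0) *m E.
Let phi u : R := K u - mu / 2 * dot (F u) (F u).
Hypothesis (phi_max : forall u, U u -> phi u <= phi u0).

Let DY u v : U u -> is_derive u v Y ('D_v Y u).
Proof. by move=> Uu; apply/derivableP/Y1.1. Qed.
Let DDY u v w : U u -> is_derive u w ('D_v Y) ('D_w ('D_v Y) u).
Proof. by move=> Uu; apply/derivableP/(Y2 v).1. Qed.
Let DDDY u v w x : U u -> is_derive u x ('D_w ('D_v Y)) ('D_x ('D_w ('D_v Y)) u).
Proof. by move=> Uu; apply/derivableP/(Y3 v w).1. Qed.
Let DN u v : U u -> is_derive u v N ('D_v N u).
Proof. by move=> Uu; apply/derivableP/N1. Qed.
Let DDN v w : is_derive u0 w ('D_v N) ('D_w ('D_v N) u0).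
Proof. by apply/derivableP/N2. Qed.

Let wein u v w : U u -> dot ('D_w N u) ('D_v Y u) + dot (N u) ('D_w ('D_v Y) u) = 0.
Proof.
move=> Uu; apply: (derive_zero_on oU Uu (fun y => @NY y v)).
by apply: is_derive_dot; [exact: DN|exact: DDY].
Qed.

Let dNN u w : U u -> dot ('D_w N u) (N u) = 0.
Proof.
move=> Uu.
have H : is_derive u w (fun y => dot (N y) (N y) - 1) (dot ('D_w N u) (N u) + dot (N u) ('D_w N u) - 0).
  apply: (@is_deriveB _ _ _ (fun y => dot (N y) (N y)) (cst 1)).
  by apply: is_derive_dot; exact: DN.
have := derive_zero_on oU Uu _ H.
rewrite subr0 (dotC (N u)) => H0.
have {}H0 : dot ('D_w N u) (N u) + dot ('D_w N u) (N u) = 0.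
  by apply: H0 => y Uy; rewrite NN// subrr.
lra.
Qed.

Let wein2 v w x : dot ('D_x ('D_w N) u0) ('D_v Y u0) + dot ('D_w N u0) ('D_x ('D_v Y) u0)
  + (dot ('D_x N u0) ('D_w ('D_v Y) u0) + dot (N u0) ('D_x ('D_w ('D_v Y)) u0)) = 0.
Proof.
apply: (derive_zero_on oU Uu0 (fun y => @wein y v w)).
apply: is_deriveD; apply: is_derive_dot => //; [exact: DDY|exact: DN|exact: DDDY].
Qed.

Let dNN2 w x : dot ('D_x ('D_w N) u0) (N u0) + dot ('D_w N u0) ('D_x N u0) = 0.
Proof.
apply: (derive_zero_on oU Uu0 (fun y => @dNN y w)).
by apply: is_derive_dot => //; exact: DN.
Qed.

Let Yi i := 'D_(e i) Y u0.

Let xi := \sum_j dot (Y u0) (Yi j) *: e j.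

Let DY_xi : 'D_xi Y u0 = \sum_j dot (Y u0) (Yi j) *: Yi j.
Proof.
rewrite (deriveEjacobian _ (C1_differentiable oU Y1 Uu0)) /xi mulmx_suml.
apply: eq_bigr => j _; rewrite -scalemxAl -deriveEjacobian//.
exact: C1_differentiable oU Y1 Uu0.
Qed.

Let DK u w : U u -> is_derive u w K (- dot (Y u) ('D_w N u)).
Proof.
move=> Uu; apply: (@near_eq_is_derive _ _ _ (fun y => - dot (Y y) (N y))).
  by apply: filterS (open_nbhs_nbhs (conj oU Uu)) => y Uy; rewrite shrinker.
apply: is_derive_eq; first by apply: is_deriveN; apply: is_derive_dot; [exact: DY|exact: DN].
by rewrite (dotC ('D_w Y u)) NY// add0r.
Qed.

Let DF u w : U u -> is_derive u w F ('D_w Y u *m E).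
Proof.
move=> Uu; apply: is_derive_eq.
  apply: (@is_derive_mulmx _ _ _ _ _ (fun y => Y y - y0) (cst E)).
  by apply: (@is_deriveB _ _ _ Y (cst y0)); exact: DY.
by rewrite subr0 mulmx0 addr0.
Qed.

Let DDF v w : is_derive u0 w (fun y => 'D_v Y y *m E) ('D_w ('D_v Y) u0 *m E).
Proof.
apply: is_derive_eq.
  by apply: (@is_derive_mulmx _ _ _ _ _ ('D_v Y) (cst E)); exact: DDY.
by rewrite mulmx0 addr0.
Qed.

Let z : 'rV[R]_n.+1 := F u0 *m E^T.

Let Dphi u w : U u -> is_derive u w phi
  (- dot (Y u) ('D_w N u) - mu * dot (F u) ('D_w Y u *m E)).
Proof.
move=> Uu; apply: is_derive_eq.
  apply: (@is_deriveB _ _ _ K (fun y => mu / 2 * dot (F y) (F y))); first exact: DK.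
  apply: (@is_deriveM _ _ (cst (mu / 2)) (fun y => dot (F y) (F y))).
  by apply: is_derive_dot; exact: DF.
rewrite scaler0 addr0 -[(mu / 2) *: _]/(mu / 2 * _) (dotC ('D_w Y u *m E)).
by congr (_ - _); field.
Qed.

Let DDphi v w : is_derive u0 w ('D_v phi)
  (- (dot ('D_w Y u0) ('D_v N u0) + dot (Y u0) ('D_w ('D_v N) u0))
   - mu * (dot ('D_w Y u0 *m E) ('D_v Y u0 *m E) + dot z ('D_w ('D_v Y) u0))).
Proof.
apply: (@near_eq_is_derive _ _ _ (fun y => - dot (Y y) ('D_v N y) - mu * dot (F y) ('D_v Y y *m E))).
  apply: filterS (open_nbhs_nbhs (conj oU Uu0)) => y Uy.
  by rewrite (derive_val (is_derive := Dphi v Uy)).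
apply: is_derive_eq.
  apply: (@is_deriveB _ _ _ (fun y => - dot (Y y) ('D_v N y)) (fun y => mu * dot (F y) ('D_v Y y *m E))).
    by apply: is_deriveN; apply: is_derive_dot => //; exact: DY.
  apply: (@is_deriveM _ _ (cst mu) (fun y => dot (F y) ('D_v Y y *m E))).
  by apply: is_derive_dot; [exact: DF|exact: DDF].
by rewrite scaler0 addr0 -[mu *: _]/(mu * _) /z -dot_trmx.
Qed.

Let critical w : - dot (Y u0) ('D_w N u0) = mu * dot z ('D_w Y u0).
Proof.
have D0 : 'D_w phi u0 = 0.
  by apply: (derive_local_max oU Uu0 phi_max) => y Uy; have [] := Dphi w Uy.
have := derive_val (is_derive := Dphi w Uu0); rewrite D0 dot_trmx -/z => H.
apply/subr0_eq; exact: esym H.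
Qed.

Let max2 i : - (dot (Yi i) ('D_(e i) N u0) + dot (Y u0) ('D_(e i) ('D_(e i) N) u0))
   - mu * (dot (Yi i *m E) (Yi i *m E) + dot z ('D_(e i) ('D_(e i) Y) u0)) <= 0.
Proof.
have := @second_derivative_test _ _ U phi u0 (e i) oU Uu0 phi_max.
rewrite (derive_val (is_derive := DDphi (e i) (e i))); apply.
  by move=> y Uy; have [] := Dphi (e i) Uy.
by have [] := DDphi (e i) (e i).
Qed.

Let Yxi_symm i u : U u -> 'D_(e i) ('D_xi Y) u = 'D_xi ('D_(e i) Y) u.
Proof. move=> Uu; exact: derive_symm_mx oU Uu Y1 (Y2 xi) (Y2 (e i)). Qed.

Let Yxi_symm3 i : 'D_(e i) ('D_(e i) ('D_xi Y)) u0 = 'D_xi ('D_(e i) ('D_(e i) Y)) u0.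
Proof.
transitivity ('D_(e i) ('D_xi ('D_(e i) Y)) u0).
  apply: near_eq_derive; apply: filterS (open_nbhs_nbhs (conj oU Uu0)) => y Uy.
  exact: Yxi_symm.
exact: derive_symm_mx oU Uu0 (Y2 (e i)) (Y3 (e i) xi) (Y3 (e i) (e i)).
Qed.

Let G i := 2 * dot (Yi i) ('D_xi ('D_(e i) Y) u0).
Let H i := dot ('D_xi N u0) ('D_(e i) ('D_(e i) Y) u0) + dot (N u0) ('D_xi ('D_(e i) ('D_(e i) Y)) u0).
Let P i := \prod_(j | j != i) k j.

Let K_prod : K u0 = \prod_i k i.
Proof.
have := Kdet Uu0.
have -> : \matrix_(i, j) dot ('D_(e i) Y u0) ('D_(e j) Y u0) = 1%:M.
  by apply/matrixP => i j; rewrite !mxE frame.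
have -> : \matrix_(i, j) dot (N u0) ('D_(e i) ('D_(e j) Y) u0) = diag_mx (\row_i k i).
  by apply/matrixP => i j; rewrite !mxE principal.
by rewrite det1 mulr1 det_diag => ->; apply: eq_bigr => i _; rewrite mxE.
Qed.

Let PK i : P i * k i = K u0.
Proof. by rewrite K_prod /P [RHS](bigD1 i)//= mulrC. Qed.

(* Jacobi's formula, applied to both sides of K det g = det h along xi: at u0 the
   matrices g and h are the identity and diagonal. *)
Let jacobi : - dot (Y u0) ('D_xi N u0) + K u0 * \sum_i G i = \sum_i P i * H i.
Proof.
pose gm (y : 'rV[R]_n) : 'M[R]_n := \matrix_(i, j) dot ('D_(e i) Y y) ('D_(e j) Y y).
pose hm (y : 'rV[R]_n) : 'M[R]_n := \matrix_(i, j) dot (N y) ('D_(e i) ('D_(e j) Y) y).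
have Dg : is_derive u0 xi gm
  (\matrix_(i, j) (dot ('D_xi ('D_(e i) Y) u0) (Yi j) + dot (Yi i) ('D_xi ('D_(e j) Y) u0))).
  apply: is_derive_mx => i j; rewrite [X in is_derive _ _ _ X]mxE.
  have -> : (fun y => gm y i j) = (fun y => dot ('D_(e i) Y y) ('D_(e j) Y y)).
    by apply/funext => y; rewrite mxE.
  by apply: is_derive_dot; exact: DDY.
have Dh : is_derive u0 xi hm
  (\matrix_(i, j) (dot ('D_xi N u0) ('D_(e i) ('D_(e j) Y) u0) + dot (N u0) ('D_xi ('D_(e i) ('D_(e j) Y)) u0))).
  apply: is_derive_mx => i j; rewrite [X in is_derive _ _ _ X]mxE.
  have -> : (fun y => hm y i j) = (fun y => dot (N y) ('D_(e i) ('D_(e j) Y) y)).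
    by apply/funext => y; rewrite mxE.
  by apply: is_derive_dot; [exact: DN|exact: DDDY].
have g1 i j : gm u0 i j = (1 : R) *+ (i == j) by rewrite mxE frame.
have h1 i j : hm u0 i j = k i *+ (i == j) by rewrite mxE principal.
have Ddg := @is_derive_det _ _ _ _ _ _ _ (fun=> 1) Dg g1.
have Ddh := @is_derive_det _ _ _ _ _ _ _ k Dh h1.
have DKg := @is_deriveM _ _ K (fun y => \det (gm y)) u0 xi _ _ (DK xi Uu0) Ddg.
have KE : 'D_xi (K * (fun y => \det (gm y))) u0 = 'D_xi (fun y => \det (hm y)) u0.
  apply: near_eq_derive; apply: filterS (open_nbhs_nbhs (conj oU Uu0)) => y Uy.
  exact: Kdet Uy.
move: KE; rewrite (derive_val (is_derive := DKg)) (derive_val (is_derive := Ddh)).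
have -> : \det (gm u0) = 1.
  by have -> : gm u0 = 1%:M; [apply/matrixP => i j; rewrite g1 mxE|rewrite det1].
rewrite scale1r addrC -[K u0 *: _]/(K u0 * _) => KE.
transitivity (- dot (Y u0) ('D_xi N u0) + K u0 * \sum_i (\prod_(j | j != i) 1) *
   (\matrix_(i, j) (dot ('D_xi ('D_(e i) Y) u0) (Yi j) + dot (Yi i) ('D_xi ('D_(e j) Y) u0))) i i).
  congr (_ + _ * _); apply: eq_bigr => i _; rewrite big1 ?mul1r ?mxE// /G dotC; ring.
rewrite KE; apply: eq_bigr => i _; by rewrite mxE.
Qed.

(** This is [shrinker_algebra] for the derivatives of the actual maps, the mixed
ones being reordered by symmetry. *)
Lemma shrinker_local_inequality :
  K u0 * (n%:R - K u0 * \sum_i k i) <=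
  mu * \sum_i P i * (dot (Yi i *m E) (Yi i *m E) + k i * dot z (N u0)).
Proof.
apply: (@shrinker_algebra R n (Y u0) (N u0) z ('D_xi Y u0) ('D_xi N u0) (K u0) mu k
  (fun i => dot (Yi i *m E) (Yi i *m E)) P (fun i => dot (N u0) ('D_xi ('D_(e i) ('D_(e i) Y)) u0))
  Yi (fun i => 'D_(e i) N u0) (fun i => 'D_(e i) ('D_(e i) Y) u0)
  (fun i => 'D_(e i) ('D_(e i) N) u0) (fun i => 'D_xi ('D_(e i) Y) u0)).
- exact: frame.
- exact: NN.
- by move=> i; exact: NY.
- exact: shrinker.
- exact: DY_xi.
- by move=> i; exact: dNN.
- exact: dNN.
- move=> i j; have W := wein (e j) (e i) Uu0; have Pr := principal i j.
  by move: W; rewrite [dot (N u0) _]Pr mulNrn => /eqP; rewrite addr_eq0 => /eqP.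
- by move=> i; apply: etrans (principal i i) _; rewrite eqxx.
- move=> j; have H1 := wein (e j) xi Uu0; have H2 := wein xi (e j) Uu0.
  move: H2; rewrite [in X in _ + X](Yxi_symm j Uu0) => H2.
  exact: (addIr _ (etrans H1 (esym H2))).
- move=> i.
  have aux (a b b' d d' : R) : b = b' -> d = d' -> a + b + (b + d) = 0 -> a + 2 * b' + d' = 0.
    by move=> <- <-; lra.
  apply: aux (wein2 xi (e i) (e i)).
    exact (congr1 (dot ('D_(e i) N u0)) (Yxi_symm i Uu0)).
  exact (congr1 (dot (N u0)) (Yxi_symm3 i)).
- by move=> i; exact: dNN2.
- by move=> j; exact: critical.
- by move=> i; exact: max2.
- by move=> i; exact: PK.
- exact: jacobi.
- exact: k0.
- by move=> i; apply: prodr_ge0.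
Qed.

End LocalComputation.

(** * Regularity of the unit normal *)

Section Smoothness.
Context {R : realType} {V W : normedModType R}.

Lemma Ck1_C1 (U : set V) (f : V -> W) : Ck_on 1 U f -> C1_on U f.
Proof.
move=> [cf H]; split=> [x v Ux|v x Ux]; first exact: (H v).1.
by have [_ [cD _]] := H v; exact: cD.
Qed.

Lemma smooth_C1 (U : set V) (f : V -> W) : smooth_on U f -> C1_on U f.
Proof. by move=> /(_ 1)/Ck1_C1. Qed.

Lemma smooth_derive (U : set V) (f : V -> W) v : smooth_on U f -> smooth_on U ('D_v f).
Proof. by move=> H k; have [_ /(_ v)[]] := H k.+1. Qed.

Lemma smooth_continuous (U : set V) (f : V -> W) x : smooth_on U f -> U x -> {for x, continuous f}.
Proof. by move=> /(_ 0)[cf _] Ux; exact: cf. Qed.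

End Smoothness.

Section NormalFrames.
Context {R : realType} {n : nat}.
Implicit Types (J : 'M[R]_(n, n.+1)) (N x : 'rV[R]_n.+1).

Lemma normal_frame_unit N J : dot N N = 1 -> N *m J^T = 0 -> row_free J ->
  (col_mx N J : 'M[R]_n.+1) \in unitmx.
Proof.
move=> NN NJ fJ; rewrite -row_free_unit; apply: inj_row_free => v.
rewrite -[v](@hsubmxK _ 1 1 n); set a := lsubmx _; set b := rsubmx _.
rewrite (@mul_row_col _ 1 1 n n.+1) => H.
have aE : a *m N = dot a 1 *: N by rewrite [a]mx11_scalar mul_scalar_mx; congr (_ *: _); rewrite /dot big_ord1 !mxE eqxx mulr1.
have := congr1 (fun y => dot y N) H.
rewrite dotDl aE dotZl NN mulr1 dot0l (dotC (b *m J)) dot_trmx NJ dot0l addr0 => a0.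
have {}a0 : a = 0.
  have d1 : dot a 1 = a 0 0 by rewrite /dot big_ord1 [X in _ * X]mxE eqxx mulr1.
  by rewrite [LHS]mx11_scalar -d1 a0 raddf0.
move: H; rewrite a0 mul0mx add0r => bJ.
have -> : b = 0 by apply: (row_free_inj fJ); rewrite bJ mul0mx.
by rewrite row_mx0.
Qed.

(** In the basis formed by the normal and the rows of J, a vector orthogonal to
the normal has no normal coordinate. *)
Lemma orthogonal_normal_sub m N J (A : 'M[R]_(m, n.+1)) : dot N N = 1 -> N *m J^T = 0 -> row_free J ->
  A *m N^T = 0 -> (A <= J)%MS.
Proof.
move=> NN NJ fJ AN; have uM := normal_frame_unit NN NJ fJ.
rewrite -(mulmxKV uM A); set B := A *m invmx _.
have E : B *m (col_mx N J : 'M[R]_n.+1) = A by rewrite mulmxKV.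
move: E; rewrite -[B](@hsubmxK _ m 1 n); set a := lsubmx _; set b := rsubmx _.
rewrite (@mul_row_col _ m 1 n n.+1) => E.
have a0 : a = 0.
  have := congr1 (fun Z => Z *m N^T) E.
  rewrite mulmxDl -!mulmxA mulmx_trE NN AN mulmx1.
  have -> : J *m N^T = 0 by rewrite -[J]trmxK -trmx_mul NJ trmx0.
  by rewrite mulmx0 addr0.
by rewrite a0 mul0mx add0r submxMl.
Qed.

End NormalFrames.

Section NormalRegularity.
Context {R : realType} {n : nat}.
Variables (U : set 'rV[R]_n) (Y N : 'rV[R]_n -> 'rV[R]_n.+1).
Hypothesis (oU : open U).
Hypothesis (sY : smooth_on U Y).
Hypothesis (cN : forall u, U u -> {for u, continuous N}).
Hypothesis (NN : forall u, U u -> dot (N u) (N u) = 1).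
Hypothesis (NJ : forall u, U u -> N u *m ('J Y u)^T = 0).
Hypothesis (fJ : forall u, U u -> row_free ('J Y u)).

Let Jm u : 'M[R]_(n, n.+1) := \matrix_i ('D_(delta_mx 0 i) Y u).
Let dJm v u : 'M[R]_(n, n.+1) := \matrix_i ('D_v ('D_(delta_mx 0 i) Y) u).

Let JmE u : U u -> 'J Y u = Jm u.
Proof.
move=> Uu; apply/matrixP => i j.
by rewrite (jacobianE i j oU (smooth_C1 sY) Uu) [RHS]mxE.
Qed.

Let is_derive_rows (f : 'I_n -> 'rV[R]_n -> 'rV[R]_n.+1) (df : 'I_n -> 'rV[R]_n.+1) u v :
  (forall i, is_derive u v (f i) (df i)) ->
  is_derive u v (fun y => \matrix_i f i y : 'M[R]_(n, n.+1)) (\matrix_i df i).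
Proof.
move=> H; apply: is_derive_mx => i j; rewrite [X in is_derive _ _ _ X]mxE.
have -> : (fun y => (\matrix_i f i y : 'M[R]_(n, n.+1)) i j) = (fun y => f i y 0 j).
  by apply/funext => y; rewrite mxE.
exact: is_derive_entry.
Qed.

Let DJm u v : U u -> is_derive u v Jm (dJm v u).
Proof.
move=> Uu; apply: is_derive_rows => i; apply: derivableP.
exact: (smooth_C1 (smooth_derive _ sY)).1.
Qed.

Let DdJm u v w : U u -> is_derive u w (dJm v)
  (\matrix_i ('D_w ('D_v ('D_(delta_mx 0 i) Y)) u)).
Proof.
move=> Uu; apply: is_derive_rows => i; apply: derivableP.
exact: (smooth_C1 (smooth_derive _ (smooth_derive _ sY))).1.
Qed.

Let M u : 'M[R]_n.+1 := (col_mx (N u) (Jm u) : 'M[R]_n.+1)^T.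
Let rhs v u : 'rV[R]_n.+1 := row_mx (0 : 'rV[R]_1) (- (N u *m (dJm v u)^T)).

Let NJm u : U u -> N u *m (Jm u)^T = 0.
Proof. by move=> Uu; rewrite -JmE//; exact: NJ. Qed.

Let uM0 u : U u -> (col_mx (N u) (Jm u) : 'M[R]_n.+1) \in unitmx.
Proof.
move=> Uu; apply: normal_frame_unit; [exact: NN|exact: NJm|].
by rewrite -JmE//; exact: fJ.
Qed.

Let uM u : U u -> M u \in unitmx.
Proof. by move=> Uu; rewrite unitmx_tr; exact: uM0. Qed.

Let DN u v : U u -> is_derive u v N (rhs v u *m invmx (M u)).
Proof.
move=> Uu; apply: is_derive_normal (uM0 Uu) (DJm v Uu).
  apply: (@cvg_comp _ _ _ (fun h : R => h *: v + u) N _ (nbhs u)); last exact: cN.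
  exact: cvg_along.
by apply: filterS (open_nbhs_nbhs (conj oU Uu)) => y Uy; split; [exact: NN|exact: NJm].
Qed.

Let DN_eq u v : U u -> 'D_v N u *m M u = rhs v u.
Proof. by move=> Uu; have [_ ->] := DN v Uu; rewrite mulmxKV//; exact: uM. Qed.

Let is_derive_col_row u w dN dJ : is_derive u w N dN -> is_derive u w Jm dJ ->
  is_derive u w M (col_mx dN dJ : 'M[R]_n.+1)^T.
Proof.
move=> HN HJ; apply: (@is_derive_trmx _ _ n.+1 n.+1 (fun u => col_mx (N u) (Jm u) : 'M[R]_n.+1)).
apply: is_derive_mx => i j; rewrite [X in is_derive _ _ _ X](@mxE _ (1 + n) n.+1).
have -> : (fun y => (col_mx (N y) (Jm y) : 'M[R]_n.+1) i j) =
    (fun y => match @fintype.split 1 n i with inl i1 => N y i1 j | inr i2 => Jm y i2 j end).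
  by apply/funext => y; rewrite (@mxE _ (1 + n) n.+1).
by case: (@fintype.split 1 n i) => i1; exact: is_derive_entry.
Qed.

Let Drhs u v w : U u -> exists d, is_derive u w (rhs v) d.
Proof.
move=> Uu; have D1 := is_derive_mulmx (DN w Uu) (is_derive_trmx (DdJm v w Uu)).
set d1 := (_ + _) in D1.
exists (row_mx (0 : 'rV[R]_1) (- d1) : 'rV[R]_n.+1).
apply: is_derive_mx => i j; rewrite [X in is_derive _ _ _ X](@mxE _ 1 (1 + n)).
have -> : (fun y => rhs v y i j) =
    (fun y => match @fintype.split 1 n j with inl j1 => (0 : 'rV[R]_1) i j1 | inr j2 => (- (N y *m (dJm v y)^T)) i j2 end).
  by apply/funext => y; rewrite /rhs (@mxE _ 1 (1 + n)).
case: (@fintype.split 1 n j) => j1; first by rewrite mxE; exact: is_derive_cst.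
exact: (@is_derive_entry _ _ 1 n (fun y => - (N y *m (dJm v y)^T))).
Qed.

(** The unit normal is only assumed continuous.  Its derivatives solve the linear
system with matrix [M] obtained by differentiating the two relations that define
it, so they inherit the regularity of the right hand side. *)
Lemma normal_C1 : C1_on U N.
Proof.
split=> [u v Uu|v u Uu]; first by have [] := DN v Uu.
have -> : {for u, continuous ('D_v N)} = ('D_v N y @[y --> nbhs u] --> 'D_v N u) by [].
have -> : 'D_v N u = rhs v u *m invmx (M u) by have [] := DN v Uu.
have cvg_rows (f : 'I_n -> 'rV[R]_n -> 'rV[R]_n.+1) :
    (forall i, smooth_on U (f i)) ->
    (\matrix_i f i y : 'M[R]_(n, n.+1)) @[y --> nbhs u] --> (\matrix_i f i u : 'M[R]_(n, n.+1)).
  move=> sf; apply: (@cvg_mx _ _ (nbhs u) (nbhs_filter u)) => i j.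
  have /cvg_mxP/(_ 0 j) H := smooth_continuous (sf i) Uu.
  rewrite [X in _ --> X]mxE; apply: cvg_trans H; apply: near_eq_cvg.
  by apply: nearW => y; rewrite mxE.
have cJ : Jm y @[y --> nbhs u] --> Jm u by apply: cvg_rows => i; exact: smooth_derive.
have cdJ : dJm v y @[y --> nbhs u] --> dJm v u.
  by apply: cvg_rows => i; do 2 apply: smooth_derive.
have cNu : N y @[y --> nbhs u] --> N u by exact: cN.
apply: (@cvg_solve _ _ (nbhs u) (nbhs_filter u) n.+1 1 M ('D_v N) (rhs v)).
- exact: uM.
- apply: (@cvg_trmx _ _ (nbhs u) (nbhs_filter u) n.+1 n.+1).
  exact (@cvg_col_mx R _ (nbhs u) (nbhs_filter u) 1 n n.+1 N Jm (N u) (Jm u) cNu cJ).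
- apply: (@cvg_row_mx _ _ (nbhs u) (nbhs_filter u) 1 1 n); first exact: cvg_cst.
  apply: (@cvgN _ _ _ (nbhs u) (nbhs_filter u)).
  have cdJT := @cvg_trmx R _ (nbhs u) (nbhs_filter u) _ _ (dJm v) (dJm v u) cdJ.
  exact (@cvg_mulmx R _ (nbhs u) (nbhs_filter u) _ _ _ N (fun y => (dJm v y)^T) _ _ cNu cdJT).
- by apply: filterS (open_nbhs_nbhs (conj oU Uu)) => y; exact: DN_eq.
Qed.

Lemma normal_C2 u v w : U u -> derivable ('D_v N) u w.
Proof.
move=> Uu; have [d Hd] := Drhs v w Uu.
have DM := is_derive_col_row (DN w Uu) (DJm w Uu).
have near_eq : \forall y \near u, 'D_v N y *m M y = rhs v y.
  by apply: filterS (open_nbhs_nbhs (conj oU Uu)) => y; exact: DN_eq.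
by have [] := is_derive_solve (uM Uu) near_eq DM Hd.
Qed.

End NormalRegularity.

(** * Hypersurfaces in charts *)

Section ChartCalculus.
Context {R : realType}.

Lemma mulmx_inj_row n m (A B : 'M[R]_(n, m)) :
  (forall v : 'rV[R]_n, v *m A = v *m B) -> A = B.
Proof. by move=> H; apply/row_matrixP => i; rewrite !rowE H. Qed.

Lemma jacobian_comp n m p (f : 'rV[R]_n -> 'rV[R]_m) (h : 'rV[R]_m -> 'rV[R]_p) u :
  differentiable f u -> differentiable h (f u) ->
  'J (h \o f) u = 'J f u *m 'J h (f u).
Proof.
move=> df dh; have dhf : differentiable (h \o f) u by exact: differentiable_comp.
have vec (v : 'rV[R]_n) : v *m 'J (h \o f) u = v *m ('J f u *m 'J h (f u)).
  have H1 : v *m 'J (h \o f) u = 'd (h \o f) u v by exact: mul_rV_lin1.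
  have H2 : v *m 'J f u = 'd f u v by exact: mul_rV_lin1.
  have H3 : 'd f u v *m 'J h (f u) = 'd h (f u) ('d f u v) by exact: mul_rV_lin1.
  by rewrite mulmxA H2 H3 H1 diff_comp.
exact: mulmx_inj_row vec.
Qed.

Lemma near_eq_jacobian n m (f h : 'rV[R]_n -> 'rV[R]_m) u :
  (\forall y \near u, f y = h y) -> differentiable f u -> differentiable h u ->
  'J f u = 'J h u.
Proof.
move=> fh df dh.
have vec (v : 'rV[R]_n) : v *m 'J f u = v *m 'J h u.
  have := near_eq_derive v fh => H.
  exact: (etrans (esym (deriveEjacobian v df)) (etrans H (deriveEjacobian v dh))).
exact: mulmx_inj_row vec.
Qed.

Lemma jacobian_id n (u : 'rV[R]_n) : 'J id u = 1%:M.
Proof.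
apply/row_matrixP => i; rewrite !rowE mulmx1.
by rewrite -(@deriveEjacobian R n n id u (delta_mx 0 i) (@ex_diff _ _ _ _ _ _ _ (is_diff_id u))) derive_id.
Qed.

(** The orthogonality of normal and tangent vectors, differentiated. *)
Lemma weingarten_equation n (U : set 'rV[R]_n) (Y N : 'rV[R]_n -> 'rV[R]_n.+1) u v w :
  open U -> U u -> C1_on U N -> C1_on U ('D_v Y) ->
  (forall u, U u -> dot (N u) ('D_v Y u) = 0) ->
  dot ('D_w N u) ('D_v Y u) + dot (N u) ('D_w ('D_v Y) u) = 0.
Proof.
move=> oU Uu CN CY NY; apply: (derive_zero_on oU Uu NY).
by apply: is_derive_dot; apply: derivableP; [exact: CN.1|exact: CY.1].
Qed.

End ChartCalculus.

Section Charts.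
Context {R : realType} {n : nat} {M : smoothManifold R n}.
Implicit Types (c d : chart R n M) (u : 'rV[R]_n) (p : M).

Lemma open_in_chart c (O : set M) : open O -> open (target c `&` chart_param c @^-1` O).
Proof.
move=> oO; rewrite openE => u [tu Ou].
have cu := param_continuous tu.
have N1 : nbhs u (chart_param c @^-1` O) by apply: cu; exact: open_nbhs_nbhs.
have N2 := open_nbhs_nbhs (conj (@target_open _ _ _ c) tu).
exact: filterI N2 N1.
Qed.

Lemma open_chart_image c (O : set 'rV[R]_n) : open O ->
  open (source c `&` chart_coord c @^-1` O).
Proof.
move=> oO; rewrite openE => p [sp Op].
have cp := Defs.coord_continuous sp.
have N1 : nbhs p (chart_coord c @^-1` O) by apply: cp; exact: open_nbhs_nbhs.
have N2 := open_nbhs_nbhs (conj (@source_open _ _ _ c) sp).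
exact: filterI N2 N1.
Qed.

(** The inverse transition map provides the inverse Jacobian. *)
Lemma transition_unit c d u : atlas c -> atlas d -> target c u ->
  source d (chart_param c u) ->
  differentiable (chart_coord d \o chart_param c) u /\
  'J (chart_coord d \o chart_param c) u \in unitmx.
Proof.
move=> ac ad tu su.
pose Wc := target c `&` chart_param c @^-1` source d.
pose Wd := target d `&` chart_param d @^-1` source c.
have oWc : open Wc by apply: open_in_chart; exact: source_open.
have oWd : open Wd by apply: open_in_chart; exact: source_open.
have Wu : Wc u by [].
pose v := chart_coord d (chart_param c u).
have Wv : Wd v.
  split; first exact: coord_target.
  by rewrite /= /v coordK//; exact: param_source.
have dc := C1_differentiable oWc (smooth_C1 (atlas_smooth ac ad)) Wu.
have dd := C1_differentiable oWd (smooth_C1 (atlas_smooth ad ac)) Wv.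
split => //.
have E : \forall y \near u, ((chart_coord c \o chart_param d) \o (chart_coord d \o chart_param c)) y = id y.
  apply: filterS (open_nbhs_nbhs (conj oWc Wu)) => y [ty sy] /=.
  by rewrite coordK// paramK.
have J1 : 'J (chart_coord d \o chart_param c) u *m 'J (chart_coord c \o chart_param d) v = 1%:M.
  rewrite -jacobian_comp// -(jacobian_id u).
  apply: near_eq_jacobian => //; exact: differentiable_comp.
exact: (proj1 (mulmx1_unit J1)).
Qed.

Lemma chart_frame_unit c u : atlas c -> target c u -> chart_frame c u \in unitmx.
Proof.
move=> ac tu; have [] // := transition_unit ac (chart_at_atlas (chart_param c u)) tu.
exact: chart_at_source.
Qed.

Lemma jacobian_chart_change m (f : M -> 'rV[R]_m) c u : atlas c -> target c u ->
  differentiable (f \o chart_param c) u ->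
  (let d := chart_at (chart_param c u) in
   differentiable (f \o chart_param d) (chart_coord d (chart_param c u))) ->
  'J (f \o chart_param c) u = chart_frame c u *m differential f (chart_param c u).
Proof.
move=> ac tu /=; set p := chart_param c u; set d := chart_at p => dfc dfd.
have ad : atlas d by exact: chart_at_atlas.
have sp : source d p by exact: chart_at_source.
have [dt _] := transition_unit ac ad tu sp.
have oW : open (target c `&` chart_param c @^-1` source d) by apply: open_in_chart; exact: source_open.
apply: (etrans _ (jacobian_comp dt dfd)); apply: (near_eq_jacobian _ dfc (differentiable_comp dt dfd)).
apply: filterS (open_nbhs_nbhs (conj oW (conj tu sp))) => y [ty sy] /=.
by rewrite coordK.
Qed.

End Charts.

Section Hypersurface.
Context {R : realType} {n : nat} {M : smoothManifold R n} (g : riemannianMetric M).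
Variables (X N : M -> 'rV[R]_n.+1).
Hypothesis (Ximm : isometric_immersion g X).
Hypothesis (Nnormal : unit_normal_field X N).
Implicit Types (c d : chart R n M) (u : 'rV[R]_n) (p : M).

Let smX c : atlas c -> smooth_on (target c) (X \o chart_param c).
Proof. by move=> ac; case: Ximm => sX _ _; exact: sX. Qed.

Lemma X_C1 c : atlas c -> C1_on (target c) (X \o chart_param c).
Proof. by move=> /smX/smooth_C1. Qed.

Lemma X_C1' c v : atlas c -> C1_on (target c) ('D_v (X \o chart_param c)).
Proof. by move=> /smX/(smooth_derive v)/smooth_C1. Qed.

Lemma X_C1'' c v w : atlas c -> C1_on (target c) ('D_w ('D_v (X \o chart_param c))).
Proof. by move=> /smX/(smooth_derive v)/(smooth_derive w)/smooth_C1. Qed.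

Lemma jacobian_X c u : atlas c -> target c u ->
  'J (X \o chart_param c) u = chart_frame c u *m differential X (chart_param c u).
Proof.
move=> ac tu; apply: jacobian_chart_change => //.
  exact: C1_differentiable (@target_open _ _ _ c) (X_C1 ac) tu.
apply: C1_differentiable (@target_open _ _ _ _) (X_C1 (chart_at_atlas _)) _.
by apply: coord_target; exact: chart_at_source.
Qed.

Lemma differential_free p : row_free (differential X p).
Proof. by case: Ximm => _ H _; exact: H. Qed.

Lemma jacobian_X_free c u : atlas c -> target c u -> row_free ('J (X \o chart_param c) u).
Proof.
move=> ac tu; rewrite jacobian_X//; apply: inj_row_free => v.
rewrite mulmxA => H.
have vT : v *m chart_frame c u = 0.
  by apply: (row_free_inj (differential_free (chart_param c u))); rewrite H mul0mx.
by rewrite -(mulmxK (chart_frame_unit ac tu) v) vT mul0mx.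
Qed.

Lemma normal_unit p : dot (N p) (N p) = 1.
Proof. by case: Nnormal. Qed.

Lemma normal_differential p : N p *m (differential X p)^T = 0.
Proof.
case: Nnormal => _ _ H; apply/rowP => i; rewrite [RHS]mxE.
have := H p (delta_mx 0 i); rewrite dot_trmx dot_delta => <- //.
Qed.

Lemma normal_jacobian c u : atlas c -> target c u ->
  N (chart_param c u) *m ('J (X \o chart_param c) u)^T = 0.
Proof. by move=> ac tu; rewrite jacobian_X// trmx_mul mulmxA normal_differential mul0mx. Qed.

Lemma N_continuous : continuous N.
Proof. by case: Nnormal. Qed.

Let N_chart_continuous c u : target c u -> {for u, continuous (N \o chart_param c)}.
Proof.
move=> tu; apply: (@cvg_comp _ _ _ (chart_param c) N _ (nbhs (chart_param c u))).
  exact: param_continuous.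
exact: N_continuous.
Qed.

Lemma N_C1 c : atlas c -> C1_on (target c) (N \o chart_param c).
Proof.
move=> ac; apply: (normal_C1 (@target_open _ _ _ c) (smX ac)) => u tu.
- exact: N_chart_continuous.
- exact: normal_unit.
- exact: normal_jacobian.
- exact: jacobian_X_free.
Qed.

Lemma N_C2 c u v w : atlas c -> target c u -> derivable ('D_v (N \o chart_param c)) u w.
Proof.
move=> ac tu.
apply: (@normal_C2 R n (target c) (X \o chart_param c) (N \o chart_param c)
  (@target_open _ _ _ c) (smX ac) _ _ _ _ u v w tu) => y ty.
- exact: N_chart_continuous.
- exact: normal_unit.
- exact: normal_jacobian.
- exact: jacobian_X_free.
Qed.

Lemma jacobian_N c u : atlas c -> target c u ->
  'J (N \o chart_param c) u = chart_frame c u *m differential N (chart_param c u).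
Proof.
move=> ac tu; apply: jacobian_chart_change => //.
  exact: C1_differentiable (@target_open _ _ _ c) (N_C1 ac) tu.
apply: C1_differentiable (@target_open _ _ _ _) (N_C1 (chart_at_atlas _)) _.
by apply: coord_target; exact: chart_at_source.
Qed.

Lemma derive_X c u v : atlas c -> target c u ->
  'D_v (X \o chart_param c) u = v *m 'J (X \o chart_param c) u.
Proof. by move=> ac tu; apply: deriveEjacobian; exact: C1_differentiable (@target_open _ _ _ c) (X_C1 ac) tu. Qed.

Lemma derive_N c u v : atlas c -> target c u ->
  'D_v (N \o chart_param c) u = v *m 'J (N \o chart_param c) u.
Proof. by move=> ac tu; apply: deriveEjacobian; exact: C1_differentiable (@target_open _ _ _ c) (N_C1 ac) tu. Qed.

Lemma normal_derive_X c u v : atlas c -> target c u ->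
  dot (N (chart_param c u)) ('D_v (X \o chart_param c) u) = 0.
Proof. by move=> ac tu; rewrite derive_X// dot_trmx normal_jacobian// dot0l. Qed.

Lemma second_form c u v w : atlas c -> target c u ->
  dot ('D_w (N \o chart_param c) u) ('D_v (X \o chart_param c) u) =
  - dot (N (chart_param c u)) ('D_w ('D_v (X \o chart_param c)) u).
Proof.
move=> ac tu; apply/eqP; rewrite -addr_eq0; apply/eqP.
have H y : target c y -> dot ((N \o chart_param c) y) ('D_v (X \o chart_param c) y) = 0.
  by move=> ty; exact: normal_derive_X.
exact: (@weingarten_equation R n (target c) (X \o chart_param c) (N \o chart_param c)
  u v w (@target_open _ _ _ c) tu (N_C1 ac) (X_C1' v ac) H).
Qed.

(** The entries are, up to sign, the normal parts of the second derivatives of X,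
and these commute. *)
Lemma second_form_symm p : (differential N p *m (differential X p)^T)^T =
  differential N p *m (differential X p)^T.
Proof.
set c := chart_at p; set u := chart_coord c p.
have ac : atlas c by exact: chart_at_atlas.
have sp : source c p by exact: chart_at_source.
have tu : target c u by exact: coord_target.
have entry i j : (differential N p *m (differential X p)^T) i j =
    - dot (N p) ('D_(delta_mx 0 i) ('D_(delta_mx 0 j) (X \o chart_param c)) u).
  have Ep : chart_param c u = p by exact: coordK.
  rewrite -[X in dot (N X)]Ep -(second_form (delta_mx 0 j) (delta_mx 0 i) ac tu).
  rewrite (derive_X _ ac tu) (derive_N _ ac tu) -!rowE.
  exact: (mulmx_tr_entry (differential N p) (differential X p)).
have symm i j : 'D_(delta_mx 0 j) ('D_(delta_mx 0 i) (X \o chart_param c)) u =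
    'D_(delta_mx 0 i) ('D_(delta_mx 0 j) (X \o chart_param c)) u.
  exact: derive_symm_mx (@target_open _ _ _ c) tu (X_C1 ac) (X_C1' _ ac) (X_C1' _ ac).
have sym i j := etrans (entry j i) (etrans
  (congr1 (fun x => - dot (N p) x) (symm i j)) (esym (entry i j))).
move: sym; generalize (differential N p *m (differential X p)^T) => B sym.
by apply/matrixP => i j; rewrite mxE.
Qed.

(** The derivative of <N, N> = 1. *)
Lemma normal_differential_N p : differential N p *m (N p)^T = 0.
Proof.
set c := chart_at p; set u := chart_coord c p.
have ac : atlas c by exact: chart_at_atlas.
have sp : source c p by exact: chart_at_source.
have tu : target c u by exact: coord_target.
have Ep : chart_param c u = p by exact: coordK.
apply/colP => i; rewrite [RHS]mxE.
have H : is_derive u (delta_mx 0 i) (fun y => dot ((N \o chart_param c) y) ((N \o chart_param c) y) - 1)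
   (dot ('D_(delta_mx 0 i) (N \o chart_param c) u) ((N \o chart_param c) u) +
    dot ((N \o chart_param c) u) ('D_(delta_mx 0 i) (N \o chart_param c) u) - 0).
  apply: (@is_deriveB _ _ _ (fun y => dot ((N \o chart_param c) y) ((N \o chart_param c) y)) (cst 1)).
  by apply: is_derive_dot; apply: derivableP; exact: (N_C1 ac).1.
have := derive_zero_on (@target_open _ _ _ c) tu _ H.
rewrite subr0 (dotC _ ('D__ _ u)) /= Ep => H0.
have {}H0 : dot ('D_(delta_mx 0 i) (N \o chart_param c) u) (N p) +
    dot ('D_(delta_mx 0 i) (N \o chart_param c) u) (N p) = 0.
  by apply: H0 => y ty; rewrite normal_unit subrr.
have {}H0 : dot ('D_(delta_mx 0 i) (N \o chart_param c) u) (N p) = 0 by lra.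
rewrite -[RHS]H0 (derive_N _ ac tu) -rowE.
have := mulmx_tr_entry (differential N p) (N p) i 0; rewrite row_id => E.
exact: E.
Qed.

Lemma shape_differential p : shape_operator X N p *m differential X p = - differential N p.
Proof.
apply: shape_operatorE; apply: (orthogonal_normal_sub (normal_unit p)).
- exact: normal_differential.
- exact: differential_free.
- exact: normal_differential_N.
Qed.

Lemma gram_pos p (v : 'rV[R]_n) : v != 0 ->
  0 < dot (v *m (differential X p *m (differential X p)^T)) v.
Proof.
move=> v0; rewrite mulmxA -dot_trmx; apply: dot_gt0; apply: contra v0 => /eqP H.
by apply/eqP; apply: (row_free_inj (differential_free p)); rewrite H mul0mx.
Qed.

(** The rows of b are principal directions, obtained by diagonalizing the second
fundamental form with respect to the first one.  In particular the characteristic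
polynomial of the shape operator splits, so that [principal_curvatures] is not
its default value and its symmetric functions are those of k. *)
Lemma principal_frame p : exists (b : 'M[R]_n) (k : 'rV[R]_n),
  [/\ b \in unitmx /\ (b *m differential X p) *m (b *m differential X p)^T = 1%:M,
      b *m differential N p = - (diag_mx k *m (b *m differential X p)),
      \prod_i k 0 i = gauss_kronecker X N p /\
        gauss_kronecker X N p = \det (shape_operator X N p),
      \sum_i k 0 i = mean_curvature X N p &
      \sum_i k 0 i ^+ 2 = shape_norm2 X N p] /\
  (weakly_convex g X N -> forall i, 0 <= k 0 i).
Proof.
set J := differential X p; set JN := differential N p; set S := shape_operator X N p.
have SJ : S *m J = - JN by exact: shape_differential.
have sg : (J *m J^T)^T = J *m J^T by rewrite trmx_mul trmxK.
have sh : (- (JN *m J^T))^T = - (JN *m J^T) by rewrite linearN /= second_form_symm.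
have [b [k [bg bh]]] := simultaneous_diagonalization sg sh (@gram_pos p).
pose b' := J *m J^T *m b^T.
have bb' : b *m b' = 1%:M by rewrite /b' mulmxA.
have b'b : b' *m b = 1%:M by exact: mulmx1C.
have bSb' : b *m S *m b' = diag_mx k.
  transitivity (b *m (S *m J) *m J^T *m b^T); first by rewrite /b' !mulmxA.
  by rewrite SJ -bh mulmxN !mulNmx mulmxN !mulNmx mulmxA.
have bS : b *m S = diag_mx k *m b by rewrite -bSb' -mulmxA b'b mulmx1.
have ub : b \in unitmx by have [] := mulmx1_unit bb'.
have cp : char_poly S = \prod_i ('X - (k 0 i)%:P).
  by rewrite (char_poly_similar ub bS) char_poly_diag.
have cp' : char_poly S = \prod_i ('X - (principal_curvatures X N p 0 i)%:P).
  by rewrite /principal_curvatures; case: xgetP => [k' -> //|/(_ k)]; case.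
have [Pk Sk] := det_tr_of_char_poly cp; have [Pk' Sk'] := det_tr_of_char_poly cp'.
have frame1 : (b *m J) *m (b *m J)^T = 1%:M by rewrite trmx_mul !mulmxA -(mulmxA b J).
exists b, k; split; first split => //.
- by rewrite mulmxA -bS -mulmxA SJ mulmxN opprK.
- by rewrite Pk -Pk'.
- by rewrite Sk -Sk'.
- have SE : S = b' *m (diag_mx k *m b) by rewrite -bS mulmxA b'b mul1mx.
  have SS : S *m S = b' *m (diag_mx k *m diag_mx k *m b).
    by rewrite {1}SE -!mulmxA bS.
  clearbody b'; rewrite /shape_norm2 -/S SS mxtrace_mulC.
  rewrite -(mulmxA _ b b') bb' mulmx1.
  by rewrite mulmx_diag mxtrace_diag; apply: eq_bigr => i _; rewrite mxE expr2.
move=> conv i; have := conv p (row i b).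
have -> : row i b *m S = k 0 i *: row i b.
  by rewrite -row_mul bS; apply/rowP => j; rewrite mxE mul_diag_mx !mxE.
case: Ximm => _ _ /(_ p) iso.
rewrite -scalemxAl dotZl -iso -!row_mul.
have -> : dot (row i (b *m J)) (row i (b *m J)) = 1.
  by rewrite -(mulmx_tr_entry (b *m J) (b *m J)) frame1 mxE eqxx.
by rewrite mulr1.
Qed.

End Hypersurface.

(** * Projection onto a tangent hyperplane *)

Section OrthogonalProjection.
Context {R : realType} {n : nat}.
Variables (E : 'M[R]_(n.+1, n)) (N0 : 'rV[R]_n.+1).
Hypothesis (EE : E^T *m E = 1%:M) (N1 : dot N0 N0 = 1) (NE : N0 *m E = 0).

Lemma dot_tangent (v : 'rV[R]_n) : dot (v *m E^T) N0 = 0.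
Proof. by rewrite dotC dot_trmx trmxK NE dot0l. Qed.

Lemma projection_decomposition (y : 'rV[R]_n.+1) :
  y = y *m E *m E^T + dot y N0 *: N0.
Proof.
apply/eqP; rewrite -subr_eq0; apply/eqP.
apply: (@orthonormal_frame_zero _ n (fun i => row i E^T) N0).
- by move=> i j; rewrite -(mulmx_tr_entry E^T E^T) trmxK EE mxE.
- exact: N1.
- by move=> i; rewrite rowE dot_trmx trmxK NE dot0l.
- by rewrite dotBl dotDl dotZl N1 mulr1 dot_tangent add0r subrr.
- move=> i; rewrite rowE dot_trmx trmxK mulmxBl mulmxDl -scalemxAl NE scaler0 addr0.
  by rewrite -(mulmxA _ E^T) EE mulmx1 subrr dot0l.
Qed.

Lemma projection_dot (x y : 'rV[R]_n.+1) :
  dot x y = dot (x *m E) (y *m E) + dot x N0 * dot y N0.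
Proof.
rewrite {1}(projection_decomposition y) dotDr dotZr dot_trmx trmxK.
by rewrite (mulrC (dot x N0)).
Qed.

Lemma projection_le (x : 'rV[R]_n.+1) : dot (x *m E) (x *m E) <= dot x x.
Proof. by rewrite (projection_dot x x) lerDl -expr2 sqr_ge0. Qed.

Lemma projection_isometry (v : 'rV[R]_n) : dot (v *m E^T) (v *m E^T) = dot v v.
Proof. by rewrite dot_trmx trmxK -mulmxA EE mulmx1. Qed.

(** A vector x orthogonal to nu has its component along N0 controlled by its
projection, since the product of the two components of nu and x along N0 is
minus the product of the projections; Cauchy-Schwarz concludes. *)
Lemma projection_tangent (nu x : 'rV[R]_n.+1) : dot nu nu = 1 -> dot nu x = 0 ->
  dot nu N0 ^+ 2 * dot x x <= dot (x *m E) (x *m E).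
Proof.
move=> nu1 nux.
have := projection_dot nu x; have := projection_dot nu nu; have := projection_dot x x.
have := dot_CS (nu *m E) (x *m E); rewrite nu1 nux.
move: (dot (nu *m E) (x *m E)) (dot (nu *m E) (nu *m E)) (dot (x *m E) (x *m E)).
move: (dot nu N0) (dot x N0) (dot x x) => m h q a b d CS -> Hb Ha.
have {}Ha : a = - (m * h) by lra.
have {}Hb : b = 1 - m * m by lra.
move: CS; rewrite Ha Hb; nra.
Qed.

End OrthogonalProjection.

Section Projection.
Context {R : realType} {n : nat} {M : smoothManifold R n} (g : riemannianMetric M).
Variables (X N : M -> 'rV[R]_n.+1).
Hypothesis (Ximm : isometric_immersion g X).
Hypothesis (Nnormal : unit_normal_field X N).
Implicit Types (c d : chart R n M) (u : 'rV[R]_n) (p q : M).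

Lemma tangent_frame p : exists E : 'M[R]_(n.+1, n), E^T *m E = 1%:M /\ N p *m E = 0.
Proof.
have [b [k [[[_ bb] _ _ _ _] _]]] := principal_frame Ximm Nnormal p.
exists (b *m differential X p)^T; split; first by rewrite trmxK.
by rewrite trmx_mul mulmxA (normal_differential Nnormal) mul0mx.
Qed.

(** In a principal frame dN is diagonal, with entries at most the square root of
the squared norm of the shape operator. *)
Lemma differential_N_bound p (C : R) (v : 'rV[R]_n) : shape_norm2 X N p <= C ->
  dot (v *m differential N p) (v *m differential N p) <=
  C * dot (v *m differential X p) (v *m differential X p).
Proof.
move=> SC; have [b [k [[[ub bb] bN _ _ Sk] _]]] := principal_frame Ximm Nnormal p.
rewrite -Sk in SC; move: bb bN; generalize (differential X p) (differential N p) => dX dN bb bN.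
pose w : 'rV[R]_n := v *m invmx b.
have vE : v = w *m b by rewrite /w mulmxKV.
have iso (x : 'rV[R]_n) : dot (x *m (b *m dX)) (x *m (b *m dX)) = dot x x.
  by rewrite dot_trmx -mulmxA bb mulmx1.
have vN : v *m dN = - ((w *m diag_mx k) *m (b *m dX)).
  by rewrite {1}vE -mulmxA bN mulmxN !mulmxA.
have vX : v *m dX = w *m (b *m dX) by rewrite {1}vE -mulmxA.
rewrite vN vX iso.
have -> (x : 'rV[R]_n.+1) : dot (- x) (- x) = dot x x by rewrite dotNl dotNr opprK.
rewrite iso.
rewrite /dot mulr_sumr; apply: ler_sum => i _; rewrite mul_mx_diag mxE.
have ki : k 0 i ^+ 2 <= C.
  apply: le_trans SC; rewrite (bigD1 i)//= lerDl; apply: sumr_ge0 => j _.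
  exact: sqr_ge0.
have w0 : 0 <= w 0 i * w 0 i by rewrite -expr2 sqr_ge0.
by rewrite mulrACA -expr2 mulrC ler_wpM2r.
Qed.

(** Gauss-Kronecker curvature is the quotient of the determinants of the two
fundamental forms in any frame; in a chart both are functions of the derivatives
of X, which can be differentiated. *)
Lemma curvature_det c u (B : 'M[R]_n) : atlas c -> target c u ->
  gauss_kronecker X N (chart_param c u) *
    \det (\matrix_(i, j) dot ('D_(row i B) (X \o chart_param c) u) ('D_(row j B) (X \o chart_param c) u)) =
  \det (\matrix_(i, j) dot ((N \o chart_param c) u) ('D_(row i B) ('D_(row j B) (X \o chart_param c)) u)).
Proof.
move=> ac tu; set p := chart_param c u.
have [b [k [[_ _ [_ Kd] _ _] _]]] := principal_frame Ximm Nnormal p.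
have SX := shape_differential Ximm Nnormal p.
have JX := jacobian_X Ximm ac tu; have JN := jacobian_N Ximm Nnormal ac tu.
rewrite -/p in JX JN.
pose G := differential X p *m (differential X p)^T; pose T := chart_frame c u.
have E1 : \matrix_(i, j) dot ('D_(row i B) (X \o chart_param c) u) ('D_(row j B) (X \o chart_param c) u) =
   (B *m T) *m G *m (B *m T)^T.
  transitivity ((B *m 'J (X \o chart_param c) u) *m (B *m 'J (X \o chart_param c) u)^T).
    apply/matrixP => i j; rewrite mxE (derive_X Ximm _ ac tu) (derive_X Ximm _ ac tu).
    by rewrite -!row_mul -mulmx_tr_entry.
  by rewrite JX /G !trmx_mul !mulmxA.
have E2 : \matrix_(i, j) dot ((N \o chart_param c) u) ('D_(row i B) ('D_(row j B) (X \o chart_param c)) u) =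
   (B *m T) *m shape_operator X N p *m G *m (B *m T)^T.
  transitivity (- ((B *m 'J (N \o chart_param c) u) *m (B *m 'J (X \o chart_param c) u)^T)).
    apply/matrixP => i j; rewrite mxE [RHS]mxE.
    apply: (@eq_trans _ _ (- dot ('D_(row i B) (N \o chart_param c) u) ('D_(row j B) (X \o chart_param c) u))).
      have := second_form Ximm Nnormal (row j B) (row i B) ac tu => ->.
      by rewrite opprK.
    congr (- _); rewrite (derive_X Ximm _ ac tu) (derive_N Ximm Nnormal _ ac tu).
    by rewrite -!row_mul -mulmx_tr_entry.
  have aux (S T' : 'M[R]_n) (dX dN JX' JN' : 'M[R]_(n, n.+1)) : S *m dX = - dN ->
      JX' = T' *m dX -> JN' = T' *m dN ->
      - ((B *m JN') *m (B *m JX')^T) = (B *m T') *m S *m (dX *m dX^T) *m (B *m T')^T.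
    move=> SX' -> ->; rewrite !trmx_mul !mulmxA -(mulmxA _ S) SX'.
    by rewrite mulmxN !mulNmx.
  exact: aux SX JX JN.
rewrite E1 E2 !det_mulmx Kd.
by move: (\det B) (\det T) (\det G) (\det (B *m T)^T) (\det _) => *; ring.
Qed.

End Projection.

Lemma is_derive_proj {R : realType} {V : normedModType R} {n m : nat} (f : V -> 'rV[R]_n)
    (a : 'rV[R]_n) (E : 'M[R]_(n, m)) x v d :
  is_derive x v f d -> is_derive x v (fun y => (f y - a) *m E) (d *m E).
Proof.
move=> Hf.
have H1 : is_derive x v (fun y => f y - a) (d - 0).
  by apply: (@is_deriveB _ _ _ f (cst a)) => //; exact: is_derive_cst.
have H2 : is_derive x v (cst E) (0 : 'M[R]_(n, m)) by exact: is_derive_cst.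
have := is_derive_mulmx H1 H2.
by rewrite mulmx0 addr0 subr0.
Qed.

Section ProjectedChart.
Context {R : realType} {n m l : nat} (U : set 'rV[R]_l) (f : 'rV[R]_l -> 'rV[R]_n).
Variables (a : 'rV[R]_n) (E : 'M[R]_(n, m)).
Hypothesis (oU : open U) (C : C1_on U f).

Let h y := (f y - a) *m E.
Let Dh x v : U x -> is_derive x v h ('D_v f x *m E).
Proof. by move=> Ux; apply: is_derive_proj; apply: derivableP; exact: C.1. Qed.

Lemma C1_proj : C1_on U h.
Proof.
split=> [x v Ux|v x Ux]; first by have [] := Dh v Ux.
have H : {for x, continuous (fun y => 'D_v f y *m E)}.
  have l1 : 'D_v f y @[y --> nbhs x] --> 'D_v f x by exact: C.2.
  have l2 : (fun=> E) y @[y --> nbhs x] --> E by exact: cvg_cst.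
  exact: (cvg_mulmx l1 l2).
apply: continuous_near_eq H.
apply: filterS (open_nbhs_nbhs (conj oU Ux)) => y Uy.
by have [_ ->] := Dh v Uy.
Qed.

Lemma jacobian_proj x : U x -> 'J h x = 'J f x *m E.
Proof.
move=> Ux; apply: mulmx_inj_row => v; rewrite mulmxA.
have df := C1_differentiable oU C Ux; have dh := C1_differentiable oU C1_proj Ux.
apply: (etrans (esym (deriveEjacobian v dh))).
apply: (etrans (@derive_val _ _ _ _ _ _ _ (Dh v Ux))).
exact: (congr1 (fun z => z *m E) (deriveEjacobian v df)).
Qed.

End ProjectedChart.

Section TangentProjection.
Context {R : realType} {n : nat} {M : smoothManifold R n} (g : riemannianMetric M).
Variables (X N : M -> 'rV[R]_n.+1).
Hypothesis (Ximm : isometric_immersion g X).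
Hypothesis (Nnormal : unit_normal_field X N).
Variables (p : M) (E : 'M[R]_(n.+1, n)).
Hypothesis (EE : E^T *m E = 1%:M) (NE : N p *m E = 0).

Definition tangent_projection q : 'rV[R]_n := (X q - X p) *m E.
(** The preimage under the Gauss map of the open hemisphere centred at [N p]. *)
Definition normal_cap : set M := [set q | 0 < dot (N q) (N p)].

Local Notation F := tangent_projection.
Local Notation M0 := normal_cap.

Lemma X_continuous : continuous X.
Proof.
move=> q; set c := chart_at q.
have ac : atlas c by exact: chart_at_atlas.
have sq : source c q by exact: chart_at_source.
have tq : target c (chart_coord c q) by exact: coord_target.
have cX : {for chart_coord c q, continuous (X \o chart_param c)}.
  apply: differentiable_continuous.
  exact: C1_differentiable (@target_open _ _ _ c) (X_C1 Ximm ac) tq.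
have H : {for q, continuous ((X \o chart_param c) \o chart_coord c)}.
  exact: (cvg_comp _ _ (Defs.coord_continuous sq) cX).
apply: continuous_near_eq H.
apply: filterS (open_nbhs_nbhs (conj (@source_open _ _ _ c) sq)) => x sx /=.
by rewrite coordK.
Qed.

Lemma projection_continuous : continuous F.
Proof.
move=> q; have l1 : X y - X p @[y --> nbhs q] --> X q - X p.
  by apply: cvgB; [exact: X_continuous|exact: cvg_cst].
have l2 : (fun=> E) y @[y --> nbhs q] --> E by exact: cvg_cst.
exact: (cvg_mulmx l1 l2).
Qed.

Lemma cvg_dot (T : Type) (G : set_system T) {FG : Filter G} m (f h : T -> 'rV[R]_m) a b :
  f x @[x --> G] --> a -> h x @[x --> G] --> b -> dot (f x) (h x) @[x --> G] --> dot a b.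
Proof.
move=> /cvg_mxP fa /cvg_mxP hb; rewrite /dot.
apply: (@cvg_sumr _ _ _ _ _ (index_enum 'I_m) xpredT (fun i x => f x 0 i * h x 0 i)) => i _.
by apply: cvgM; [exact: fa|exact: hb].
Qed.

Lemma angle_continuous : continuous (fun q => dot (N q) (N p)).
Proof.
move=> q; apply: cvg_dot; last exact: cvg_cst.
by case: Nnormal => cN _ _; exact: cN.
Qed.

Lemma normal_cap_open : open M0.
Proof.
have -> : M0 = (fun q => dot (N q) (N p)) @^-1` [set x | 0 < x] by [].
by apply: open_comp; [move=> q _; exact: angle_continuous|exact: open_gt].
Qed.

Lemma jacobian_projection_unit c u : atlas c -> target c u -> M0 (chart_param c u) ->
  'J (F \o chart_param c) u \in unitmx.
Proof.
move=> ac tu Mu.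
have -> : 'J (F \o chart_param c) u = 'J (X \o chart_param c) u *m E.
  exact: (jacobian_proj (X p) E (@target_open _ _ _ c) (X_C1 Ximm ac) tu).
have fJ := jacobian_X_free Ximm ac tu; have NJ := normal_jacobian Ximm Nnormal ac tu.
move: fJ NJ Mu; rewrite /M0 /=.
generalize ('J (X \o chart_param c) u) => J fJ NJ m0.
rewrite -row_free_unit; apply: inj_row_free => v vJ.
have nx : dot (N (chart_param c u)) (v *m J) = 0 by rewrite dot_trmx NJ dot0l.
have := projection_tangent EE (normal_unit Nnormal p) NE (normal_unit Nnormal _) nx.
rewrite -mulmxA vJ dot0l => H.
have : dot (v *m J) (v *m J) = 0.
  apply/eqP; rewrite eq_le dot_ge0 andbT.
  by rewrite -(pmulr_rle0 _ (exprn_gt0 2 m0)).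
move/eqP; rewrite dot_eq0 => /eqP vJ0.
by apply: (row_free_inj fJ); rewrite vJ0 mul0mx.
Qed.

Lemma projection_C1 c : atlas c -> C1_on (target c) (F \o chart_param c).
Proof. by move=> ac; exact: (C1_proj (X p) E (@target_open _ _ _ c) (X_C1 Ximm ac)). Qed.

(** Where the normals make an acute angle the projection kills no tangent vector,
and the inverse function theorem applies in a chart. *)
Lemma projection_locally_invertible q : M0 q -> locally_invertible_at F M0 q.
Proof.
move=> Mq; set c := chart_at q.
have ac : atlas c by exact: chart_at_atlas.
have sq : source c q by exact: chart_at_source.
have tq : target c (chart_coord c q) by exact: coord_target.
pose U := target c `&` chart_param c @^-1` M0.
have oU : open U by apply: open_in_chart; exact: normal_cap_open.
have Uq : U (chart_coord c q) by split => //=; rewrite coordK.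
have CU : C1_on U (F \o chart_param c).
  have [C1 C2] := projection_C1 ac.
  by split=> [x v [tx _]|v x [tx _]]; [exact: C1|exact: C2].
have uJ : 'J (F \o chart_param c) (chart_coord c q) \in unitmx.
  by apply: jacobian_projection_unit => //; rewrite coordK.
have [r [e [s [r0 e0 rU inj inv]]]] := local_inverse oU CU Uq uJ.
exists (source c `&` chart_coord c @^-1` (ball (chart_coord c q) r)), e, (chart_param c \o s).
have FK x : source c x -> (F \o chart_param c) (chart_coord c x) = F x.
  by move=> sx /=; rewrite coordK.
split => //.
- apply: open_chart_image; exact: ball_open.
- split; first by split => //; exact: ballxx.
  by move=> x [sx /rU[_ /=]]; rewrite coordK.
- move=> x y [sx bx] [sy by_] Fxy.
  rewrite -(coordK sx) -(coordK sy); congr (chart_param c _).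
  apply: inj => //; exact: (etrans (FK x sx) (etrans Fxy (esym (FK y sy)))).
- move=> w; rewrite -(FK q sq) => /inv[bw Fw cw].
  have [tw Mw] := rU _ bw.
  split => //.
    by split; [exact: param_source|rewrite /= paramK].
  exact: (cvg_comp _ _ cw (param_continuous tw)).
Qed.

End TangentProjection.

(** * Curves, length and completeness *)

Section Integrals.
Context {R : realType}.
Implicit Types (f s : R -> R).

Let mu := @lebesgue_measure R.

Lemma continuous_measurable_EFin s (a b : R) : continuous s ->
  measurable_fun `[a, b] (EFin \o s).
Proof.
move=> cs; apply/measurable_EFinP.
apply: (@measurable_funS _ _ _ _ setT) => //.
exact: continuous_measurable_fun.
Qed.

Lemma integral_le_cst s (L : R) : continuous s -> (forall t, 0 <= s t) ->
  (forall t, 0 <= t <= 1 -> s t <= L) ->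
  (\int[mu]_(t in `[0%R, 1%R]) (s t)%:E <= L%:E)%E.
Proof.
move=> cs s0 sL.
have L0 : 0 <= L by apply: le_trans (s0 0) (sL 0 _); rewrite lexx ler01.
have H : (\int[mu]_(t in `[0%R, 1%R]) (s t)%:E <= \int[mu]_(t in `[0%R, 1%R]) (cst L%:E) t)%E.
  apply: ge0_le_integral => //=.
  - by move=> t _; rewrite lee_fin.
  - exact: continuous_measurable_EFin.
apply: (le_trans H); rewrite integral_cst//= lebesgue_measure_itv /= lte_fin ltr01.
by rewrite -EFinD subr0 -EFinM mulr1.
Qed.

Lemma variation_le_integral f f' s (a : R) : 0 <= a <= 1 ->
  (forall t : R, is_derive t 1 f (f' t)) -> continuous f' -> continuous s ->
  (forall t, `|f' t| <= s t) ->
  (`|f 1 - f a|%:E <= \int[mu]_(t in `[0%R, 1%R]) (s t)%:E)%E.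
Proof.
move=> /andP[a0 a1] df cf' cs f's.
have s0 t : 0 <= s t by exact: le_trans (f's t).
have i0 : (0 <= \int[mu]_(t in `[0%R, 1%R]) (s t)%:E)%E.
  by apply: integral_ge0 => t _; rewrite lee_fin.
move: a1; rewrite le_eqVlt => /orP[/eqP ->|a1]; first by rewrite subrr normr0.
have cf : continuous f.
  move=> t; apply: differentiable_continuous; apply/derivable1_diffP.
  by have [] := df t.
have FTC : (\int[mu]_(x in `[a, 1%R]) (f' x)%:E = (f 1)%:E - (f a)%:E)%E.
  apply: continuous_FTC2 => //.
  - exact: continuous_subspaceT.
  - split.
    + by move=> x _; have [] := df x.
    + by apply: cvg_at_right_filter; exact: cf.
    + by apply: cvg_at_left_filter; exact: cf.
  - by move=> x _; rewrite derive1E; have [_ ->] := df x.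
have -> : (`|f 1 - f a|%:E = `| \int[mu]_(x in `[a, 1%R]) (f' x)%:E|)%E.
  by rewrite FTC -EFinB.
apply: le_trans (le_abse_integral _ _ _) _ => //.
  exact: continuous_measurable_EFin.
apply: (@le_trans _ _ (\int[mu]_(x in `[a, 1%R]) (s x)%:E)%E).
  apply: ge0_le_integral => //=.
  - apply: (@continuous_measurable_EFin (fun t => `|f' t|)) => t.
    by apply: (cvg_comp _ _ (cf' t)); exact: norm_continuous.
  - exact: continuous_measurable_EFin.
  - by move=> t _; rewrite lee_fin.
apply: ge0_subset_integral => //=.
- exact: continuous_measurable_EFin.
- by move=> t _; rewrite lee_fin.
- by move=> t /=; rewrite !in_itv /= => /andP[at_ ->]; rewrite (le_trans a0 at_).
Qed.

End Integrals.

Section Curves.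
Context {R : realType} {n : nat} {M : smoothManifold R n} (g : riemannianMetric M).
Implicit Types (c d : chart R n M) (u : 'rV[R]_n) (p q : M) (gamma : R -> M).

Lemma curve_near_source gamma c (t : R) : {for t, continuous gamma} -> source c (gamma t) ->
  \forall r \near t, source c (gamma r).
Proof.
move=> cg sg; apply: cg; exact: (open_nbhs_nbhs (conj (@source_open _ _ _ c) sg)).
Qed.

Lemma derive_through_chart m (Phi : M -> 'rV[R]_m) gamma c (t : R) w :
  C1_on (target c) (Phi \o chart_param c) -> source c (gamma t) ->
  {for t, continuous gamma} -> is_derive t 1 (chart_coord c \o gamma) w ->
  is_derive t 1 (Phi \o gamma)
    (w *m 'J (Phi \o chart_param c) (chart_coord c (gamma t))).
Proof.
move=> C sg cg dg.
have tg : target c ((chart_coord c \o gamma) t) by exact: coord_target.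
have H := is_derive_C1_comp (@target_open _ _ _ c) C tg dg.
apply: near_eq_is_derive H.
by apply: filterS (curve_near_source cg sg) => r sr /=; rewrite coordK.
Qed.

Variables (X N : M -> 'rV[R]_n.+1).
Hypothesis (Ximm : isometric_immersion g X).
Hypothesis (Nnormal : unit_normal_field X N).

Lemma velocity_derive gamma (t : R) : {for t, continuous gamma} ->
  derivable (chart_coord (chart_at (gamma t)) \o gamma) t 1 ->
  is_derive t 1 (X \o gamma) (velocity gamma t *m differential X (gamma t)) /\
  is_derive t 1 (N \o gamma) (velocity gamma t *m differential N (gamma t)).
Proof.
move=> cg dg; set c := chart_at (gamma t) in dg *.
have ac : atlas c by exact: chart_at_atlas.
have sq : source c (gamma t) by exact: chart_at_source.
have H : is_derive t 1 (chart_coord c \o gamma) (velocity gamma t).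
  by rewrite /velocity derive1E; exact: derivableP.
split.
  exact: (derive_through_chart (X_C1 Ximm ac) sq cg H).
exact: (derive_through_chart (N_C1 Ximm Nnormal ac) sq cg H).
Qed.

Lemma speedE gamma t : speed g gamma t =
  Num.sqrt (dot (velocity gamma t *m differential X (gamma t))
                (velocity gamma t *m differential X (gamma t))).
Proof. by case: Ximm => _ _ iso; rewrite /speed iso. Qed.

Lemma C1_curve_derivable gamma c (t : R) : C1_curve gamma -> atlas c -> source c (gamma t) ->
  is_derive t 1 (chart_coord c \o gamma) ('D_1 (chart_coord c \o gamma) t) /\
  {for t, continuous ('D_1 (chart_coord c \o gamma))}.
Proof.
move=> [cg H] ac sg; have [_ /(_ (1 : R))[D1 [D2 _]]] := H c ac.
by split; [apply: derivableP; exact: D1|exact: D2].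
Qed.

Lemma C1_curve_image gamma (t : R) : C1_curve gamma ->
  [/\ is_derive t 1 (X \o gamma) ('D_1 (X \o gamma) t),
      speed g gamma t = Num.sqrt (dot ('D_1 (X \o gamma) t) ('D_1 (X \o gamma) t)) &
      {for t, continuous ('D_1 (X \o gamma))}].
Proof.
move=> Cg; have cg : continuous gamma by case: Cg.
set c := chart_at (gamma t).
have ac : atlas c by exact: chart_at_atlas.
have sq : source c (gamma t) by exact: chart_at_source.
have [[dc _] cc] := C1_curve_derivable Cg ac sq.
have [dX _] := velocity_derive (cg t) dc.
have E : 'D_1 (X \o gamma) t = velocity gamma t *m differential X (gamma t).
  by have [_ ->] := dX.
split; first by rewrite E.
  by rewrite E; exact: speedE.
pose J y := 'J (X \o chart_param c) y.
have H : {for t, continuous (fun r => 'D_1 (chart_coord c \o gamma) r *m J (chart_coord c (gamma r)))}.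
  have l1 : 'D_1 (chart_coord c \o gamma) r @[r --> t] --> 'D_1 (chart_coord c \o gamma) t by exact: cc.
  have l2 : chart_coord c (gamma r) @[r --> t] --> chart_coord c (gamma t).
    exact: (cvg_comp _ _ (cg t) (Defs.coord_continuous sq)).
  have l3 : J (chart_coord c (gamma r)) @[r --> t] --> J (chart_coord c (gamma t)).
    apply: (cvg_comp _ _ l2).
    exact: (C1_jacobian_continuous (@target_open _ _ _ c) (X_C1 Ximm ac) (coord_target sq)).
  exact: (cvg_mulmx l1 l3).
apply: continuous_near_eq H.
apply: filterS (curve_near_source (cg t) sq) => r sr.
have [dr _] := C1_curve_derivable Cg ac sr.
exact: (esym (@derive_val _ _ _ _ _ _ _ (derive_through_chart (X_C1 Ximm ac) sr (cg r) dr))).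
Qed.

(** Each coordinate of X varies by at most the integral of the speed, because X is
an isometric immersion. *)
Lemma chord_le_length gamma a : C1_curve gamma -> 0 <= a <= 1 ->
  (`|X (gamma 1) - X (gamma a)|%:E <= curve_length g gamma)%E.
Proof.
move=> Cg a01; pose D := 'D_1 (X \o gamma).
have HD (t : R) : is_derive t 1 (X \o gamma) (D t) by have [] := C1_curve_image t Cg.
have cD (t : R) : {for t, continuous D} by have [] := C1_curve_image t Cg.
pose s t := Num.sqrt (dot (D t) (D t)).
have sE : speed g gamma = s by apply/funext => t; have [_ ->] := C1_curve_image t Cg.
have cs : continuous s.
  by move=> t; apply: (cvg_comp _ _ (cvg_dot (cD t) (cD t))); exact: sqrt_continuous.
have Ds t j : `|D t 0 j| <= s t.
  rewrite -sqrtr_sqr; apply: ler_wsqrtr; rewrite /dot (bigD1 j)//= -expr2 lerDl.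
  by apply: sumr_ge0 => i _; rewrite -expr2 sqr_ge0.
rewrite /curve_length sE.
have H j : (`|(X (gamma 1) - X (gamma a)) 0 j|%:E <=
    \int[lebesgue_measure]_(t in `[0%R, 1%R]) (s t)%:E)%E.
  have -> : (X (gamma 1) - X (gamma a)) 0 j = X (gamma 1) 0 j - X (gamma a) 0 j by rewrite !mxE.
  apply: (@variation_le_integral R (fun t => (X \o gamma) t 0 j) (fun t => D t 0 j)) => //.
  - by move=> t; apply: is_derive_entry.
  - by move=> t; have /cvg_mxP := cD t; apply.
have : (0 <= \int[lebesgue_measure]_(t in `[0%R, 1%R]) (s t)%:E)%E.
  by apply: integral_ge0 => t _; rewrite lee_fin sqrtr_ge0.
move: H; case: (\int[lebesgue_measure]_(t in _) _)%E => [l| |] H l0.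
- rewrite lee_fin in l0; rewrite lee_fin; apply: mx_norm_le => // i j.
  by rewrite ord1 -lee_fin.
- by rewrite leey.
- by [].
Qed.

(** A curve that leaves a coordinate ball around its endpoint is long, because
the immersion separates points of the ball at a linear rate. *)
Lemma dist_nbhs (q : M) (W : set M) : open W -> W q ->
  exists2 e : R, 0 < e & forall x, (riemannian_dist g x q < e%:E)%E -> W x.
Proof.
move=> oW Wq; set c := chart_at q.
have ac : atlas c by exact: chart_at_atlas.
have sq : source c q by exact: chart_at_source.
set u0 := chart_coord c q.
have tq : target c u0 by exact: coord_target.
pose U := target c `&` chart_param c @^-1` W.
have oU : open U by exact: open_in_chart.
have Uq : U u0 by split => //=; rewrite coordK.
have CU : C1_on U (X \o chart_param c).
  have [C1 C2] := X_C1 Ximm ac.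
  by split=> [x v [tx _]|v x [tx _]]; [exact: C1|exact: C2].
have [r [k [r0 k0 rU chord]]] := immersion_chord oU CU Uq (jacobian_X_free Ximm ac tq).
pose e := k * (r / 2).
have e0 : 0 < e by rewrite mulr_gt0// divr_gt0.
exists e => // x /ereal_inf_lt[_ [gamma [Cg g0 g1] <-] lg].
have cg : continuous gamma by case: Cg.
pose V := source c `&` chart_coord c @^-1` (ball u0 r).
have oV : open V by apply: open_chart_image; exact: ball_open.
pose D := [set v : 'rV[R]_n | `|v - u0| <= r / 2].
have Dball v : D v -> ball u0 r v.
  rewrite /D /= -ball_normE /ball_/= distrC => /le_lt_trans; apply.
  by rewrite ltr_pdivrMr// ltr_pMr// ltr1n.
have cD : compact D.
  apply: bounded_closed_compact.
    exists (`|u0| + r / 2); split; first exact: num_real.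
    move=> y yM v /= Dv; apply: ltW; apply: le_lt_trans yM.
    rewrite -[v](subrK u0) addrC; apply: le_trans (ler_normD _ _) _.
    by rewrite lerD2l.
  have -> : D = (fun v => `|v - u0|) @^-1` [set y | y <= r / 2] by [].
  apply: closed_comp; last exact: closed_le.
  move=> v _; apply: (@continuous_of_dist R) => d d0.
  apply: filterS (@near_dist_le _ 'rV[R]_n v d d0) => y; apply: le_trans.
  apply: le_trans (ler_dist_dist _ _) _.
  by rewrite opprB addrA subrK.
have cK : closed (chart_param c @` D).
  apply: compact_closed; first exact: manifold_hausdorff.
  apply: continuous_compact => //.
  apply: continuous_in_subspaceT => v; rewrite inE => /Dball/rU[tv _].
  exact: param_continuous.
have VK t : 0 <= t <= 1 -> (V (gamma t) <-> (chart_param c @` D) (gamma t)).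
  move=> t01; split.
    move=> [st bt]; exists (chart_coord c (gamma t)); last by rewrite coordK.
    have := chord u0 (chart_coord c (gamma t)) (ballxx _ r0) bt.
    have -> : (X \o chart_param c) u0 = X (gamma 1) by rewrite /= coordK// g1.
    have -> : (X \o chart_param c) (chart_coord c (gamma t)) = X (gamma t) by rewrite /= coordK.
    have := le_lt_trans (chord_le_length Cg t01) lg; rewrite lte_fin => H1 H2.
    rewrite /D /= distrC; have := le_lt_trans H2 H1.
    by rewrite /e ltr_pM2l// => /ltW.
  move=> [v Dv <-]; have bv := Dball _ Dv; have [tv _] := rU _ bv.
  by split; [exact: param_source|rewrite /= paramK].
have A1 : [set t : R | 0 <= t <= 1 /\ V (gamma t)] = `[0, 1]%classic.
  apply: (@segment_connected R 0 1).
  - exists 1; split; first by rewrite ler01 lexx.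
    by rewrite g1; split => //; exact: ballxx.
  - exists (gamma @^-1` V); first by apply: open_comp => // t _; exact: cg.
    by apply/seteqP; split => t /=; rewrite in_itv.
  - exists (gamma @^-1` (chart_param c @` D)).
      by apply: closed_comp => // t _; exact: cg.
    apply/seteqP; split => t /=; rewrite in_itv /=.
      by move=> [t01 Vt]; split => //; exact: (VK t t01).1 Vt.
    by move=> [t01 Kt]; split => //; exact: (VK t t01).2 Kt.
have : [set t : R | 0 <= t <= 1 /\ V (gamma t)] 0.
  by rewrite A1 /= in_itv /= lexx ler01.
rewrite /= g0 => -[_ [sx bx]]; have [_ /=] := rU _ bx.
by rewrite coordK.
Qed.

End Curves.

Lemma is_derive_scale {R : realType} {n : nat} (f : R -> R) (t df : R) (u : 'rV[R]_n) :
  is_derive t 1 f df -> is_derive t 1 (fun r => f r *: u) (df *: u).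
Proof.
move=> Hf; apply: is_derive_mx => i j; rewrite [X in is_derive _ _ _ X]mxE.
have -> : (fun r => (f r *: u) i j) = u i j \*: f.
  by apply/funext => r; rewrite mxE mulrC.
rewrite mulrC; exact: (is_deriveZ (u i j) Hf).
Qed.

Section Lifts.
Context {R : realType} {n : nat} {M : smoothManifold R n} (g : riemannianMetric M).
Variables (X N : M -> 'rV[R]_n.+1).
Hypothesis (Ximm : isometric_immersion g X).
Hypothesis (Nnormal : unit_normal_field X N).
Variables (p : M) (E : 'M[R]_(n.+1, n)).
Hypothesis (EE : E^T *m E = 1%:M) (NE : N p *m E = 0).
Implicit Types (gamma : R -> M).

Local Notation F := (tangent_projection X p E).
Local Notation M0 := (normal_cap N p).

Lemma lift_coord c gamma (t : R) z : atlas c -> source c (gamma t) ->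
  {for t, continuous gamma} -> M0 (gamma t) -> is_derive t 1 (F \o gamma) z ->
  is_derive t 1 (chart_coord c \o gamma)
    (z *m pinvmx ('J (F \o chart_param c) (chart_coord c (gamma t)))).
Proof.
move=> ac sg cg Mg dz.
have tg : target c (chart_coord c (gamma t)) by exact: coord_target.
have cc : {for t, continuous (chart_coord c \o gamma)}.
  exact: (cvg_comp _ _ cg (Defs.coord_continuous sg)).
have uJ : row_free ('J (F \o chart_param c) (chart_coord c (gamma t))).
  rewrite row_free_unit; apply: (jacobian_projection_unit Ximm Nnormal EE NE ac tg).
  by rewrite coordK.
have dz' : is_derive t 1 ((F \o chart_param c) \o (chart_coord c \o gamma)) z.
  apply: near_eq_is_derive dz.
  by apply: filterS (curve_near_source cg sg) => r sr /=; rewrite coordK.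
by have [] := is_derive_lift (@target_open _ _ _ c) (projection_C1 Ximm p E ac) tg uJ cc dz'.
Qed.

Lemma lift_velocity gamma (t : R) z : {for t, continuous gamma} -> M0 (gamma t) ->
  is_derive t 1 (F \o gamma) z ->
  [/\ is_derive t 1 (X \o gamma) (velocity gamma t *m differential X (gamma t)),
      is_derive t 1 (N \o gamma) (velocity gamma t *m differential N (gamma t)) &
      velocity gamma t *m differential X (gamma t) *m E = z].
Proof.
move=> cg Mg dz.
have dc : derivable (chart_coord (chart_at (gamma t)) \o gamma) t 1.
  by have [] := lift_coord (chart_at_atlas _) (chart_at_source _) cg Mg dz.
have [dX dN] := velocity_derive Ximm Nnormal cg dc.
split => //.
have dz' : is_derive t 1 (F \o gamma) (velocity gamma t *m differential X (gamma t) *m E).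
  exact: is_derive_proj dX.
exact: (etrans (esym (@derive_val _ _ _ _ _ _ _ dz')) (@derive_val _ _ _ _ _ _ _ dz)).
Qed.

(** A lift is as regular as the curve it lifts, because the projection is a local
diffeomorphism. *)
Lemma lift_C1 gamma (z : R -> 'rV[R]_n) : continuous gamma -> (forall t, M0 (gamma t)) ->
  (forall t : R, is_derive t 1 (F \o gamma) (z t)) -> continuous z -> C1_curve gamma.
Proof.
move=> cg Mg dz cz; split; first exact: cg.
move=> c ac.
pose w t := z t *m pinvmx ('J (F \o chart_param c) (chart_coord c (gamma t))).
have dw (t : R) (v : R) : source c (gamma t) -> is_derive t v (chart_coord c \o gamma) (v *: w t).
  move=> sg; have := is_derive_dirZ v (lift_coord ac sg (cg t) (Mg t) (dz t)).
  by rewrite [v *: _]mulr1.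
have cc (t : R) : source c (gamma t) -> {for t, continuous (chart_coord c \o gamma)}.
  by move=> sg; exact: (cvg_comp _ _ (cg t) (Defs.coord_continuous sg)).
have cw (t : R) : source c (gamma t) -> {for t, continuous w}.
  move=> sg; pose J y := 'J (F \o chart_param c) y.
  have tg : target c (chart_coord c (gamma t)) by exact: coord_target.
  have l1 : chart_coord c (gamma r) @[r --> t] --> chart_coord c (gamma t) by exact: cc.
  have l2 : J (chart_coord c (gamma r)) @[r --> t] --> J (chart_coord c (gamma t)).
    apply: (cvg_comp _ _ l1).
    exact: (C1_jacobian_continuous (@target_open _ _ _ c) (projection_C1 Ximm p E ac) tg).
  have uJ (r : R) : source c (gamma r) -> J (chart_coord c (gamma r)) \in unitmx.
    move=> sr; apply: (jacobian_projection_unit Ximm Nnormal EE NE ac (coord_target sr)).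
    by rewrite coordK.
  have l3 : invmx (J (chart_coord c (gamma r))) @[r --> t] --> invmx (J (chart_coord c (gamma t))).
    exact: (cvg_invmx (uJ t sg) l2).
  have l4 : {for t, continuous (fun r => z r *m invmx (J (chart_coord c (gamma r))))}.
    exact: (cvg_mulmx (cz t) l3).
  apply: continuous_near_eq l4.
  apply: filterS (curve_near_source (cg t) sg) => r sr.
  exact: (congr1 (mulmx (z r)) (esym (pinvmxE (uJ r sr)))).
split; first by move=> t sg; exact: cc.
move=> v; split; first by move=> t sg; have [] := dw t v sg.
split; last by [].
move=> t sg.
have l : {for t, continuous (fun r => (v : R) *: w r)}.
  have lw : w r @[r --> t] --> w t by exact: cw.
  have lv : (fun=> (v : R)) r @[r --> t] --> (v : R) by exact: cvg_cst.
  exact: (cvgZ lv lw).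
apply: continuous_near_eq l.
apply: filterS (curve_near_source (cg t) sg) => r sr.
exact: (esym (@derive_val _ _ _ _ _ _ _ (dw r v sr))).
Qed.

Lemma lift_speed_le gamma (t : R) z (c L : R) : {for t, continuous gamma} ->
  0 < c -> c <= dot (N (gamma t)) (N p) -> is_derive t 1 (F \o gamma) z ->
  0 <= L -> dot z z <= (c * L) ^+ 2 -> speed g gamma t <= L.
Proof.
move=> cg c0 cm dz L0 zL.
have Mg : M0 (gamma t) by rewrite /normal_cap /=; exact: lt_le_trans cm.
have [_ _ vE] := lift_velocity cg Mg dz.
have nv : dot (N (gamma t)) (velocity gamma t *m differential X (gamma t)) = 0.
  by case: Nnormal => _ _; apply.
have := projection_tangent EE (normal_unit Nnormal p) NE (normal_unit Nnormal _) nv.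
rewrite vE => H; rewrite (speedE Ximm) -[X in _ <= X](ger0_norm L0) -sqrtr_sqr.
apply: ler_wsqrtr; rewrite -(ler_pM2l (exprn_gt0 2 c0)) -exprMn.
apply: le_trans zL; apply: le_trans H; apply: ler_wpM2r; first exact: dot_ge0.
by rewrite ler_sqr ?nnegrE// ltW//; exact: lt_le_trans cm.
Qed.

Section Ray.
Variables (O : set 'rV[R]_n) (s : 'rV[R]_n -> M) (u : 'rV[R]_n) (T1 c : R).
Hypothesis (sec : star_section F M0 p O s).
Hypothesis (T10 : 0 < T1) (c0 : 0 < c).
Hypothesis (rayO : forall t, 0 <= t < T1 -> O (t *: u)).
Hypothesis (rayc : forall t, 0 <= t < T1 -> c <= dot (N (s (t *: u))) (N p)).

Let L := Num.sqrt (dot u u) * pi / c.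

Lemma ray_dist_le t1 t2 : 0 <= t1 < T1 -> 0 <= t2 < T1 ->
  (riemannian_dist g (s (t1 *: u)) (s (t2 *: u)) <= (L * `|t2 - t1|)%:E)%E.
Proof.
move=> /andP[t10 t1T] /andP[t20 t2T].
have [oO starO s0 HO] := sec.
(* A C1 curve is parametrized by the whole line, whereas the ray is lifted on a
   half-open segment only: theta maps the line into [0, 1], and 0, 1 to 0, 1. *)
pose theta (r : R) : R := (1 - cos (pi * r)) / 2.
pose theta' (r : R) : R := pi * sin (pi * r) / 2.
have dtheta (r : R) : is_derive r 1 theta (theta' r).
  have H1 : is_derive r 1 (pi \*: (id : R -> R)) (pi *: (1 : R)).
    exact: (is_deriveZ pi (is_derive_id r (1 : R))).
  have H2 : is_derive r 1 (cos \o (pi \*: (id : R -> R))) (- sin (pi * r) * (pi *: (1 : R))).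
    exact: (is_derive1_comp (is_derive_cos (pi * r)) H1).
  have H3 := is_deriveZ (2^-1 : R) (is_deriveB (is_derive_cst (1 : R) r (1 : R)) H2).
  have -> : theta = 2^-1 \*: (cst (1 : R) - (cos \o (pi \*: (id : R -> R)))).
    by apply/funext => x; rewrite /theta mulrC.
  apply: (is_derive_eq H3); rewrite /theta' sub0r mulNr opprK.
  by rewrite [LHS]mulrC [_ *: _]mulr1 [sin _ * _]mulrC.
have cth' : continuous theta'.
  move=> r; apply: cvgM; last exact: cvg_cst.
  apply: cvgM; first exact: cvg_cst.
  have l : pi * x @[x --> r] --> pi * r by apply: cvgM; [exact: cvg_cst|exact: cvg_id].
  by apply: (cvg_comp _ _ l); exact: continuous_sin.
have th01 r : 0 <= theta r <= 1.
  by rewrite /theta; have := cos_geN1 (pi * r); have := cos_le1 (pi * r); lra.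
pose tau r := t1 + (t2 - t1) * theta r.
have tauT r : 0 <= tau r < T1.
  have := th01 r; rewrite /tau; move: (theta r) => x /andP[x0 x1].
  apply/andP; split.
    rewrite (_ : _ + _ = t1 * (1 - x) + t2 * x); last by ring.
    by rewrite addr_ge0// mulr_ge0// subr_ge0.
  case: (lerP t1 t2) => t12.
    by apply: le_lt_trans t2T; nra.
  by apply: le_lt_trans t1T; nra.
pose delta r := s (tau r *: u).
pose z r := ((t2 - t1) * theta' r) *: u.
have Fdelta r : (F \o delta) r = tau r *: u.
  by rewrite /=; have [] := HO _ (rayO (tauT r)).
have dtau (r : R) : is_derive r 1 tau ((t2 - t1) * theta' r).
  have H := is_deriveD (is_derive_cst t1 r (1 : R)) (is_deriveZ (t2 - t1) (dtheta r)).
  by apply: (is_derive_eq H); rewrite add0r.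
have dF (r : R) : is_derive r 1 (F \o delta) (z r).
  have -> : F \o delta = fun r => tau r *: u by apply/funext => x; rewrite Fdelta.
  exact: is_derive_scale.
have ctau : continuous tau.
  move=> r; apply: differentiable_continuous; apply/derivable1_diffP.
  by have [] := dtau r.
have cdelta : continuous delta.
  move=> r; have [_ _ cs] := HO _ (rayO (tauT r)).
  have l : tau x *: u @[x --> r] --> tau r *: u.
    have lu : (fun=> u) x @[x --> r] --> u by exact: cvg_cst.
    exact: (cvgZ (ctau r) lu).
  exact: (cvg_comp _ _ l cs).
have cz : continuous z.
  move=> r.
  have l : (t2 - t1) * theta' x @[x --> r] --> (t2 - t1) * theta' r.
    by apply: cvgM; [exact: cvg_cst|exact: cth'].
  have lu : (fun=> u) x @[x --> r] --> u by exact: cvg_cst.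
  exact: (cvgZ l lu).
have Cdelta : C1_curve delta.
  by apply: lift_C1 dF cz => // r; have [] := HO _ (rayO (tauT r)).
have L0 : 0 <= L.
  by apply: divr_ge0; [apply: mulr_ge0; [exact: sqrtr_ge0|exact: pi_ge0]|exact: ltW].
apply: ge_ereal_inf; exists (curve_length g delta).
  exists delta => //; split => //.
    by rewrite /delta /tau /theta mulr0 cos0 subrr mul0r mulr0 addr0.
  rewrite /delta /tau /theta mulr1 cospi opprK.
  by rewrite (_ : (1 + 1) / 2 = 1 :> R) ?mulr1 1?addrC ?subrK// divff.
apply: integral_le_cst.
- move=> r; pose D := 'D_1 (X \o delta).
  have cD (t : R) : {for t, continuous D} by have [] := C1_curve_image Ximm Nnormal t Cdelta.
  have -> : speed g delta = fun t => Num.sqrt (dot (D t) (D t)).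
    by apply/funext => t; have [_ ->] := C1_curve_image Ximm Nnormal t Cdelta.
  by apply: (cvg_comp _ _ (cvg_dot (cD r) (cD r))); exact: sqrt_continuous.
- by move=> r; exact: sqrtr_ge0.
move=> r _; apply: (lift_speed_le (cdelta r) c0 (rayc (tauT r)) (dF r)).
  by rewrite mulr_ge0.
rewrite /z dotZl dotZr /L.
have -> : c * (Num.sqrt (dot u u) * pi / c * `|t2 - t1|) =
    Num.sqrt (dot u u) * (pi * `|t2 - t1|).
  by rewrite -!mulrA; field; rewrite gt_eqF.
rewrite exprMn sqr_sqrtr ?dot_ge0// mulrA mulrC ler_wpM2l ?dot_ge0//.
rewrite -expr2 !exprMn real_normK ?num_real// mulrC; apply: ler_wpM2r; first exact: sqr_ge0.
rewrite /theta'; have := cos2Dsin2 (pi * r); have := sqr_ge0 (cos (pi * r)).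
have := sqr_ge0 (@pi R); move: (@pi R) (sin _) (cos _) => a b c' a0 b0 bc; nra.
Qed.

Hypothesis (Mcomplete : complete_manifold g).

(** The lift of a bounded segment along which the normal stays away from the
equator has finite length, so by completeness it cannot escape. *)
Lemma ray_cluster : exists q, M0 q /\
  forall (W : set M) (t0 : R), open W -> W q -> t0 < T1 ->
    exists t, [/\ 0 <= t, t0 <= t, t < T1 & W (s (t *: u))].
Proof.
have L0 : 0 <= L.
  by apply: divr_ge0; [apply: mulr_ge0; [exact: sqrtr_ge0|exact: pi_ge0]|exact: ltW].
pose a (i : nat) : R := T1 - T1 * i.+1%:R^-1.
have inv01 i : 0 < (i.+1%:R^-1 : R) <= 1.
  by rewrite invr_gt0 ltr0Sn /= invf_le1 ?ltr0Sn// ler1n.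
have aT i : 0 <= a i < T1.
  have /andP[i0 i1] := inv01 i; rewrite /a; apply/andP; split.
    by rewrite subr_ge0 ler_piMr// ltW.
  by rewrite gtrBl mulr_gt0.
have aclose (e : R) : 0 < e -> exists K : nat, forall i, (K <= i)%N -> T1 - e < a i.
  move=> e0; exists (Num.truncn (T1 / e)) => i Ki; rewrite /a ltrD2l ltrN2.
  rewrite ltr_pdivrMr ?ltr0Sn// mulrC -ltr_pdivrMr//.
  apply: lt_le_trans (truncnS_gt _) _.
  by rewrite ler_nat.
have [q Hq] : exists q : M, forall e : R, 0 < e -> exists K : nat, forall i : nat,
    (K <= i)%N -> (riemannian_dist g (s (a i *: u)) q < e%:E)%E.
  move: (Mcomplete); rewrite /complete_manifold => /(_ (fun i => s (a i *: u))).
  apply => e e0.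
  have e1 : 0 < e / (L + 1) by rewrite divr_gt0// ltr_wpDl.
  have [K HK] := aclose _ e1; exists K => i j Ki Kj.
  apply: (le_lt_trans (ray_dist_le (aT i) (aT j))); rewrite lte_fin.
  have d : `|a j - a i| < e / (L + 1).
    have := HK i Ki; have := HK j Kj; have := aT i; have := aT j.
    by rewrite ltr_norml; lra.
  apply: (@le_lt_trans _ _ ((L + 1) * `|a j - a i|)).
    by rewrite ler_wpM2r// lerDl.
  by rewrite mulrC -ltr_pdivlMr// ltr_wpDl.
have cluster (W : set M) (t0 : R) : open W -> W q -> t0 < T1 ->
    exists t, [/\ 0 <= t, t0 <= t, t < T1 & W (s (t *: u))].
  move=> oW Wq t0T; have [e e0 He] := dist_nbhs Ximm Nnormal oW Wq.
  have [K1 HK1] := Hq e e0.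
  have t0T' : 0 < T1 - t0 by rewrite subr_gt0.
  have [K2 HK2] := aclose _ t0T'.
  pose i := maxn K1 K2; have /andP[a0 aT1] := aT i.
  exists (a i); split => //.
    by have := HK2 i (leq_maxr _ _); lra.
  by apply: He; apply: HK1; exact: leq_maxl.
exists q; split => //; rewrite /normal_cap /=; case: ltP => // mq.
pose W := (fun q => dot (N q) (N p)) @^-1` [set x | x < c].
have oW : open W.
  apply: open_comp; last exact: open_lt.
  by move=> x _; apply: angle_continuous; exact: Nnormal.
have Wq : W q by rewrite /W /=; exact: le_lt_trans c0.
have [t [t0 _ tT Wt]] := cluster W 0 oW Wq T10.
have := rayc (t := t); rewrite t0 tT /= => /(_ isT).
by rewrite leNgt => /negP[].
Qed.

End Ray.

Hypothesis (Mcomplete : complete_manifold g).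

(** By [ray_cluster], a lower bound on the angle along the lifts keeps them from
escaping, which is what [radial_section] asks for. *)
Theorem projection_section : exists O s, star_section F M0 p O s /\
  forall u, (exists2 c : R, 0 < c & forall T1 : R, 0 < T1 <= 1 ->
      (forall t, 0 <= t < T1 -> O (t *: u)) ->
      forall t, 0 <= t < T1 -> c <= dot (N (s (t *: u))) (N p)) -> O u.
Proof.
have Fcont q : M0 q -> {for q, continuous F} by move=> _; apply: projection_continuous; exact: Ximm.
have Floc q : M0 q -> locally_invertible_at F M0 q.
  by exact: (projection_locally_invertible Ximm Nnormal EE NE).
have Mp : M0 p by rewrite /normal_cap /= (normal_unit Nnormal) ltr01.
have Fp : F p = 0 by rewrite /tangent_projection subrr mul0mx.
have [ O [s [sec H]]] := radial_section (@manifold_hausdorff _ _ M) Fcont Floc Mp Fp.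
exists O, s; split => // u [c c0 Hc]; apply: H => T1 T11 HT.
have /andP[T10 _] := T11.
exact: (ray_cluster sec T10 c0 HT (Hc T1 T11 HT)).
Qed.
End Lifts.

(** * Rays over a tangent hyperplane *)

Lemma mvt_exists {R : realType} (f : R -> R) (a b : R) (P : R -> Prop) : a < b ->
  (forall t, a <= t <= b -> {for t, continuous f}) ->
  (forall t : R, a < t < b -> exists2 d : R, is_derive t 1 f d & P d) ->
  exists2 d, P d & f b - f a = d * (b - a).
Proof.
move=> ab cf df.
have df' x : x \in `]a, b[ -> is_derive x 1 f ('D_1 f x).
  rewrite in_itv /= => /df[d Hd _]; apply: derivableP; by have [] := Hd.
have cf' : {within `[a, b], continuous f}.
  by apply: continuous_in_subspaceT => x; rewrite inE /= in_itv /=; exact: cf.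
have [c cab E] := MVT ab df' cf'.
move: cab; rewrite in_itv /= => /df[d [_ dE] Pd].
by exists d => //; rewrite E dE.
Qed.

(** Here k is the angle function, d its derivative, y and B the squared speeds of
the lift and of the normal along it. *)
Lemma product_derivative_bound {R : realType} (C U y B d k : R) : 0 < C ->
  B <= C ^+ 2 * y -> d ^+ 2 <= B -> k ^+ 2 * y <= U -> U <= (4 * C)^-1 ^+ 2 ->
  - 2^-1 <= k * d + k * d.
Proof.
move=> C0 B1 B2 B3 UC.
have H2 : (k * d) ^+ 2 <= 4^-1 ^+ 2.
  have D1 : d ^+ 2 <= C ^+ 2 * y by exact: le_trans B2 B1.
  have D2 : k ^+ 2 * d ^+ 2 <= k ^+ 2 * (C ^+ 2 * y) by rewrite ler_wpM2l ?sqr_ge0.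
  have D3 : C ^+ 2 * (k ^+ 2 * y) <= C ^+ 2 * (4 * C)^-1 ^+ 2.
    by rewrite ler_wpM2l ?sqr_ge0// (le_trans B3).
  have D4 : C ^+ 2 * (4 * C)^-1 ^+ 2 = 4^-1 ^+ 2.
    by field; rewrite gt_eqF.
  by rewrite -D4 exprMn (le_trans D2)// mulrCA.
have H3 : `|k * d| <= 4^-1 by rewrite -ler_sqr ?nnegrE// real_normK ?num_real.
have := ler_norml (k * d) 4^-1; rewrite H3 => /esym/andP[H4 _]; lra.
Qed.

Section Rays.
Context {R : realType} {n : nat} {M : smoothManifold R n} (g : riemannianMetric M).
Variables (X N : M -> 'rV[R]_n.+1).
Hypothesis (Ximm : isometric_immersion g X).
Hypothesis (Nnormal : unit_normal_field X N).

Lemma position_derive q (w : 'rV[R]_n) : (forall q, dot (X q) (N q) = 0) ->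
  dot (X q) (w *m differential N q) = 0.
Proof.
move=> flat; set c := chart_at q; set u := chart_coord c q.
have ac : atlas c by exact: chart_at_atlas.
have sq : source c q by exact: chart_at_source.
have tu : target c u by exact: coord_target.
have Eq : chart_param c u = q by exact: coordK.
have H : is_derive u w (fun y => dot ((X \o chart_param c) y) ((N \o chart_param c) y))
   (dot ('D_w (X \o chart_param c) u) ((N \o chart_param c) u) +
    dot ((X \o chart_param c) u) ('D_w (N \o chart_param c) u)).
  apply: is_derive_dot; apply: derivableP; first exact: (X_C1 Ximm ac).1.
  exact: (N_C1 Ximm Nnormal ac).1.
have flat' y : target c y -> dot ((X \o chart_param c) y) ((N \o chart_param c) y) = 0.
  by move=> _; exact: flat.
have := derive_zero_on (@target_open _ _ _ c) tu flat' H.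
have := normal_derive_X Ximm Nnormal w ac tu; rewrite dotC /= Eq => ->.
rewrite add0r => H0; apply: etrans H0; congr (dot _ _).
exact: (esym (derive_N Ximm Nnormal w ac tu)).
Qed.

(** When the position vector is everywhere tangent it lies in the kernel of the
shape operator: differentiating <X, N> = 0 shows that <X, dN w> = 0 for all w, and
the shape operator is self-adjoint. *)
Lemma normal_stationary q (x : 'rV[R]_n) : (forall q, dot (X q) (N q) = 0) ->
  X q = x *m differential X q -> x *m differential N q = 0.
Proof.
move=> flat Xq.
have H w : dot (x *m differential X q) (w *m differential N q) = 0.
  by rewrite -Xq; exact: position_derive.
have := second_form_symm Ximm Nnormal q; have := shape_differential Ximm Nnormal q.
move: H; generalize (differential X q) (differential N q) (shape_operator X N q).
move=> dX dN S H SX symm.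
have H' w : dot (x *m dN) (w *m dX) = 0.
  rewrite dot_trmx -mulmxA -symm trmx_mul trmxK mulmxA -[dN in LHS]trmxK -dot_trmx trmxK.
  exact: H.
have xN : x *m dN = (- (x *m S)) *m dX by rewrite mulNmx -mulmxA SX mulmxN opprK.
by apply/eqP; rewrite -dot_eq0 {2}xN H'.
Qed.

Variables (p : M) (E : 'M[R]_(n.+1, n)).
Hypothesis (EE : E^T *m E = 1%:M) (NE : N p *m E = 0).
Variables (O : set 'rV[R]_n) (s : 'rV[R]_n -> M).

Local Notation F := (tangent_projection X p E).
Local Notation M0 := (normal_cap N p).

Hypothesis (sec : star_section F M0 p O s).

(** The section and the local inverse of the projection agree near u, as both
land where the projection is injective. *)
Lemma section_near u : O u -> \forall x \near s u, O (F x) /\ s (F x) = x.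
Proof.
move=> Ou; have [oO _ _ HO] := sec; have [Mu Fu cu] := HO _ Ou.
have cF : {for s u, continuous F} by apply: projection_continuous; exact: Ximm.
have [V [e [s' [oV [Vq _] _ inj _]]]] := projection_locally_invertible Ximm Nnormal EE NE Mu.
have l1 : F x @[x --> s u] --> u by rewrite -[X in _ --> X]Fu; exact: cF.
have nO : \forall x \near s u, O (F x).
  by apply: l1; exact: (open_nbhs_nbhs (conj oO Ou)).
have nV : \forall x \near s u, V x by exact: (open_nbhs_nbhs (conj oV Vq)).
have nsV : \forall x \near s u, V (s (F x)).
  have l2 : s (F x) @[x --> s u] --> s u by exact: (cvg_comp _ _ l1 cu).
  by apply: l2; exact: (open_nbhs_nbhs (conj oV Vq)).
apply: filterS (filterI nO (filterI nV nsV)) => x [Ox [Vx Vsx]].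
split => //; apply: inj => //; by have [] := HO _ Ox.
Qed.

Section Ray.
Variable u : 'rV[R]_n.
Let gamma (r : R) : M := s (r *: u).
Let m (r : R) := dot (N (gamma r)) (N p).
Let v (t : R) := velocity gamma t.

Lemma ray_continuous (t : R) : O (t *: u) -> {for t, continuous gamma}.
Proof.
move=> Ot; have [_ _ _ HO] := sec; have [_ _ cs] := HO _ Ot.
have l : r *: u @[r --> t] --> t *: u.
  have l1 : r @[r --> t] --> t by exact: cvg_id.
  have l2 : (fun=> u) r @[r --> t] --> u by exact: cvg_cst.
  exact: (cvgZ l1 l2).
exact: (cvg_comp _ _ l cs).
Qed.

Lemma ray_angle_continuous (t : R) : O (t *: u) -> {for t, continuous m}.
Proof.
move=> Ot; have cN : {for gamma t, continuous (fun q => dot (N q) (N p))}.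
  by apply: angle_continuous; exact: Nnormal.
exact: (cvg_comp _ _ (ray_continuous Ot) cN).
Qed.

Lemma ray_derive (t : R) : O (t *: u) ->
  [/\ 0 < m t, is_derive t 1 (X \o gamma) (v t *m differential X (gamma t)),
      is_derive t 1 (N \o gamma) (v t *m differential N (gamma t)) &
      v t *m differential X (gamma t) *m E = u].
Proof.
move=> Ot; have [oO _ _ HO] := sec; have [Mt _ cs] := HO _ Ot.
have l : r *: u @[r --> t] --> t *: u.
  have l1 : r @[r --> t] --> t by exact: cvg_id.
  have l2 : (fun=> u) r @[r --> t] --> u by exact: cvg_cst.
  exact: (cvgZ l1 l2).
have dF : is_derive t 1 (F \o gamma) u.
  have H : is_derive t 1 (fun r : R => r *: u) ((1 : R) *: u).
    by apply: (@is_derive_scale R n id); exact: is_derive_id.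
  rewrite scale1r in H; apply: near_eq_is_derive H.
  have nO : \forall r \near t, O (r *: u) by apply: l; exact: (open_nbhs_nbhs (conj oO Ot)).
  by apply: filterS nO => r Or; have [_ FO _] := HO _ Or; exact: (esym FO).
have [dX dN vE] := lift_velocity Ximm Nnormal EE NE (ray_continuous Ot) Mt dF.
split; [exact: Mt|exact: dX|exact: dN|exact: vE].
Qed.

Lemma ray_angle_derive (t : R) : O (t *: u) ->
  is_derive t 1 m (dot (v t *m differential N (gamma t)) (N p)).
Proof.
move=> Ot; have [_ _ dN _] := ray_derive Ot.
have := is_derive_dot dN (is_derive_cst (N p) t (1 : R)).
by rewrite dot0r addr0.
Qed.

Lemma ray_angle0 : m 0 = 1.
Proof. by have [_ _ s0 _] := sec; rewrite /m /gamma scale0r s0 (normal_unit Nnormal). Qed.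

(** Let m be the angle function.  The lift has speed at most |u| / m and the normal
turns at most C times as fast, so the derivative of m^2 is at least - 2 C |u|: the
weight m in m m' compensates the loss of the projection. *)
Lemma short_ray_angle (C T1 : R) : 0 < C -> (forall q, shape_norm2 X N q <= C ^+ 2) ->
  dot u u <= (4 * C)^-1 ^+ 2 -> T1 <= 1 -> (forall t, 0 <= t < T1 -> O (t *: u)) ->
  forall t, 0 <= t < T1 -> 2^-1 <= m t.
Proof.
move=> C0 SC uC T11 HO t /andP[t0 tT].
move: t0; rewrite le_eqVlt => /orP[/eqP <-|t0].
  by rewrite ray_angle0 invf_le1 ?ler1n.
have Or r : 0 <= r <= t -> O (r *: u).
  by move=> /andP[r0 rt]; apply: HO; rewrite r0 (le_lt_trans rt tT).
have cm2 r : 0 <= r <= t -> {for r, continuous (fun r => m r * m r)}.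
  by move=> /Or/ray_angle_continuous cm; exact: cvgM.
have dm2 (r : R) : 0 < r < t -> exists2 d : R,
    is_derive r 1 (fun r => m r * m r) d & - 2^-1 <= d.
  move=> /andP[r0 rt]; have Ort : O (r *: u) by apply: Or; rewrite !ltW.
  have dm := ray_angle_derive Ort; have := is_deriveM dm dm => H.
  exists (m r *: dot (v r *m differential N (gamma r)) (N p) +
          m r *: dot (v r *m differential N (gamma r)) (N p)) => //.
  have [m0 _ _ vE] := ray_derive Ort.
  have B1 := differential_N_bound Ximm Nnormal (v r) (SC (gamma r)).
  have B2 := dot_CS (v r *m differential N (gamma r)) (N p).
  have nv : dot (N (gamma r)) (v r *m differential X (gamma r)) = 0.
    by case: Nnormal => _ _; apply.
  have B3 := projection_tangent EE (normal_unit Nnormal p) NE (normal_unit Nnormal _) nv.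
  rewrite vE in B3; rewrite (normal_unit Nnormal) mulr1 in B2.
  exact: (product_derivative_bound C0 B1 B2 B3 uC).
have [d Pd] := mvt_exists t0 cm2 dm2; rewrite ray_angle0 subr0 mulr1 => E1.
have m0 : 0 < m t by have [] := ray_derive (Or t _) => //; rewrite lexx ltW.
have : 2^-1 <= m t * m t by nra.
move: (m t) m0 => x x0 xx; rewrite leNgt; apply/negP => x2; nra.
Qed.

Section FlatRay.
Hypothesis flat : forall q, dot (X q) (N q) = 0.
Variables (b : 'rV[R]_n.+1) (alpha beta T1 : R).
Hypothesis (bN : dot b (N p) = 0) (Xp : X p = alpha *: b).
Hypothesis (uE : u = beta *: (b *m E)) (beta0 : beta != 0) (T10 : 0 < T1).
Hypothesis (lambda0 : forall t, 0 < t < T1 -> alpha + beta * t != 0).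
Hypothesis (rayO : forall t, 0 <= t < T1 -> O (t *: u)).

Let lambda (t : R) := alpha + beta * t.
Let h (t : R) := dot (X (gamma t)) (N p).

Let position t : 0 <= t < T1 -> X (gamma t) = lambda t *: b + h t *: N p.
Proof.
move=> /rayO Ot; have [_ _ _ HO] := sec; have [_ Ft _] := HO _ Ot.
have bE : b = b *m E *m E^T.
  by rewrite {1}(projection_decomposition EE (normal_unit Nnormal p) NE b) bN scale0r addr0.
rewrite {1}(projection_decomposition EE (normal_unit Nnormal p) NE (X (gamma t))).
congr (_ + _).
have -> : X (gamma t) *m E = lambda t *: (b *m E).
  have : (X (gamma t) - X p) *m E = t *: u by exact: Ft.
  rewrite mulmxBl Xp uE -scalemxAl scalerA => /eqP; rewrite subr_eq => /eqP ->.
  by rewrite -scalerDl /lambda addrC mulrC.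
by rewrite -scalemxAl -bE.
Qed.

Let velocity_position t : 0 <= t < T1 ->
  let dX := v t *m differential X (gamma t) in
  [/\ dX = beta *: b + dot dX (N p) *: N p,
      is_derive t 1 h (dot dX (N p)) &
      lambda t * dot dX (N p) = beta * h t].
Proof.
move=> t0T dX; have Ot := rayO t0T; have [m0 HX _ vE] := ray_derive Ot.
rewrite -/dX in HX vE.
have bE : b = b *m E *m E^T.
  by rewrite {1}(projection_decomposition EE (normal_unit Nnormal p) NE b) bN scale0r addr0.
have dXE : dX = beta *: b + dot dX (N p) *: N p.
  rewrite {1}(projection_decomposition EE (normal_unit Nnormal p) NE dX).
  by rewrite vE uE -scalemxAl -bE.
split => //.
  have := is_derive_dot HX (is_derive_cst (N p) t (1 : R)).
  by rewrite dot0r addr0.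
have H1 : dot (N (gamma t)) dX = 0 by case: Nnormal => _ _; apply.
have H2 : dot (N (gamma t)) (X (gamma t)) = 0 by rewrite dotC.
rewrite dXE dotDr !dotZr in H1; rewrite (position t0T) dotDr !dotZr in H2.
move: H1 H2 m0; rewrite -/(m t); move: (m t) (dot _ b) (dot dX _) (h t) (lambda t).
move=> k c h' h0 l H1 H2 k0.
have : (l * h' - beta * h0) * k = 0.
  transitivity (l * (beta * c + h' * k) - beta * (l * c + h0 * k)); first by ring.
  by rewrite H1 H2 !mulr0 subrr.
by move/eqP; rewrite mulf_eq0 (gt_eqF k0) orbF subr_eq0 => /eqP.
Qed.

Let interior t : 0 < t < T1 -> 0 <= t < T1.
Proof. by move=> /andP[/ltW -> ->]. Qed.

(* The height over the tangent hyperplane solves the same first order linear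
   equation as lambda, so that their quotient is constant. *)
Let height_proportional : exists k, forall t, 0 < t < T1 -> h t = k * lambda t.
Proof.
pose f t := h t * (lambda t)^-1.
have dlambda (t : R) : is_derive t 1 lambda beta.
  have H := is_deriveD (is_derive_cst alpha t (1 : R)) (is_deriveZ beta (is_derive_id t (1 : R))).
  by apply: (is_derive_eq H); rewrite add0r [_ *: _]mulr1.
have df t : 0 < t < T1 -> is_derive t 1 f 0.
  move=> t0T; have [_ Hh Eh] := velocity_position (interior t0T).
  have l0 : lambda t != 0 by exact: lambda0.
  have H := is_deriveM Hh (@is_deriveV R lambda t beta 1 l0 (dlambda t)).
  apply: (is_derive_eq H); move: Eh l0.
  move: (dot _ (N p)) (h t) (lambda t) => h' h0 l El l0.
  rewrite /GRing.scale /=; have -> : h' = beta * h0 / l by rewrite -El mulrC mulKf.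
  by field.
have const t1 t2 : 0 < t1 -> t1 < t2 -> t2 < T1 -> f t2 = f t1.
  move=> t10 t12 t2T.
  have inT t : t1 <= t <= t2 -> 0 < t < T1.
    by move=> /andP[a1 a2]; rewrite (lt_le_trans t10 a1) (le_lt_trans a2 t2T).
  have cf t : t1 <= t <= t2 -> {for t, continuous f}.
    move=> /inT t0T; apply: differentiable_continuous; apply/derivable1_diffP.
    by have [] := df t t0T.
  have df' t : t1 < t < t2 -> exists2 d : R, is_derive t 1 f d & d = 0.
    by move=> /andP[a1 a2]; exists 0 => //; apply: df; apply: inT; rewrite !ltW.
  have [d -> ] := mvt_exists t12 cf df'; rewrite mul0r => /eqP.
  by rewrite subr_eq0 => /eqP.
exists (f (T1 / 2)) => t /andP[t0 tT].
have m0 : 0 < T1 / 2 < T1 by rewrite divr_gt0//= ltr_pdivrMr// ltr_pMr// ltr1n.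
have l0 : lambda t != 0 by apply: lambda0; rewrite t0.
have -> : f (T1 / 2) = f t.
  have /andP[m1 m2] := m0.
  by case: (ltrgtP t (T1 / 2)) => [tm|mt|-> //]; [exact: const|symmetry; exact: const].
by rewrite /f mulfVK.
Qed.

(* If the height were k * lambda, the direction b + k N p of the ray would be
   orthogonal to all normals along it, hence also to N p in the limit. *)
Let height_zero t : 0 < t < T1 -> h t = 0.
Proof.
have [k Hk] := height_proportional; suff k0 : k = 0 by move=> /Hk ->; rewrite k0 mul0r.
pose psi t := dot (b + k *: N p) (N (gamma t)).
have psi0 : psi 0 = k.
  have [_ _ s0 _] := sec.
  by rewrite /psi /gamma scale0r s0 dotDl dotZl bN (normal_unit Nnormal) mulr1 add0r.
have psit r : 0 < r < T1 -> psi r = 0.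
  move=> r0T; have := flat (gamma r); rewrite (position (interior r0T)) (Hk r r0T).
  rewrite (mulrC k) -scalerA -scalerDr dotZl => /eqP; rewrite mulf_eq0.
  by rewrite (negbTE (lambda0 r0T)) => /eqP.
have O0 : O (0 *: u) by apply: rayO; rewrite lexx.
have cpsi : {for 0, continuous psi}.
  have cN : {for gamma 0, continuous N} by case: Nnormal => cN _ _; exact: cN.
  have l : N (gamma r) @[r --> (0 : R)] --> N (gamma 0).
    exact: (cvg_comp _ _ (ray_continuous O0) cN).
  have l' : (fun=> b + k *: N p) r @[r --> (0 : R)] --> b + k *: N p by exact: cvg_cst.
  exact: (cvg_dot l' l).
apply/eqP/negP => /negP k0.
have e0 : 0 < `|k| by rewrite normr_gt0.
have : \forall r \near (0 : R), ball (psi 0) `|k| (psi r).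
  by apply: cpsi; exact: nbhsx_ballx.
case=> d /= d0 Hd; pose r := Num.min (d / 2) (T1 / 2).
have r0 : 0 < r by rewrite lt_min !divr_gt0.
have rT : r < T1 by rewrite gt_min; apply/orP; right; rewrite ltr_pdivrMr// ltr_pMr// ltr1n.
have rd : r < d by rewrite gt_min; apply/orP; left; rewrite ltr_pdivrMr// ltr_pMr// ltr1n.
have := Hd r; rewrite /ball_ /= sub0r normrN (gtr0_norm r0) => /(_ rd).
by rewrite psi0 psit ?r0// -ball_normE /ball_ /= subr0 ltxx.
Qed.

(** When all tangent hyperplanes pass through the origin, the hypersurface is ruled
by straight lines towards the origin along which the normal is constant.  The two
cases needed are the ray from p towards the origin (alpha = 1, beta = - 1, b = X p)
and any ray from a point at the origin (alpha = 0, beta = 1). *)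
Lemma flat_ray t : 0 <= t < T1 -> X (gamma t) = lambda t *: b /\ m t = 1.
Proof.
move=> t0T; have /andP[] := t0T; rewrite le_eqVlt => /orP[/eqP <-|t0] tT.
  have [_ _ s0 _] := sec.
  by rewrite ray_angle0 /gamma scale0r s0 Xp /lambda mulr0 addr0.
split; first by rewrite (position t0T) height_zero ?t0// scale0r addr0.
have Or r : 0 <= r <= t -> O (r *: u).
  by move=> /andP[r0 rt]; apply: rayO; rewrite r0 (le_lt_trans rt tT).
have cm r : 0 <= r <= t -> {for r, continuous m}.
  by move=> /Or; exact: ray_angle_continuous.
have dm (r : R) : 0 < r < t -> exists2 d : R, is_derive r 1 m d & d = 0.
  move=> /andP[r0 rt]; have r0T : 0 < r < T1 by rewrite r0 (lt_trans rt tT).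
  have Ort : O (r *: u) by apply: Or; rewrite !ltW.
  exists (dot (v r *m differential N (gamma r)) (N p)); first exact: ray_angle_derive.
  have [dXE _ El] := velocity_position (interior r0T).
  have hr := height_zero r0T.
  have h'0 : dot (v r *m differential X (gamma r)) (N p) = 0.
    move: El; rewrite hr mulr0 => /eqP; rewrite mulf_eq0.
    by rewrite (negbTE (lambda0 r0T)) => /eqP.
  have Xr : X (gamma r) = (lambda r / beta *: v r) *m differential X (gamma r).
    rewrite -scalemxAl dXE h'0 scale0r addr0 scalerA divfK//.
    by rewrite (position (interior r0T)) hr scale0r addr0.
  have := normal_stationary flat Xr; rewrite -scalemxAl => /eqP.
  rewrite scaler_eq0 mulf_eq0 invr_eq0 (negbTE beta0) (negbTE (lambda0 r0T)) /=.
  by move=> /eqP ->; rewrite dot0l.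
have [d -> ] := mvt_exists t0 cm dm; rewrite mul0r ray_angle0 => /eqP.
by rewrite subr_eq0 => /eqP.
Qed.

End FlatRay.

End Ray.
End Rays.

(** * Cones and the vanishing of the curvature *)

Lemma weighted_sum_bound {R : realType} n (k a : 'I_n -> R) (z C : R) : 1 <= C ->
  (forall i, 0 <= k i <= C) -> (forall i, a i <= 1) -> z <= 1 ->
  \sum_i \prod_(j | j != i) k j * (a i + k i * z) <= n%:R * (C ^+ n * (1 + C)).
Proof.
move=> C1 kC a1 z1; have C0 : 0 <= C by exact: le_trans C1.
have -> : n%:R * (C ^+ n * (1 + C)) = \sum_(i < n) C ^+ n * (1 + C).
  by rewrite sumr_const card_ord mulr_natl.
apply: ler_sum => i _; have /andP[ki0 kiC] := kC i.
have P0 : 0 <= \prod_(j | j != i) k j by apply: prodr_ge0 => j _; have /andP[] := kC j.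
have PC : \prod_(j | j != i) k j <= C ^+ n.
  rewrite -[X in C ^+ X](card_ord n) -prodr_const big_mkcond /=.
  by apply: ler_prod => j _; case: ifP => _; rewrite ?kC ?ler01 ?C1.
apply: (@le_trans _ _ (\prod_(j | j != i) k j * (1 + C))).
  rewrite ler_wpM2l// lerD//; apply: le_trans kiC.
  by rewrite ler_piMr.
by apply: ler_wpM2r PC; rewrite addr_ge0.
Qed.

Lemma sqr_norm_continuous {R : realType} n : continuous (fun u : 'rV[R]_n => dot u u).
Proof.
move=> u; have l : (fun y : 'rV[R]_n => y) y @[y --> nbhs u] --> u by move=> A; exact.
exact: (@cvg_dot R _ (nbhs u) (nbhs_filter u) n (fun y => y) (fun y => y) u u l l).
Qed.

Lemma half_le {R : realType} (k d x y : R) :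
  k - d < y - x -> d <= k / 2 -> 0 <= x -> k / 2 <= y.
Proof. lra. Qed.

Lemma le1_of_sqr {R : realType} (x y : R) : x ^+ 2 <= y -> y <= 1 -> x <= 1.
Proof. by move=> xy y1; rewrite leNgt; apply/negP => x1; nra. Qed.

Lemma row_neg_diag_mul {R : realType} n m (k : 'rV[R]_n) (A D : 'M[R]_(n, m)) i :
  A = - (diag_mx k *m D) -> row i A = - (k 0 i *: row i D).
Proof. by move=> ->; apply/rowP => j; rewrite mxE [LHS]mxE mul_diag_mx !mxE. Qed.

Section Conclusion.
Context {R : realType} {n : nat} {M : smoothManifold R n} (g : riemannianMetric M).
Variables (X N : M -> 'rV[R]_n.+1).
Hypothesis (Mconn : connected_manifold M).
Hypothesis (Ximm : isometric_immersion g X).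
Hypothesis (Nnormal : unit_normal_field X N).
Hypothesis (Mcomplete : complete_manifold g).

(** The ray from any point towards the origin lifts completely, by [flat_ray], and
ends at a point o over the origin.  From o all rays lift to straight lines, so the
section is defined on the whole tangent space; its image is open because it
inverts a local homeomorphism, and closed because it is the set where [s \o F] is
the identity. *)
Theorem cone_hyperplane : (forall q, dot (X q) (N q) = 0) -> hyperplane (range X).
Proof.
move=> flat; have [[p _] conn] := Mconn.
have [ o Xo] : exists o, X o = 0.
  have [E [EE NE]] := tangent_frame Ximm Nnormal p.
  have [ O [s [sec HO]]] := projection_section Ximm Nnormal EE NE Mcomplete.
  pose u := -1 *: (X p *m E).
  have Ou : O u.
    apply: HO; exists 2^-1 => [|T1 /andP[T10 T11] rayO t tT]; first by rewrite invr_gt0.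
    have l0 t' : 0 < t' < T1 -> (1 : R) + -1 * t' != 0.
      move=> /andP[_ t'T]; rewrite mulN1r subr_eq0 gt_eqF//; exact: lt_le_trans T11.
    have N10 : (-1 : R) != 0 by rewrite oppr_eq0 oner_eq0.
    have [_ ->] := flat_ray Ximm Nnormal EE NE sec flat (flat p) (esym (scale1r (X p)))
      (erefl u) N10 T10 l0 rayO tT.
    by rewrite invf_le1 ?ler1n.
  have [_ _ _ /(_ u Ou)[Mo Fo _]] := sec.
  exists (s u); have := projection_decomposition EE (normal_unit Nnormal p) NE (X (s u)).
  have -> : X (s u) *m E = 0.
    have : (X (s u) - X p) *m E = u by exact: Fo.
    rewrite mulmxBl /u scaleN1r => /eqP; rewrite subr_eq addNr => /eqP; exact.
  rewrite mul0mx add0r => Xo; have := flat (s u); rewrite Xo dotZl (dotC (N p)) => /eqP.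
  rewrite mulf_eq0 (gt_eqF Mo) orbF => /eqP h0.
  by rewrite h0 scale0r.
have [E [EE NE]] := tangent_frame Ximm Nnormal o.
have [ O [s [sec HO]]] := projection_section Ximm Nnormal EE NE Mcomplete.
have tangent (u : 'rV[R]_n) : dot (u *m E^T) (N o) = 0 by exact: dot_tangent.
have uE (u : 'rV[R]_n) : u = 1 *: (u *m E^T *m E) by rewrite -mulmxA EE mulmx1 scale1r.
have Xo0 (u : 'rV[R]_n) : X o = 0 *: (u *m E^T) by rewrite scale0r.
have l0 (T1 t' : R) : 0 < t' < T1 -> (0 : R) + 1 * t' != 0.
  by move=> /andP[t'0 _]; rewrite add0r mul1r gt_eqF.
have Oall u : O u.
  apply: HO; exists 2^-1 => [|T1 /andP[T10 T11] rayO t tT]; first by rewrite invr_gt0.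
  have [_ ->] := flat_ray Ximm Nnormal EE NE sec flat (tangent u) (Xo0 u) (uE u)
    (oner_neq0 R) T10 (l0 T1) rayO tT.
  by rewrite invf_le1 ?ler1n.
have Xs u : X (s u) = u *m E^T.
  have T20 : (0 : R) < 2 by [].
  have tT : 0 <= (1 : R) < 2 by rewrite ler01 ltr1n.
  have [+ _] := flat_ray Ximm Nnormal EE NE sec flat (tangent u) (Xo0 u) (uE u)
    (oner_neq0 R) T20 (l0 2) (fun t _ => Oall _) tT.
  by rewrite scale1r add0r mulr1 scale1r.
have surj : range s = [set: M].
  apply: (conn (range s)).
  - by exists (s 0); exists 0.
  - exists (range s); last by rewrite setTI.
    rewrite openE => _ [u _ <-]; apply: filterS (section_near Ximm Nnormal EE NE sec (Oall u)).
    by move=> x [_ <-]; exists (tangent_projection X o E x).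
  - exists (range s); last by rewrite setTI.
    pose F := tangent_projection X o E.
    have sF : range s = [set x | s (F x) = x].
      apply/seteqP; split => [_ [u _ <-] /=|x /= <-]; last by exists (F x).
      by have [_ _ _ /(_ u (Oall u))[_ Fu _]] := sec; rewrite /F Fu.
    rewrite sF => x clx /=; apply/eqP/negP => /negP neq.
    have := @manifold_hausdorff _ _ M; rewrite open_hausdorff => /(_ _ _ neq).
    move=> [[A B] /= [As Bx] [oA oB AB]]; rewrite !inE in As Bx.
    have cF : {for x, continuous F} by apply: projection_continuous; exact: Ximm.
    have [_ _ _ /(_ _ (Oall (F x)))[_ _ cs]] := sec.
    have l : s (F y) @[y --> x] --> s (F x) by exact: (cvg_comp _ _ cF cs).
    have nA : \forall y \near x, A (s (F y)).
      by apply: l; exact: (open_nbhs_nbhs (conj oA As)).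
    have nB : \forall y \near x, B y by exact: (open_nbhs_nbhs (conj oB Bx)).
    have [y [/= sy [Ay By]]] := clx _ (filterI nA nB).
    by rewrite sy in Ay; move/eqP/seteqP: AB => [/(_ y) AB0 _]; apply: AB0.
exists (N o), 0; split.
  by apply/eqP => N0; have := normal_unit Nnormal o; rewrite N0 dot0l => /eqP; rewrite eq_sym oner_eq0.
apply/seteqP; split => [_ [q _ <-] /=|x /= xN].
  have : [set: M] q by []; rewrite -surj => -[u _ <-].
  by rewrite Xs tangent.
exists (s (x *m E)) => //; rewrite Xs.
have := projection_decomposition EE (normal_unit Nnormal o) NE x.
by rewrite xN scale0r addr0.
Qed.

Hypothesis (Mconvex : weakly_convex g X N).
Hypothesis (Mshrinker : gauss_self_shrinker X N).
Let K := gauss_kronecker X N.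

Lemma curvature_bounds p (C : R) : 0 <= C -> shape_norm2 X N p <= C ^+ 2 ->
  0 <= K p <= C ^+ n.
Proof.
move=> C0 SC; have [b [k [[_ _ [Pk _] _ Sk] k0]]] := principal_frame Ximm Nnormal p.
have {}k0 := k0 Mconvex; rewrite /K -Pk prodr_ge0//= -[X in C ^+ X](card_ord n) -prodr_const.
apply: ler_prod => i _; rewrite k0 /=.
rewrite -ler_sqr ?nnegrE//; apply: le_trans SC; rewrite -Sk (bigD1 i)//= lerDl.
by apply: sumr_ge0 => j _; exact: sqr_ge0.
Qed.

Lemma curvature_continuous : continuous K.
Proof.
have -> : K = (fun q => - dot (X q) (N q)) by apply/funext => q; exact: Mshrinker.
move=> q; apply: cvgN; apply: cvg_dot.
  by apply: X_continuous; exact: Ximm.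
by case: Nnormal => cN _ _; exact: cN.
Qed.

(** [shrinker_local_inequality] in a chart at q and a principal frame, with its
right hand side bounded by means of the bound C on the principal curvatures. *)
Lemma penalized_maximum p q (E : 'M[R]_(n.+1, n)) (mu C : R) :
  E^T *m E = 1%:M -> N p *m E = 0 -> 0 <= mu -> 1 <= C ->
  (forall q, shape_norm2 X N q <= C ^+ 2) ->
  (let F := tangent_projection X p E in dot (F q) (F q) <= 1 /\
   \forall x \near q, K x - mu / 2 * dot (F x) (F x) <= K q - mu / 2 * dot (F q) (F q)) ->
  K q * (n%:R - K q * mean_curvature X N q) <= mu * (n%:R * (C ^+ n * (1 + C))).
Proof.
move=> EE NE mu0 C1 SC /= [F1 near_max].
have [B [oB Bq] HB] := near_open near_max.
have [b [k [[[ub bb] bN [Pk _] Sk Sk2] k0]]] := principal_frame Ximm Nnormal q.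
have {}k0 := k0 Mconvex; have C0 : 0 <= C by exact: le_trans C1.
have kC i : k 0 i <= C.
  rewrite -ler_sqr ?nnegrE//; apply: le_trans (SC q); rewrite -Sk2 (bigD1 i)//= lerDl.
  by apply: sumr_ge0 => j _; exact: sqr_ge0.
set c := chart_at q; set u0 := chart_coord c q.
have ac : atlas c by exact: chart_at_atlas.
have sq : source c q by exact: chart_at_source.
have tq : target c u0 by exact: coord_target.
have Eq : chart_param c u0 = q by exact: coordK.
pose U := target c `&` chart_param c @^-1` B.
have oU : open U by exact: open_in_chart.
have Uu : U u0 by split => //=; rewrite Eq.
pose Y := X \o chart_param c; pose Nc := N \o chart_param c.
have sub (f : 'rV[R]_n -> 'rV[R]_n.+1) : C1_on (target c) f -> C1_on U f.
  by move=> [D1 D2]; split=> [x v [tx _]|v x [tx _]]; [exact: D1|exact: D2].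
have Y1 : C1_on U Y by apply: sub; exact: (X_C1 Ximm ac).
have Y2 v : C1_on U ('D_v Y) by apply: sub; exact: (X_C1' Ximm v ac).
have Y3 v w : C1_on U ('D_w ('D_v Y)) by apply: sub; exact: (X_C1'' Ximm v w ac).
have N1 u v : U u -> derivable Nc u v by move=> [tu _]; exact: (N_C1 Ximm Nnormal ac).1.
have N2 v w : derivable ('D_v Nc) u0 w by apply: N_C2 ac tq; [exact: Ximm|exact: Nnormal].
have NN u : U u -> dot (Nc u) (Nc u) = 1 by move=> _; exact: (normal_unit Nnormal _).
have NY u v : U u -> dot (Nc u) ('D_v Y u) = 0.
  by move=> [tu _]; exact: (normal_derive_X Ximm Nnormal v ac tu).
have shr u : U u -> (K \o chart_param c) u = - dot (Y u) (Nc u) by move=> _; exact: Mshrinker.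
have Kdet u : U u -> (K \o chart_param c) u *
    \det (\matrix_(i, j) dot ('D_(row i b) Y u) ('D_(row j b) Y u)) =
  \det (\matrix_(i, j) dot (Nc u) ('D_(row i b) ('D_(row j b) Y) u)).
  by move=> [tu _]; exact: (curvature_det Ximm Nnormal b ac tu).
have DY i : 'D_(row i b) Y u0 = row i (b *m differential X q).
  by apply: (etrans (derive_X Ximm (row i b) ac tq)); rewrite row_mul.
have frame i j : dot ('D_(row i b) Y u0) ('D_(row j b) Y u0) = (i == j)%:R.
  by rewrite !DY -mulmx_tr_entry bb mxE.
have DN i : 'D_(row i b) Nc u0 = - (k 0 i *: row i (b *m differential X q)).
  apply: (etrans (derive_N Ximm Nnormal (row i b) ac tq)).
  apply: (@eq_trans _ _ (row i (b *m differential N q))); first by rewrite row_mul.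
  exact: (row_neg_diag_mul i bN).
have principal i j : dot (Nc u0) ('D_(row i b) ('D_(row j b) Y) u0) = k 0 i *+ (i == j).
  have H := second_form Ximm Nnormal (row j b) (row i b) ac tq.
  have {}H : dot (Nc u0) ('D_(row i b) ('D_(row j b) Y) u0) =
      - dot ('D_(row i b) Nc u0) ('D_(row j b) Y u0) by rewrite H opprK.
  by rewrite H DN DY dotNl opprK dotZl -mulmx_tr_entry bb mxE mulr_natr.
have Yu0 : Y u0 = X q by rewrite /Y /= Eq.
have Ku0 : (K \o chart_param c) u0 = K q by rewrite /= Eq.
have phi_max u : U u ->
    (K \o chart_param c) u - mu / 2 * dot ((Y u - X p) *m E) ((Y u - X p) *m E) <=
    (K \o chart_param c) u0 - mu / 2 * dot ((Y u0 - X p) *m E) ((Y u0 - X p) *m E).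
  by move=> [_ Bu]; rewrite Yu0 Ku0; exact: HB.
have Y1' i : dot ('D_(row i b) Y u0 *m E) ('D_(row i b) Y u0 *m E) <= 1.
  apply: (le_trans (projection_le EE (normal_unit Nnormal p) NE _)).
  exact: (eq_ind_r (fun x => x <= 1) (lexx _) (etrans (frame i i) (congr1 (fun b : bool => b%:R) (eqxx i)))).
have Z1 : dot ((Y u0 - X p) *m E *m E^T) (Nc u0) <= 1.
  rewrite Yu0; have := dot_CS ((X q - X p) *m E *m E^T) (Nc u0).
  rewrite (projection_isometry EE) (NN _ Uu) mulr1.
  by move=> /le1_of_sqr; apply; exact: F1.
have kbound i : 0 <= k 0 i <= C by rewrite k0 kC.
have H := shrinker_local_inequality oU Uu Y1 Y2 Y3 N1 N2 NN NY shr Kdet frame principal k0 phi_max.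
have HK (a h : R) : a = K q -> h = mean_curvature X N q ->
  a * (n%:R - a * h) = K q * (n%:R - K q * mean_curvature X N q) by move=> -> ->.
rewrite -(HK _ _ Ku0 Sk).
exact: (le_trans H (ler_wpM2l mu0 (weighted_sum_bound C1 kbound Y1' Z1))).
Qed.

(** Were the supremum kappa of K positive, take p with K p close to kappa.  On a
disc of radius 1 / (4 C) around p, independent of p, the curvature penalized by
mu / 2 times the squared distance has an interior maximum, where
kappa / 2 * e <= K (n - H K) <= mu * D.  This is false for small mu. *)
Theorem shrinker_flat (C e : R) : 1 <= C -> (forall q, shape_norm2 X N q <= C ^+ 2) ->
  0 < e -> (forall q, mean_curvature X N q * K q <= n%:R - e) -> forall q, K q = 0.
Proof.
move=> C1 SC e0 HKe; have C0 : 0 < C by exact: lt_le_trans C1.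
have Kb q : 0 <= K q <= C ^+ n by apply: curvature_bounds (SC q); exact: ltW.
move=> q0; apply/eqP/negP => /negP K0.
have Kq0 : 0 < K q0 by rewrite lt_neqAle eq_sym K0; have /andP[] := Kb q0.
have supK : has_sup (range K).
  by split; [exists (K q0), q0|exists (C ^+ n) => _ [q _ <-]; have /andP[] := Kb q].
set kappa := sup (range K).
have Kle q : K q <= kappa by apply: ub_le_sup; [case: supK|exists q].
have kappa0 : 0 < kappa by exact: lt_le_trans (Kle q0).
pose D := n%:R * (C ^+ n * (1 + C)).
have D0 : 0 <= D by rewrite mulr_ge0// mulr_ge0 ?exprn_ge0 ?addr_ge0// ltW.
pose mu := Num.min kappa (kappa / 2 * e / (D + 1)).
have mu0 : 0 < mu.
  by rewrite lt_min kappa0/= divr_gt0 ?ltr_wpDl// mulr_gt0// divr_gt0.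
have muD : mu * D < kappa / 2 * e.
  have D1 : 0 < D + 1 by rewrite ltr_wpDl.
  apply: (@lt_le_trans _ _ (mu * (D + 1))); first by rewrite ltr_pM2l// ltrDl.
  by rewrite -ler_pdivlMr// ge_min lexx orbT.
pose r0 := (4 * C)^-1.
have r00 : 0 < r0 by rewrite invr_gt0 mulr_gt0.
have r01 : r0 ^+ 2 <= 1.
  rewrite expr_le1//; last exact: ltW.
  have C4 : 0 < 4 * C by rewrite mulr_gt0.
  by rewrite /r0 invf_le1//; lra.
(* On the boundary of the disc the penalty is eta, more than kappa - K p. *)
pose eta := mu / 2 * r0 ^+ 2.
have mu20 : 0 < mu / 2 by rewrite divr_gt0.
have eta0 : 0 < eta by apply: mulr_gt0 => //; exact: exprn_gt0.
have etak : eta <= kappa / 2.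
  rewrite /eta; apply: (@le_trans _ _ (mu / 2 * 1)).
    by rewrite ler_wpM2l// divr_ge0// ltW.
  by rewrite mulr1 ler_wpM2r ?invr_ge0// ge_min lexx.
have [_ [p _ <-] Kp] := sup_adherent eta0 supK.
rewrite -/kappa in Kp.
have [E [EE NE]] := tangent_frame Ximm Nnormal p.
have [ O [s [sec HO]]] := projection_section Ximm Nnormal EE NE Mcomplete.
pose B := [set u : 'rV[R]_n | dot u u <= r0 ^+ 2].
have BO u : B u -> O u.
  move=> Bu; apply: HO; exists 2^-1 => [|T1 /andP[T10 T11] rayO]; first by rewrite invr_gt0.
  exact: (short_ray_angle Ximm Nnormal EE NE sec C0 SC Bu T11 rayO).
pose psi u := K (s u) - mu / 2 * dot u u.
have cpsi : {within B, continuous psi}.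
  apply: continuous_in_subspaceT => u; rewrite inE => /BO Ou.
  have [_ _ _ /(_ u Ou)[_ _ cs]] := sec.
  have cK : {for s u, continuous K} by exact: curvature_continuous.
  have l : K (s y) @[y --> u] --> K (s u) by exact: (cvg_comp _ _ cs cK).
  have l' : dot y y @[y --> u] --> dot u u by exact: sqr_norm_continuous.
  have penalize (T : Type) (G : set_system T) (FG : Filter G) (f h : T -> R) (a b c : R) :
      f x @[x --> G] --> a -> h x @[x --> G] --> b -> f x - c * h x @[x --> G] --> a - c * b.
    by move=> fa hb; apply: cvgB => //; apply: cvgM => //; exact: cvg_cst.
  exact: (@penalize _ (nbhs u) (nbhs_filter u) (K \o s) (fun y => dot y y) _ _ _ l l').
have cB : compact B.
  apply: bounded_closed_compact.
    exists r0; split; first exact: num_real.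
    move=> y yr u /= Bu; apply: ltW; apply: le_lt_trans yr.
    apply: mx_norm_le => [|i j]; first exact: ltW.
    rewrite ord1 -(@ler_pXn2r _ 2)// ?nnegrE ?(ltW r00)// real_normK ?num_real//.
    apply: le_trans Bu.
    rewrite /dot (bigD1 j)//= -expr2 lerDl; apply: sumr_ge0 => l _.
    by rewrite -expr2 sqr_ge0.
  have -> : B = (fun u : 'rV[R]_n => dot u u) @^-1` [set y | y <= r0 ^+ 2] by [].
  apply: closed_comp; last exact: closed_le.
  by move=> u _; exact: sqr_norm_continuous.
have B0 : B 0 by rewrite /B /= dot0l sqr_ge0.
have [u1 /set_mem Bu1 Hmax] := EVT_max_rV (ex_intro _ 0 B0) cB cpsi.
have {}Hmax u : B u -> psi u <= psi u1 by move=> Bu; apply: Hmax; exact: mem_set.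
have [_ _ s0 HsO] := sec.
have psi0 : kappa - eta < psi u1.
  apply: lt_le_trans (Hmax 0 B0); rewrite /psi s0 dot0l mulr0 subr0; exact: Kp.
pose q := s u1.
have uu0 : 0 <= dot u1 u1 by exact: dot_ge0.
have u1int : dot u1 u1 < r0 ^+ 2.
  rewrite ltNge; apply/negP => ru; move: psi0; rewrite ltNge => /negP; apply.
  rewrite /psi; apply: lerB; first exact: Kle.
  by apply: ler_wpM2l => //; exact: ltW.
have Kq : kappa / 2 <= K q.
  have h : 0 <= mu / 2 * dot u1 u1 by rewrite mulr_ge0// divr_ge0// ltW.
  exact: (half_le psi0 etak h).
have Ou1 := BO _ Bu1; have [_ Fq _] := HsO _ Ou1.
have near_max : \forall x \near q,
    let F := tangent_projection X p E in
    K x - mu / 2 * dot (F x) (F x) <= K q - mu / 2 * dot (F q) (F q).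
  have nF : \forall x \near q, dot (tangent_projection X p E x) (tangent_projection X p E x) < r0 ^+ 2.
    have cF : {for q, continuous (tangent_projection X p E)}.
      by apply: projection_continuous; exact: Ximm.
    pose f x := dot (tangent_projection X p E x) (tangent_projection X p E x).
    have l : f x @[x --> q] --> f q by exact: (cvg_dot cF cF).
    have fq : f q < r0 ^+ 2 by rewrite /f Fq.
    have nb : nbhs (f q) [set x | x < r0 ^+ 2].
      by apply: open_nbhs_nbhs; split; [exact: open_lt|exact: fq].
    exact: (l _ nb).
  apply: filterS (filterI nF (section_near Ximm Nnormal EE NE sec Ou1)).
  move=> x [Fx [Ox sx]] /=; have := Hmax _ (ltW Fx); rewrite /psi sx -/q Fq; exact.
have F1 : dot (tangent_projection X p E q) (tangent_projection X p E q) <= 1.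
  by rewrite Fq; apply: le_trans r01; exact: Bu1.
have := penalized_maximum EE NE (ltW mu0) C1 SC (conj F1 near_max).
rewrite -/D; apply/negP; rewrite -ltNge; apply: (lt_le_trans muD).
have HKq := HKe q; rewrite mulrC in HKq.
apply: ler_pM => //; [by rewrite divr_ge0 ?ltW|exact: ltW|].
by rewrite lerBrDr addrC -lerBrDr.
Qed.

End Conclusion.

Theorem corollary1p4 (R : realType) (n : nat) (M : smoothManifold R n)
    (g : riemannianMetric M) (X N : M -> 'rV[R]_n.+1)
    (Mconn : connected_manifold M)
    (Ximm : isometric_immersion g X)
    (Nnormal : unit_normal_field X N)
    (Mcomplete : complete_manifold g)
    (Mconvex : weakly_convex g X N)
    (Mshrinker : gauss_self_shrinker X N)
    (supA : (ereal_sup (range (fun p : M => (shape_norm2 X N p)%:E)) < +oo)%E)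
    (supHK : (ereal_sup (range (fun p : M =>
                (mean_curvature X N p * gauss_kronecker X N p)%:E))
              < n%:R%:E)%E) :
  hyperplane (range X).
Proof.
have [C C1 SC] : exists2 C : R, 1 <= C & forall q, shape_norm2 X N q <= C ^+ 2.
  have ub q : ((shape_norm2 X N q)%:E <= ereal_sup (range (fun p : M => (shape_norm2 X N p)%:E)))%E.
    by apply: ereal_sup_ubound; exists q.
  move: supA ub; case: (ereal_sup _) => [a _ ub||] //.
    exists (1 + `|a|) => [|q]; first by rewrite lerDl.
    have := ub q; rewrite lee_fin => /le_trans; apply; apply: le_trans (ler_norm a) _.
    by have := normr_ge0 a; move: `|a| => b b0; nra.
  by move=> _ ub; exists 1 => // q; have := ub q.
have [e e0 HKe] : exists2 e : R, 0 < e &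
    forall q, mean_curvature X N q * gauss_kronecker X N q <= n%:R - e.
  have ub q : ((mean_curvature X N q * gauss_kronecker X N q)%:E <=
      ereal_sup (range (fun p : M => (mean_curvature X N p * gauss_kronecker X N p)%:E)))%E.
    by apply: ereal_sup_ubound; exists q.
  move: supHK ub; case: (ereal_sup _) => [a aH ub||] //.
    exists (n%:R - a); first by rewrite subr_gt0 -lte_fin.
    by move=> q; have := ub q; rewrite lee_fin opprB addrCA subrr addr0.
  by move=> _ ub; exists 1 => // q; have := ub q.
have K0 := shrinker_flat Ximm Nnormal Mcomplete Mconvex Mshrinker C1 SC e0 HKe.
apply: (cone_hyperplane Mconn Ximm Nnormal Mcomplete) => q.
by have := Mshrinker q; rewrite K0 => /esym/eqP; rewrite oppr_eq0 => /eqP.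
Qed.
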